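(* Let $T\colon X\to X$ be a Ritt operator on an arbitrary Banach space $X$ and let $A=I-T$. The following are equivalent. (i) $T$ admits a bounded $H^{\infty}(B_\gamma)$ functional calculus for some $\gamma\in\bigl(0,\frac{\pi}{2}\bigr)$. (ii) $A$ admits a bounded $H^{\infty}(\Sigma_\theta)$ functional calculus for some $\theta\in\bigl(0,\frac{\pi}{2}\bigr)$.
   Context: Let $X$ be a complex Banach space and $B(X)$ the algebra of bounded operators on $X$; write $R(\lambda,T)=(\lambda I-T)^{-1}$. An operator $T\in B(X)$ is a Ritt operator if the two sets $\{T^n : n\geq 0\}$ and $\{n(T^n-T^{n-1}) : n\geq 1\}$ are bounded. For $\gamma\in(0,\frac{\pi}{2})$, $B_\gamma$ (Stolz domain) is the interior of the convex hull of $1$ and the disc $D(0,\sin\gamma)=\{|z|<\sin\gamma\}$. A Ritt operator $T$ is of type $\alpha\in(0,\frac{\pi}{2})$ if $\sigma(T)\subset\overline{B_\alpha}$ and for every $\beta\in(\alpha,\frac{\pi}{2})$ the set $\{(\lambda-1)R(\lambda,T) : \lambda\in\mathbb{C}\setminus\overline{B_\beta}\}$ is bounded (every Ritt operator is of some type $\alpha$). $H^\infty_0(B_\gamma)$ is the space of bounded holomorphic $\varphi\colon B_\gamma\to\mathbb{C}$ for which there are $s,c>0$ with $|\varphi(\lambda)|\leq c|1-\lambda|^s$ on $B_\gamma$. If $T$ is a Ritt operator of type $\alpha<\gamma$ and $\varphi\in H^\infty_0(B_\gamma)$, set $\varphi(T)=\frac{1}{2\pi i}\int_{\partial B_\beta}\varphi(\lambda)R(\lambda,T)\,d\lambda$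 with $\beta\in(\alpha,\gamma)$ and $\partial B_\beta$ oriented counterclockwise (independent of $\beta$). $T$ admits a bounded $H^\infty(B_\gamma)$ functional calculus if $T$ is of type $\alpha$ for some $\alpha<\gamma$ and there is $K>0$ with $\|\varphi(T)\|\leq K\sup_{\lambda\in B_\gamma}|\varphi(\lambda)|$ for all $\varphi\in H^\infty_0(B_\gamma)$. For $\omega\in(0,\pi)$, $\Sigma_\omega=\{z\in\mathbb{C}\setminus\{0\} : |\mathrm{Arg}(z)|<\omega\}$. A closed densely defined operator $A$ on $X$ is sectorial of type $\omega$ if $\sigma(A)\subset\overline{\Sigma_\omega}$ and for every $\nu\in(\omega,\pi)$ the set $\{zR(z,A) : z\in\mathbb{C}\setminus\overline{\Sigma_\nu}\}$ is bounded. (If $T$ is Ritt then $I-T$ is sectorial of type $<\frac{\pi}{2}$.) $H^\infty_0(\Sigma_\theta)$ is the algebra of bounded holomorphic $f\colon\Sigma_\theta\to\mathbb{C}$ for which there are $s,c>0$ with $|f(z)|\leq c\frac{|z|^s}{1+|z|^{2s}}$ on $\Sigma_\theta$. If $A$ is sectorial of type $\omega<\theta$ and $f\in H^\infty_0(\Sigma_\theta)$, set $f(A)=\frac{1}{2\pi i}\int_{\partial\Sigma_\nu}f(z)R(z,A)\,dz$, with $\nu\in(\omega,\theta)$ and $\partial\Sigma_\nu$ oriented counterclockwise (independent of $\nu$). $A$ admits a bounded $H^\infty(\Sigma_\theta)$ functional calculus if $A$ is sectorial of type $\omega$ for some $\omega<\theta$ and there is $K>0$ with $\|f(A)\|\leq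 K\sup_{z\in\Sigma_\theta}|f(z)|$ for all $f\in H^\infty_0(\Sigma_\theta)$. *)

(* Defs.v *)
From Stdlib Require Import Reals Lra ClassicalEpsilon FunctionalExtensionality ProofIrrelevance.
From Coquelicot Require Import Coquelicot.

Local Open Scope R_scope.

Record bounded_op (X : NormedModule C_AbsRing) : Type :=
  Bop { bop_fun :> X -> X ; bop_linear : is_linear bop_fun }.

Arguments Bop {X} bop_fun bop_linear.
Arguments bop_fun {X} b x.
Arguments bop_linear {X} b.

Section BoundedOperators.

Variable X : NormedModule C_AbsRing.

Lemma bop_ext (S T : bounded_op X) : (forall x, S x = T x) -> S = T.
Proof.
destruct S as [S HS], T as [T HT]; simpl; intros H.
assert (E : S = T) by now apply functional_extensionality.
subst T; f_equal; apply proof_irrelevance.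
Qed.

Definition bop_plus (S T : bounded_op X) : bounded_op X :=
  Bop _ (is_linear_comp _ _ (is_linear_prod _ _ (bop_linear S) (bop_linear T))
           is_linear_plus).

Definition bop_opp (T : bounded_op X) : bounded_op X :=
  Bop _ (is_linear_comp _ _ (bop_linear T) is_linear_opp).

Definition bop_zero : bounded_op X := Bop _ (@is_linear_zero C_AbsRing X X).

Definition bop_one : bounded_op X := Bop _ (@is_linear_id C_AbsRing X).

Definition bop_mult (S T : bounded_op X) : bounded_op X :=
  Bop _ (is_linear_comp _ _ (bop_linear T) (bop_linear S)).

Definition bop_scal (k : C) (T : bounded_op X) : bounded_op X :=
  Bop _ (is_linear_comp _ _ (bop_linear T)
           (is_linear_scal_r (V := X) (k : C_AbsRing) Cmult_comm)).

Definition op_norm (T : bounded_op X) : R :=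
  real (Lub_Rbar (fun r => exists x : X, norm x <= 1 /\ r = norm (T x))).

Lemma op_norm_lub (T : bounded_op X) :
  is_lub_Rbar (fun r => exists x : X, norm x <= 1 /\ r = norm (T x)) (op_norm T).
Proof.
unfold op_norm.
set (E := fun r => exists x : X, norm x <= 1 /\ r = norm (T x)).
assert (HE : E 0).
{ exists zero; split; [rewrite norm_zero; lra|].
  now rewrite (linear_zero _ (bop_linear T)), norm_zero. }
destruct (linear_norm _ (bop_linear T)) as [M [HM HT]].
assert (HU : is_ub_Rbar E M).
{ intros r [x [Hx ->]]; simpl; eapply Rle_trans; [apply HT|].
  rewrite <- (Rmult_1_r M) at 2; apply Rmult_le_compat_l; lra. }
pose proof (Lub_Rbar_correct E) as [H1 H2].
specialize (H2 _ HU); pose proof (H1 _ HE) as H3.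
destruct (Lub_Rbar E) as [l| |] eqn:HL; simpl in *; try contradiction.
rewrite <- HL; apply Lub_Rbar_correct.
Qed.

Lemma op_norm_ge_0 (T : bounded_op X) : 0 <= op_norm T.
Proof.
apply (proj1 (op_norm_lub T)); exists zero; split.
- rewrite norm_zero; lra.
- now rewrite (linear_zero _ (bop_linear T)), norm_zero.
Qed.

Lemma op_norm_spec (T : bounded_op X) (x : X) : norm (T x) <= op_norm T * norm x.
Proof.
destruct (Req_dec (norm x) 0) as [H0|H0].
- rewrite (norm_eq_zero _ H0), (linear_zero _ (bop_linear T)), norm_zero; lra.
- assert (Hp : 0 < norm x) by (pose proof (norm_ge_0 x); lra).
  set (k := RtoC (/ norm x) : C_AbsRing).
  set (k' := RtoC (norm x) : C_AbsRing).
  assert (Hx : x = scal k' (scal k x)).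
  { rewrite scal_assoc.
    replace (mult k' k) with (one : C_AbsRing); [now rewrite scal_one|].
    unfold k, k', mult, one; simpl.
    rewrite <- RtoC_mult; f_equal; now field. }
  assert (Hu : norm (scal k x) <= 1).
  { eapply Rle_trans; [apply norm_scal|].
    unfold k, abs; simpl; rewrite Cmod_R, Rabs_pos_eq.
    - right; now field.
    - left; now apply Rinv_0_lt_compat. }
  rewrite Hx at 1; rewrite (linear_scal _ (bop_linear T)).
  eapply Rle_trans; [apply norm_scal|].
  unfold k', abs at 1; simpl.
  rewrite Cmod_R, Rabs_pos_eq by lra; rewrite Rmult_comm.
  apply Rmult_le_compat_r; [lra|].
  apply (proj1 (op_norm_lub T)); now exists (scal k x).
Qed.

Lemma op_norm_le (T : bounded_op X) (M : R) :
  0 <= M -> (forall x, norm (T x) <= M * norm x) -> op_norm T <= M.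
Proof.
intros HM H; apply (proj2 (op_norm_lub T) M).
intros r [x [Hx ->]]; simpl; eapply Rle_trans; [apply H|].
rewrite <- (Rmult_1_r M) at 2; now apply Rmult_le_compat_l.
Qed.

Definition bop_AbelianMonoid_mixin : AbelianMonoid.mixin_of (bounded_op X).
Proof.
exists bop_plus bop_zero.
- intros S T; apply bop_ext; intros x; apply plus_comm.
- intros S T U; apply bop_ext; intros x; apply plus_assoc.
- intros S; apply bop_ext; intros x; apply plus_zero_r.
Defined.

Definition bop_AbelianGroup_mixin :
  AbelianGroup.mixin_of (AbelianMonoid.Pack (bounded_op X) bop_AbelianMonoid_mixin (bounded_op X)).
Proof.
exists bop_opp; intros S; apply bop_ext; intros x; apply (plus_opp_r (S x)).
Defined.

Canonical bop_AbelianMonoid := AbelianMonoid.Pack (bounded_op X) bop_AbelianMonoid_mixin (bounded_op X).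

Definition bop_AbelianGroup_class :=
  AbelianGroup.Class (bounded_op X) bop_AbelianMonoid_mixin bop_AbelianGroup_mixin.

Canonical bop_AbelianGroup := AbelianGroup.Pack (bounded_op X) bop_AbelianGroup_class (bounded_op X).

Definition bop_Ring_mixin : Ring.mixin_of bop_AbelianGroup.
Proof.
exists bop_mult bop_one.
- now intros S T U; apply bop_ext.
- now intros S; apply bop_ext.
- now intros S; apply bop_ext.
- now intros S T U; apply bop_ext.
- intros S T U; apply bop_ext; intros x.
  apply (linear_plus _ (bop_linear S)).
Defined.

Canonical bop_Ring :=
  Ring.Pack (bounded_op X) (Ring.Class _ bop_AbelianGroup_class bop_Ring_mixin) (bounded_op X).

Definition bop_ModuleSpace_mixin : ModuleSpace.mixin_of C_Ring bop_AbelianGroup.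
Proof.
exists bop_scal.
- intros a b S; apply bop_ext; intros x; apply (scal_assoc a b (S x)).
- intros S; apply bop_ext; intros x; apply (scal_one (S x)).
- intros a S T; apply bop_ext; intros x; apply (scal_distr_l a (S x) (T x)).
- intros a b S; apply bop_ext; intros x; apply (scal_distr_r a b (S x)).
Defined.

Definition bop_ModuleSpace_class :=
  ModuleSpace.Class C_Ring (bounded_op X) bop_AbelianGroup_class bop_ModuleSpace_mixin.

Canonical bop_ModuleSpace := ModuleSpace.Pack C_Ring (bounded_op X) bop_ModuleSpace_class (bounded_op X).

Lemma op_norm_zero : op_norm zero = 0.
Proof.
apply Rle_antisym; [|apply op_norm_ge_0].
apply op_norm_le; [lra|]; intros x.
change (norm (zero : X) <= 0 * norm x); rewrite norm_zero; lra.
Qed.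

Lemma op_norm_triangle (S T : bounded_op X) : op_norm (plus S T) <= op_norm S + op_norm T.
Proof.
apply op_norm_le.
- pose proof (op_norm_ge_0 S); pose proof (op_norm_ge_0 T); lra.
- intros x; change (norm (plus (S x) (T x)) <= (op_norm S + op_norm T) * norm x).
  eapply Rle_trans; [apply norm_triangle|]; rewrite Rmult_plus_distr_r.
  apply Rplus_le_compat; apply op_norm_spec.
Qed.

Lemma op_norm_scal (k : C) (T : bounded_op X) : op_norm (scal k T) <= Cmod k * op_norm T.
Proof.
apply op_norm_le.
- apply Rmult_le_pos; [apply Cmod_ge_0|apply op_norm_ge_0].
- intros x; change (norm (scal (k : C_AbsRing) (T x)) <= Cmod k * op_norm T * norm x).
  eapply Rle_trans; [apply norm_scal|]; rewrite Rmult_assoc.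
  apply Rmult_le_compat_l; [apply Cmod_ge_0|apply op_norm_spec].
Qed.

Lemma op_norm_opp (T : bounded_op X) : op_norm (opp T) <= op_norm T.
Proof.
apply op_norm_le; [apply op_norm_ge_0|]; intros x.
change (norm (opp (T x)) <= op_norm T * norm x).
rewrite norm_opp; apply op_norm_spec.
Qed.

Definition bop_UniformSpace_mixin : UniformSpace.mixin_of (bounded_op X).
Proof.
refine (UniformSpace.Mixin (bounded_op X) zero
          (fun (S : bounded_op X) (e : R) (T : bounded_op X) => op_norm (minus T S) < e) _ _ _).
- intros S e; rewrite minus_eq_zero.
  eapply Rle_lt_trans; [right; exact op_norm_zero|apply cond_pos].
- intros S T e H; rewrite <- opp_minus.
  eapply Rle_lt_trans; [apply op_norm_opp|exact H].
- intros S T U d e HS HT; rewrite (minus_trans T).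
  eapply Rle_lt_trans; [apply op_norm_triangle|]; lra.
Defined.

Canonical bop_UniformSpace := UniformSpace.Pack (bounded_op X) bop_UniformSpace_mixin (bounded_op X).

Definition bop_NormedModuleAux_class :=
  NormedModuleAux.Class C_AbsRing (bounded_op X) bop_ModuleSpace_class bop_UniformSpace_mixin.

Canonical bop_NormedModuleAux :=
  NormedModuleAux.Pack C_AbsRing (bounded_op X) bop_NormedModuleAux_class (bounded_op X).

Definition bop_NormedModule_mixin : NormedModule.mixin_of C_AbsRing bop_NormedModuleAux.
Proof.
exists op_norm 1.
- exact op_norm_triangle.
- exact op_norm_scal.
- now intros S T e H.
- intros S T e H; rewrite Rmult_1_l; exact H.
- intros S H; apply bop_ext; intros x.
  change (S x = zero); apply norm_eq_zero, Rle_antisym; [|apply norm_ge_0].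
  rewrite <- (Rmult_0_l (norm x)), <- H; apply op_norm_spec.
Defined.

Canonical bop_NormedModule :=
  NormedModule.Pack C_AbsRing (bounded_op X)
    (NormedModule.Class _ _ bop_NormedModuleAux_class bop_NormedModule_mixin) (bounded_op X).

End BoundedOperators.

(* Restriction of scalars: Coquelicot's Riemann integral takes values in normed
   modules over R. *)

Section RealModule.

Variable V : NormedModule C_AbsRing.

Let V_AbelianGroup := NormedModule.AbelianGroup _ V.

Definition real_scal (r : R) (v : V) : V := scal (RtoC r : C_AbsRing) v.

Definition real_ModuleSpace_mixin : ModuleSpace.mixin_of R_Ring V_AbelianGroup.
Proof.
exists real_scal; unfold real_scal.
- intros a b v; rewrite scal_assoc; f_equal; symmetry; apply RtoC_mult.
- intros v; apply (scal_one v).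
- intros a u v; apply (scal_distr_l (RtoC a : C_AbsRing) u v).
- intros a b v; transitivity (scal (plus (RtoC a : C_AbsRing) (RtoC b)) v).
  + f_equal; apply RtoC_plus.
  + apply (scal_distr_r (RtoC a : C_AbsRing) (RtoC b) v).
Defined.

Definition real_NormedModuleAux_class :=
  NormedModuleAux.Class R_AbsRing V
    (ModuleSpace.Class R_Ring V (AbelianGroup.class V_AbelianGroup) real_ModuleSpace_mixin)
    (UniformSpace.class (NormedModule.UniformSpace _ V)).

Definition real_NormedModule_mixin :
  NormedModule.mixin_of R_AbsRing
    (NormedModuleAux.Pack R_AbsRing V real_NormedModuleAux_class V).
Proof.
refine (NormedModule.Mixin R_AbsRing
          (NormedModuleAux.Pack R_AbsRing V real_NormedModuleAux_class V)
          (@norm C_AbsRing V) (@norm_factor C_AbsRing V) _ _ _ _ _).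
- exact norm_triangle.
- intros r v; eapply Rle_trans; [apply (norm_scal (RtoC r : C_AbsRing) v)|].
  right; unfold abs; simpl; now rewrite Cmod_R.
- exact norm_compat1.
- exact norm_compat2.
- exact norm_eq_zero.
Defined.

Definition real_module : NormedModule R_AbsRing :=
  NormedModule.Pack R_AbsRing V
    (NormedModule.Class _ _ real_NormedModuleAux_class real_NormedModule_mixin) V.

End RealModule.

Definition plane_interior (D : C -> Prop) (z : C) : Prop := locally z D.

Definition plane_closure (D : C -> Prop) (z : C) : Prop :=
  forall P : C -> Prop, locally z P -> exists w, P w /\ D w.

Definition plane_convex (D : C -> Prop) : Prop :=
  forall (z w : C) (t : R), D z -> D w -> 0 <= t <= 1 ->
    D (RtoC (1 - t) * z + RtoC t * w)%C.

Definition convex_hull (D : C -> Prop) (z : C) : Prop :=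
  forall E : C -> Prop, plane_convex E -> (forall w, D w -> E w) -> E z.

Definition stolz (gamma : R) : C -> Prop :=
  plane_interior (convex_hull (fun z => z = RtoC 1 \/ Cmod z < sin gamma)).

(* The principal argument, with values in (-PI, PI]. *)
Definition Carg (z : C) : R :=
  if Rle_dec 0 (Im z) then acos (Re z / Cmod z) else - acos (Re z / Cmod z).

Definition sector (omega : R) (z : C) : Prop :=
  z <> RtoC 0 /\ Rabs (Carg z) < omega.

Definition holomorphic_on (D : C -> Prop) (f : C -> C) : Prop :=
  forall z, D z -> ex_derive (K := C_AbsRing) (V := C_NormedModule) f z.

Definition bounded_on (D : C -> Prop) (f : C -> C) : Prop :=
  exists M : R, forall z, D z -> Cmod (f z) <= M.

Definition sup_norm_on (D : C -> Prop) (f : C -> C) : R :=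
  real (Lub_Rbar (fun r => exists z, D z /\ r = Cmod (f z))).

Definition H0_stolz (gamma : R) (phi : C -> C) : Prop :=
  holomorphic_on (stolz gamma) phi /\ bounded_on (stolz gamma) phi /\
  exists s c : R, 0 < s /\ 0 < c /\
    forall z, stolz gamma z -> Cmod (phi z) <= c * Rpower (Cmod (1 - z)%C) s.

Definition H0_sector (theta : R) (f : C -> C) : Prop :=
  holomorphic_on (sector theta) f /\ bounded_on (sector theta) f /\
  exists s c : R, 0 < s /\ 0 < c /\
    forall z, sector theta z ->
      Cmod (f z) <= c * (Rpower (Cmod z) s / (1 + Rpower (Cmod z) (2 * s))).

Definition is_resolvent {X : NormedModule C_AbsRing} (z : C) (T S : bounded_op X) : Prop :=
  let zI_T := minus (scal (z : C_AbsRing) (one : bounded_op X)) T in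
  mult S zI_T = one /\ mult zI_T S = one.

Definition spectrum {X : NormedModule C_AbsRing} (T : bounded_op X) (z : C) : Prop :=
  ~ exists S : bounded_op X, is_resolvent z T S.

(* Unspecified when z is in the spectrum. *)
Definition resolvent {X : NormedModule C_AbsRing} (z : C) (T : bounded_op X) : bounded_op X :=
  epsilon (inhabits zero) (is_resolvent z T).

Definition cis (t : R) : C := (cos t, sin t).

Definition velocity (p : R -> C) (t : R) : C :=
  (Derive (fun u => Re (p u)) t, Derive (fun u => Im (p u)) t).

(* S is the integral of F along the path p, whose parameter runs from the
   filter Fa to the filter Fb.  All the integrals below converge absolutely, so
   improper Riemann integration in B(X) agrees with Bochner integration. *)
Definition is_path_integral {X : NormedModule C_AbsRing}
    (F : C -> bounded_op X) (p : R -> C) (Fa Fb : (R -> Prop) -> Prop) (S : bounded_op X) : Prop :=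
  is_RInt_gen (V := real_module (bop_NormedModule X))
    (fun t => scal (velocity p t : C_AbsRing) (F (p t))) Fa Fb S.

(* The boundary of the Stolz domain of angle beta, counterclockwise: the segment
   from 1 to the tangency point sin beta * exp (i (PI/2 - beta)), the large arc of
   the circle, and the segment back to 1.  The integrand may be singular at 1. *)
Definition is_stolz_boundary_integral {X : NormedModule C_AbsRing}
    (beta : R) (F : C -> bounded_op X) (S : bounded_op X) : Prop :=
  exists S1 S2 S3 : bounded_op X,
    is_path_integral F (fun t => 1 - RtoC t * cis (- beta))%C
      (at_right 0) (at_point (cos beta)) S1 /\
    is_path_integral F (fun t => RtoC (sin beta) * cis t)%C
      (at_point (PI / 2 - beta)) (at_point (3 * PI / 2 + beta)) S2 /\
    is_path_integral F (fun t => 1 - RtoC t * cis beta)%C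
      (at_point (cos beta)) (at_right 0) S3 /\
    S = plus S1 (plus S2 S3).

(* Counterclockwise: in from infinity along the upper ray, out along the lower. *)
Definition is_sector_boundary_integral {X : NormedModule C_AbsRing}
    (nu : R) (F : C -> bounded_op X) (S : bounded_op X) : Prop :=
  exists S1 S2 : bounded_op X,
    is_path_integral F (fun t => RtoC t * cis nu)%C
      (Rbar_locally p_infty) (at_right 0) S1 /\
    is_path_integral F (fun t => RtoC t * cis (- nu))%C
      (at_right 0) (Rbar_locally p_infty) S2 /\
    S = plus S1 S2.

Definition is_Ritt {X : NormedModule C_AbsRing} (T : bounded_op X) : Prop :=
  (exists M : R, forall n : nat, norm (pow_n T n) <= M) /\
  (exists M : R, forall n : nat, (1 <= n)%nat ->
     norm (scal (RtoC (INR n) : C_AbsRing) (minus (pow_n T n) (pow_n T (n - 1)))) <= M).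

Definition Ritt_type {X : NormedModule C_AbsRing} (T : bounded_op X) (alpha : R) : Prop :=
  0 < alpha < PI / 2 /\ is_Ritt T /\
  (forall z, spectrum T z -> plane_closure (stolz alpha) z) /\
  (forall beta, alpha < beta < PI / 2 ->
     exists M : R, forall z, ~ plane_closure (stolz beta) z ->
       norm (scal (z - 1 : C)%C (resolvent z T)) <= M).

(* phi(T) = S, computed on the boundary of the Stolz domain of angle beta. *)
Definition is_stolz_calculus {X : NormedModule C_AbsRing}
    (T : bounded_op X) (phi : C -> C) (beta : R) (S : bounded_op X) : Prop :=
  exists I : bounded_op X,
    is_stolz_boundary_integral beta
      (fun z => scal (phi z : C_AbsRing) (resolvent z T)) I /\
    S = scal (/ (2 * RtoC PI * Ci))%C I.

Definition bounded_stolz_calculus {X : NormedModule C_AbsRing}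
    (T : bounded_op X) (gamma : R) : Prop :=
  exists alpha : R, alpha < gamma /\ Ritt_type T alpha /\
  exists K : R, 0 < K /\
    forall phi : C -> C, H0_stolz gamma phi ->
    forall beta : R, alpha < beta < gamma ->
    exists S : bounded_op X, is_stolz_calculus T phi beta S /\
      norm S <= K * sup_norm_on (stolz gamma) phi.

(* Everywhere defined bounded operators only: these are closed and densely
   defined, so those two requirements disappear. *)
Definition sectorial_type {X : NormedModule C_AbsRing} (A : bounded_op X) (omega : R) : Prop :=
  0 < omega < PI /\
  (forall z, spectrum A z -> plane_closure (sector omega) z) /\
  (forall nu, omega < nu < PI ->
     exists M : R, forall z, ~ plane_closure (sector nu) z ->
       norm (scal (z : C_AbsRing) (resolvent z A)) <= M).

(* f(A) = S, computed on the boundary of the sector of angle nu. *)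
Definition is_sector_calculus {X : NormedModule C_AbsRing}
    (A : bounded_op X) (f : C -> C) (nu : R) (S : bounded_op X) : Prop :=
  exists I : bounded_op X,
    is_sector_boundary_integral nu
      (fun z => scal (f z : C_AbsRing) (resolvent z A)) I /\
    S = scal (/ (2 * RtoC PI * Ci))%C I.

Definition bounded_sector_calculus {X : NormedModule C_AbsRing}
    (A : bounded_op X) (theta : R) : Prop :=
  exists omega : R, omega < theta /\ sectorial_type A omega /\
  exists K : R, 0 < K /\
    forall f : C -> C, H0_sector theta f ->
    forall nu : R, omega < nu < theta ->
    exists S : bounded_op X, is_sector_calculus A f nu S /\
      norm S <= K * sup_norm_on (sector theta) f.

(* Submission.v *)
(* Put A = I - T and z = 1 - lambda.  The boundary of B_beta becomes two initial
   segments of the rays bounding a sector Sigma_beta, joined by an arc of the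
   circle centred at 1.

   From (i) to (ii): given f in H^oo_0(Sigma_gamma), let phi(lambda) = f(1 - lambda).
   Dilating the arc sweeps out the region between the two remaining half-rays;
   Cauchy's theorem there and the decay of f at infinity show that the arc can be
   replaced by these half-rays, so that f(A) = phi(T).

   From (ii) to (i): the Ritt condition bounds the resolvent on the arc, so only
   the integral of phi(lambda) R(lambda,T) over the two segments matters.  Cut off
   at distance d from 1, it is a limit of Riemann sums, i.e. of operators f(A) for
   combinations f of the functions k(w,z) = 1/(z-w) + 1/(w(z+1)), up to a bounded
   term.  On Sigma_theta the corresponding scalar integrals are bounded by
   C sup|phi| uniformly in d: directly over the part |w| <= 2|z|, and for the
   rest by Cauchy's theorem, which moves it to the arcs of size 2|z| and 1.  The
   calculus of A transfers this bound to the operator, and d tends to 0. *)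

Require Import Defs.
From Stdlib Require Import Reals Lra Lia List ClassicalEpsilon FunctionalExtensionality PropExtensionality.
From Coquelicot Require Import Coquelicot.

Local Open Scope R_scope.

(** * Linear identities in complex modules *)

(** Along one ray the Cauchy kernel integrates only to a logarithm, because 1/|w| is not integrable
    at 0 and a bound by sup|phi| cannot use the decay of phi; the two segments are therefore
    subtracted from each other before anything is estimated ([jump]). The kernel 1/(z-w) does not
    vanish at z = 0, so the calculus of A cannot be applied to it; the correction 1/(w(z+1)) repairs
    this at the cost of a multiple of the resolvent at -1, a point outside every sector in use.
    Riemann sums replace an interchange of two operator-valued integrals. All contours are
    coordinate lines of one map, (s,u) to s times [circ c0 c1 u]: the unit circle gives sectors, and
    the circle |1-z| = sin b rescaled by 1/cos b gives the Stolz boundary, so one Cauchy theorem for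
    images of rectangles serves everywhere. Finally gamma is in general larger than theta: away from
    1 the Ritt condition controls the resolvent of T only outside a disc of some radius r0 < 1, and
    the Stolz domain has to swallow that disc. *)

Inductive mexpr : Type :=
| MAtom (i : nat) | MZero | MPlus (e f : mexpr) | MOpp (e : mexpr) | MScal (c : C) (e : mexpr).

Section ModuleIdentities.

Variable V : NormedModule C_AbsRing.

Lemma scal_C0 (v : V) : scal (RtoC 0 : C_AbsRing) v = (zero : V).
Proof. apply (scal_zero_l (V := V) v). Qed.

Lemma scal_C1 (v : V) : scal (RtoC 1 : C_AbsRing) v = v.
Proof. apply (scal_one (V := V) v). Qed.

Lemma scal_CD (a b : C) (v : V) :
  scal (Cplus a b : C_AbsRing) v = plus (scal (a : C_AbsRing) v) (scal (b : C_AbsRing) v).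
Proof. apply (scal_distr_r (a : C_AbsRing) b v). Qed.

Lemma scal_CM (a b : C) (v : V) :
  scal (Cmult a b : C_AbsRing) v = scal (a : C_AbsRing) (scal (b : C_AbsRing) v).
Proof. symmetry; apply (scal_assoc (a : C_AbsRing) b v). Qed.

Fixpoint meval (env : list V) (e : mexpr) : V :=
  match e with
  | MAtom i => nth i env zero
  | MZero => zero
  | MPlus e f => plus (meval env e) (meval env f)
  | MOpp e => opp (meval env e)
  | MScal c e => scal (c : C_AbsRing) (meval env e)
  end.

Fixpoint mcoef (e : mexpr) (j : nat) : C :=
  match e with
  | MAtom i => if Nat.eqb i j then RtoC 1 else RtoC 0
  | MZero => RtoC 0
  | MPlus e f => Cplus (mcoef e j) (mcoef f j)
  | MOpp e => Copp (mcoef e j)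
  | MScal c e => Cmult c (mcoef e j)
  end.

Fixpoint mlin (k : nat -> C) (env : list V) : V :=
  match env with
  | nil => zero
  | v :: env' => plus (scal (k 0%nat : C_AbsRing) v) (mlin (fun n => k (S n)) env')
  end.

Lemma mlin_ext (env : list V) : forall k k',
  (forall j, (j < length env)%nat -> k j = k' j) -> mlin k env = mlin k' env.
Proof.
induction env as [|v env IH]; intros k k' H; simpl; [reflexivity|].
rewrite (H 0%nat) by (simpl; lia).
f_equal; apply IH; intros j Hj; apply H; simpl; lia.
Qed.

Lemma mlin_zero (env : list V) : mlin (fun _ => RtoC 0) env = zero.
Proof.
induction env as [|v env IH]; simpl; [reflexivity|].
rewrite IH, scal_C0; apply plus_zero_l.
Qed.

Lemma mlin_plus (env : list V) : forall k k',
  mlin (fun j => Cplus (k j) (k' j)) env = plus (mlin k env) (mlin k' env).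
Proof.
induction env as [|v env IH]; intros k k'; simpl; [now rewrite plus_zero_l|].
rewrite IH.
rewrite scal_CD, <- !plus_assoc; f_equal.
rewrite !plus_assoc; f_equal; apply plus_comm.
Qed.

Lemma mlin_scal (env : list V) : forall (c : C) k,
  mlin (fun j => Cmult c (k j)) env = scal (c : C_AbsRing) (mlin k env).
Proof.
induction env as [|v env IH]; intros c k; simpl.
- symmetry; apply (scal_zero_r (V := V)).
- rewrite IH, scal_CM; symmetry; apply (scal_distr_l (c : C_AbsRing)).
Qed.

Lemma mlin_atom (env : list V) : forall i,
  mlin (fun j => if Nat.eqb i j then RtoC 1 else RtoC 0) env = nth i env zero.
Proof.
induction env as [|v env IH]; intros i; simpl; [now destruct i|].
destruct i as [|i]; simpl.
- rewrite mlin_zero, plus_zero_r; apply scal_C1.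
- rewrite scal_C0, plus_zero_l; apply IH.
Qed.

Lemma meval_coef (env : list V) (e : mexpr) : meval env e = mlin (mcoef e) env.
Proof.
induction e as [i| |e IHe f IHf|e IHe|c e IHe]; simpl.
- symmetry; apply mlin_atom.
- symmetry; apply mlin_zero.
- now rewrite IHe, IHf, <- mlin_plus.
- transitivity (scal (Copp (RtoC 1) : C_AbsRing) (meval env e)).
  { symmetry; apply (scal_opp_one (V := V)). }
  rewrite IHe, <- mlin_scal.
  apply mlin_ext; intros j _; ring.
- now rewrite IHe, <- mlin_scal.
Qed.

(** Comparing coefficients atom by atom is sufficient whatever relations hold between the atoms.
    This is the soundness of the reflexive tactic [module]. *)
Lemma meval_eq (env : list V) (e f : mexpr) :
  (forall j, (j < length env)%nat -> mcoef e j = mcoef f j) -> meval env e = meval env f.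
Proof. rewrite !meval_coef; apply mlin_ext. Qed.

End ModuleIdentities.

Arguments scal_C0 {V} v.
Arguments scal_C1 {V} v.
Arguments scal_CD {V} a b v.
Arguments scal_CM {V} a b v.

Ltac module_find x l :=
  lazymatch l with
  | x :: _ => constr:(0%nat)
  | _ :: ?l' => let n := module_find x l' in constr:(S n)
  end.

Ltac module_atoms acc t :=
  lazymatch t with
  | plus ?a ?b => let acc := module_atoms acc a in module_atoms acc b
  | minus ?a ?b => let acc := module_atoms acc a in module_atoms acc b
  | opp ?a => module_atoms acc a
  | scal _ ?a => module_atoms acc a
  | zero => acc
  | ?x => match acc with
          | context [x :: _] => acc
          | _ => constr:(x :: acc)
          end
  end.

Ltac module_reify l t :=
  lazymatch t with
  | plus ?a ?b => let e := module_reify l a in let f := module_reify l b in constr:(MPlus e f)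
  | minus ?a ?b => let e := module_reify l a in let f := module_reify l b in constr:(MPlus e (MOpp f))
  | opp ?a => let e := module_reify l a in constr:(MOpp e)
  | scal ?c ?a => let e := module_reify l a in constr:(MScal c e)
  | zero => constr:(MZero)
  | ?x => let n := module_find x l in constr:(MAtom n)
  end.

(** [ring] on C recognises only [Cplus], [Cmult], [Copp] and the like; operations stated through the
    canonical structures are convertible to these but syntactically different. *)
Ltac C_ops :=
  change (@plus C_AbelianMonoid) with Cplus in *;
  change (@plus C_AbsRing) with Cplus in *;
  change (@opp C_AbsRing) with Copp in *;
  change (@minus C_AbsRing) with Cminus in *;
  change (@mult C_AbsRing) with Cmult in *;
  change (@one C_AbsRing) with (RtoC 1) in *;
  change (@zero C_AbsRing) with (RtoC 0) in *.

Ltac module_split j Hj :=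
  first [ exfalso; lia
        | destruct j as [|j]; [clear Hj; cbn [mcoef Nat.eqb]; C_ops | module_split j Hj] ].

(* Reduces an identity between linear combinations in the complex module V to
   the equality of the coefficients of each atom. *)
Ltac module_coefs V :=
  lazymatch goal with
  | |- ?a = ?b =>
    let l := module_atoms (@nil V) a in
    let l := module_atoms l b in
    let e := module_reify l a in
    let f := module_reify l b in
    change (meval V l e = meval V l f);
    apply meval_eq;
    let j := fresh "j" in let Hj := fresh "Hj" in
    intros j Hj;
    cbn [length] in Hj;
    module_split j Hj
  end.

Ltac module V := module_coefs V; ring.

Lemma norm_minus_sym {V : NormedModule C_AbsRing} (u v : V) : norm (minus u v) = norm (minus v u).
Proof. rewrite <- norm_opp, opp_minus; reflexivity. Qed.

Lemma norm_0 {V : NormedModule C_AbsRing} : norm (zero : V) = 0.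
Proof. apply norm_zero. Qed.

Lemma norm_minus_self {V : NormedModule C_AbsRing} (u : V) : norm (minus u u) = 0.
Proof. replace (minus u u) with (zero : V) by module V; apply norm_zero. Qed.

Lemma norm_minus_le {V : NormedModule C_AbsRing} (u v w : V) :
  norm (minus u w) <= norm (minus u v) + norm (minus v w).
Proof. rewrite (minus_trans v); apply norm_triangle. Qed.

Lemma norm_minus_triangle {V : NormedModule C_AbsRing} (u v : V) : norm (minus u v) <= norm u + norm v.
Proof. unfold minus; eapply Rle_trans; [apply norm_triangle|]; rewrite norm_opp; apply Rle_refl. Qed.

Lemma norm_plus_le {V : NormedModule C_AbsRing} (u v : V) (a b : R) :
  norm u <= a -> norm v <= b -> norm (plus u v) <= a + b.
Proof. intros Hu Hv; eapply Rle_trans; [apply norm_triangle|]; now apply Rplus_le_compat. Qed.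

Lemma norm_opp_le {V : NormedModule C_AbsRing} (u : V) (a : R) : norm u <= a -> norm (opp u) <= a.
Proof. now rewrite norm_opp. Qed.

Lemma norm_le_minus {V : NormedModule C_AbsRing} (u v : V) : norm u <= norm v + norm (minus u v).
Proof.
replace u with (plus v (minus u v)) at 1 by module V; apply norm_triangle.
Qed.

Lemma norm_minus_lt {V : NormedModule C_AbsRing} (u v w : V) (a b : R) :
  norm (minus u v) < a -> norm (minus w v) <= b -> norm (minus u w) < a + b.
Proof.
intros Ha Hb; pose proof (norm_minus_le u v w) as H.
rewrite (norm_minus_sym v w) in H; lra.
Qed.

Lemma eq_of_norm_minus_small {V : NormedModule C_AbsRing} (u v : V) :
  (forall e, 0 < e -> norm (minus u v) <= e) -> u = v.
Proof.
intros H.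
assert (H0 : norm (minus u v) = 0).
{ apply Rle_antisym; [|apply norm_ge_0].
  apply Rnot_lt_le; intros Hp.
  specialize (H (norm (minus u v) / 2)); lra. }
apply norm_eq_zero in H0.
replace u with (plus v (minus u v)) by module V; rewrite H0; apply plus_zero_r.
Qed.

(** In a Coquelicot normed module, balls and norm balls agree only up to [norm_factor];
    [norm_compat1] gives one inclusion and this is the other. *)
Lemma ball_norm_minus {V : NormedModule C_AbsRing} (u : V) (e : posreal) :
  exists d : posreal, forall v, ball u d v -> norm (minus v u) < e.
Proof.
assert (Hf := norm_factor_gt_0 (V := V)).
assert (Hd : 0 < e / norm_factor (V := V)) by (apply Rdiv_lt_0_compat; [apply cond_pos|exact Hf]).
exists (mkposreal _ Hd); intros v Hv.
eapply Rlt_le_trans; [apply (norm_compat2 u v _ Hv)|]; simpl; right; field; lra.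
Qed.

(** * The Banach algebra of bounded operators *)

Section OperatorAlgebra.

Variable X : NormedModule C_AbsRing.
Implicit Types S T : bounded_op X.

Lemma bop_norm_spec T (x : X) : norm (T x) <= norm T * norm x.
Proof. apply op_norm_spec. Qed.

Lemma bop_norm_le T (M : R) : 0 <= M -> (forall x, norm (T x) <= M * norm x) -> norm T <= M.
Proof. apply op_norm_le. Qed.

Lemma norm_mult S T : norm (mult S T) <= norm S * norm T.
Proof.
apply bop_norm_le; [apply Rmult_le_pos; apply norm_ge_0|]; intros x.
change (norm (S (T x)) <= norm S * norm T * norm x).
eapply Rle_trans; [apply bop_norm_spec|]; rewrite Rmult_assoc.
apply Rmult_le_compat_l; [apply norm_ge_0|apply bop_norm_spec].
Qed.

Lemma norm_one_le : norm (one : bounded_op X) <= 1.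
Proof. apply bop_norm_le; [lra|]; intros x; rewrite Rmult_1_l; apply Rle_refl. Qed.

Lemma mult_scal_l (c : C) S T : mult (scal (c : C_AbsRing) S) T = scal (c : C_AbsRing) (mult S T).
Proof. now apply bop_ext. Qed.

Lemma mult_scal_r (c : C) S T : mult S (scal (c : C_AbsRing) T) = scal (c : C_AbsRing) (mult S T).
Proof. apply bop_ext; intros x; apply (linear_scal _ (bop_linear S)). Qed.

Lemma mult_plus_l S T U : mult (plus S T) U = plus (mult S U) (mult T U).
Proof. now apply bop_ext. Qed.

Lemma mult_plus_r S T U : mult S (plus T U) = plus (mult S T) (mult S U).
Proof. apply (mult_distr_l S T U). Qed.

Lemma bop_mult_one_l T : mult one T = T.
Proof. now apply bop_ext. Qed.

Lemma bop_mult_one_r T : mult T one = T.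
Proof. now apply bop_ext. Qed.

Lemma bop_mult_assoc S T U : mult (mult S T) U = mult S (mult T U).
Proof. now apply bop_ext. Qed.

End OperatorAlgebra.

Arguments bop_norm_spec {X} T x.
Arguments bop_norm_le {X} T M.
Arguments norm_mult {X} S T.

(** Completeness is a predicate rather than part of a structure, so that X, C and the bounded
    operators all remain plain complex normed modules. *)
Definition norm_complete (V : NormedModule C_AbsRing) : Prop :=
  forall F : (V -> Prop) -> Prop,
    ProperFilter F -> cauchy F -> exists L : V, forall e : posreal, F (ball L e).

Section Completeness.

Variable X : NormedModule C_AbsRing.

(** A Cauchy filter of operators converges at each x because its evaluation at x is Cauchy in X. The
    pointwise limit [L] inherits linearity, and the uniform estimate [HLS] upgrades pointwise to
    norm convergence. *)
Lemma bop_norm_complete : norm_complete X -> norm_complete (bop_NormedModule X).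
Proof.
intros CX F PF HF.
set (ev := fun (x : X) => filtermap (fun T : bounded_op X => T x) F).
assert (Pev : forall x, ProperFilter (ev x)) by (intros x; apply filtermap_proper_filter; exact PF).
assert (HF' : forall e, 0 < e -> exists S : bounded_op X, F (fun T => norm (minus T S) < e)).
{ intros e He; destruct (HF (mkposreal _ He)) as [S HS]; now exists S. }
assert (Cev : forall x, cauchy (ev x)).
{ intros x e.
  assert (He : 0 < e / (norm x + 1)).
  { apply Rdiv_lt_0_compat; [apply cond_pos|pose proof (norm_ge_0 x); lra]. }
  destruct (HF' _ He) as [S HS]; exists (S x); unfold ev, filtermap.
  eapply filter_imp; [|exact HS]; intros T HT; apply norm_compat1.
  change (norm ((minus T S : bounded_op X) x) < e).
  eapply Rle_lt_trans; [apply bop_norm_spec|].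
  pose proof (norm_ge_0 x) as Hx.
  apply Rle_lt_trans with (e / (norm x + 1) * norm x).
  { apply Rmult_le_compat_r; lra. }
  apply Rlt_le_trans with (e / (norm x + 1) * (norm x + 1)); [|right; field; lra].
  apply Rmult_lt_compat_l; lra. }
set (L := fun x : X => proj1_sig (constructive_indefinite_description _ (CX (ev x) (Pev x) (Cev x)))).
assert (HL : forall x e, 0 < e -> F (fun T => norm (minus (T x) (L x)) < e)).
{ intros x e He.
  destruct (ball_norm_minus (L x) (mkposreal _ He)) as [d Hd].
  assert (H : ev x (ball (L x) d)) by (apply (proj2_sig (constructive_indefinite_description _ (CX (ev x) (Pev x) (Cev x))))).
  unfold ev, filtermap in H.
  eapply filter_imp; [|exact H]; intros T HT; apply Hd; exact HT. }
(* A closed inequality survives the limit: a set of the filter consists of T with [T x] within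
   [e * norm x] of [S x], and some of these T also bring [T x] arbitrarily close to [L x]. *)
assert (HLS : forall e (S : bounded_op X), 0 < e -> F (fun T => norm (minus T S) < e) ->
          forall x, norm (minus (L x) (S x)) <= e * norm x).
{ intros e S He HS x.
  apply Rnot_lt_le; intros Hlt.
  set (d := norm (minus (L x) (S x)) - e * norm x).
  assert (Hd : 0 < d) by (unfold d; lra).
  destruct (filter_ex (F := F) _ (filter_and (F := F) _ _ HS (HL x d Hd))) as [T [H1 H2]].
  pose proof (norm_minus_le (L x) (T x) (S x)) as H3.
  rewrite (norm_minus_sym (L x) (T x)) in H3.
  pose proof (bop_norm_spec (minus T S) x) as H4.
  change ((minus T S : bounded_op X) x) with (minus (T x) (S x)) in H4.
  pose proof (norm_ge_0 x) as Hx.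
  assert (norm (minus T S) * norm x <= e * norm x) by (apply Rmult_le_compat_r; lra).
  unfold d in *; lra. }
assert (Hlin : is_linear L).
{ split.
  - intros x y; apply eq_of_norm_minus_small; intros e He.
    destruct (filter_ex (F := F) _ (filter_and (F := F) _ _ (HL (plus x y) (e / 3) ltac:(lra))
       (filter_and (F := F) _ _ (HL x (e / 3) ltac:(lra)) (HL y (e / 3) ltac:(lra))))) as [T [H1 [H2 H3]]].
    replace (minus (L (plus x y)) (plus (L x) (L y))) with
      (plus (opp (minus (T (plus x y)) (L (plus x y))))
         (plus (minus (T x) (L x)) (minus (T y) (L y)))).
    2: { rewrite (linear_plus _ (bop_linear T)); module X. }
    eapply Rle_trans; [apply norm_triangle|]; rewrite norm_opp.
    eapply Rle_trans; [apply Rplus_le_compat_l, norm_triangle|]; lra.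
  - intros k x; apply eq_of_norm_minus_small; intros e He.
    pose proof (Cmod_ge_0 k) as Hk.
    assert (He' : 0 < e / 2 / (Cmod k + 1)) by (apply Rdiv_lt_0_compat; lra).
    destruct (filter_ex (F := F) _ (filter_and (F := F) _ _ (HL (scal k x) (e / 2) ltac:(lra))
       (HL x _ He'))) as [T [H1 H2]].
    replace (minus (L (scal k x)) (scal k (L x))) with
      (plus (opp (minus (T (scal k x)) (L (scal k x)))) (scal k (minus (T x) (L x)))).
    2: { rewrite (linear_scal _ (bop_linear T)); module X. }
    eapply Rle_trans; [apply norm_triangle|]; rewrite norm_opp.
    eapply Rle_trans; [apply Rplus_le_compat_l, (norm_scal k)|].
    change (abs k) with (Cmod k).
    assert (Cmod k * norm (minus (T x) (L x)) <= Cmod k * (e / 2 / (Cmod k + 1))).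
    { apply Rmult_le_compat_l; lra. }
    assert (Cmod k * (e / 2 / (Cmod k + 1)) <= e / 2).
    { replace (e / 2) with ((Cmod k + 1) * (e / 2 / (Cmod k + 1))) at 2 by (field; lra).
      apply Rmult_le_compat_r; lra. }
    lra.
  - destruct (HF' 1 Rlt_0_1) as [S HS]; exists (norm S + 1).
    pose proof (norm_ge_0 S); split; [lra|]; intros x.
    pose proof (HLS 1 S Rlt_0_1 HS x); pose proof (norm_le_minus (L x) (S x)).
    pose proof (bop_norm_spec S x); lra. }
exists (Bop L Hlin); intros e.
destruct (HF' (e / 3)) as [S HS]; [pose proof (cond_pos e); lra|].
eapply filter_imp; [|exact HS]; intros T HT.
apply norm_compat1.
assert (H1 : norm (minus (Bop L Hlin) S) <= e / 3).
{ apply bop_norm_le; [pose proof (cond_pos e); lra|]; intros x.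
  apply (HLS (e / 3) S); [pose proof (cond_pos e); lra|exact HS]. }
apply Rlt_le_trans with (e / 3 + e / 3); [|pose proof (cond_pos e); lra].
exact (norm_minus_lt (V := bop_NormedModule X) T S (Bop L Hlin) _ _ HT H1).
Qed.

End Completeness.

Section CompleteInstance.

Variable V : NormedModule C_AbsRing.
Hypothesis CV : norm_complete V.

Definition module_lim (F : (V -> Prop) -> Prop) : V :=
  epsilon (inhabits zero) (fun L : V => forall e : posreal, F (ball (M := V) L e)).

(** Mutually included filters are equal by extensionality, so [epsilon] returns the same point for
    both. *)
Lemma module_lim_close (F G : (V -> Prop) -> Prop) :
  filter_le F G -> filter_le G F -> close (module_lim F) (module_lim G).
Proof.
intros HFG HGF.
assert (E : F = G).
{ apply functional_extensionality; intros P; apply propositional_extensionality; split; auto. }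
rewrite E; intros e; apply ball_center.
Qed.

Definition module_CompleteSpace_mixin : CompleteSpace.mixin_of V :=
  CompleteSpace.Mixin V module_lim
    (fun F PF HF => epsilon_spec (inhabits zero) (fun L : V => forall e : posreal, F (ball (M := V) L e)) (CV F PF HF))
    module_lim_close.

(** Existence of integrals of continuous functions and the fundamental theorem of calculus are
    available for complete real modules. The normed module underlying this one is [real_module V],
    so the integrals obtained here are those of the definitions. *)
Definition real_complete_module : CompleteNormedModule R_AbsRing :=
  CompleteNormedModule.Pack R_AbsRing V
    (CompleteNormedModule.Class R_AbsRing V (NormedModule.class _ (real_module V))
       module_CompleteSpace_mixin) V.

End CompleteInstance.

Lemma C_norm_complete : norm_complete C_NormedModule.
Proof.
intros F PF HF; exists (lim (T := C_CompleteNormedModule) F).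
apply (complete_cauchy (T := C_CompleteNormedModule) F PF HF).
Qed.

Lemma complete_norm_complete (X : CompleteNormedModule C_AbsRing) : norm_complete X.
Proof. intros F PF HF; exists (lim F); intros e; exact (complete_cauchy F PF HF e). Qed.

Lemma filter_norm_cauchy {V : NormedModule C_AbsRing} (CV : norm_complete V) {U : Type}
    (F : (U -> Prop) -> Prop) (PF : ProperFilter F) (f : U -> V) :
  (forall e, 0 < e -> exists v : V, F (fun x => norm (minus (f x) v) < e)) ->
  exists l : V, forall e, 0 < e -> F (fun x => norm (minus (f x) l) < e).
Proof.
intros H.
destruct (CV (filtermap f F) (filtermap_proper_filter U V f F PF)) as [l Hl].
{ intros e; destruct (H e (cond_pos e)) as [v Hv]; exists v; unfold filtermap.
  eapply filter_imp; [|exact Hv]; intros x Hx; now apply norm_compat1. }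
exists l; intros e He.
destruct (ball_norm_minus l (mkposreal _ He)) as [d Hd].
specialize (Hl d); unfold filtermap in Hl.
eapply filter_imp; [|exact Hl]; intros x Hx; apply Hd; exact Hx.
Qed.

(** There are two instances, the bounded operators and C itself, so that facts on resolvents also
    cover 1/(z-w). [ba_norm_one] is an inequality because the unit has norm 0 on the trivial
    space. *)
Record banach_algebra : Type := BanachAlgebra {
  ba_mod :> NormedModule C_AbsRing;
  ba_mul : ba_mod -> ba_mod -> ba_mod;
  ba_one : ba_mod;
  ba_complete : norm_complete ba_mod;
  ba_assoc : forall a b c, ba_mul (ba_mul a b) c = ba_mul a (ba_mul b c);
  ba_one_l : forall a, ba_mul ba_one a = a;
  ba_one_r : forall a, ba_mul a ba_one = a;
  ba_plus_l : forall a b c, ba_mul (plus a b) c = plus (ba_mul a c) (ba_mul b c);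
  ba_plus_r : forall a b c, ba_mul a (plus b c) = plus (ba_mul a b) (ba_mul a c);
  ba_scal_l : forall (k : C) a b, ba_mul (scal (k : C_AbsRing) a) b = scal (k : C_AbsRing) (ba_mul a b);
  ba_scal_r : forall (k : C) a b, ba_mul a (scal (k : C_AbsRing) b) = scal (k : C_AbsRing) (ba_mul a b);
  ba_norm_mul : forall a b, norm (ba_mul a b) <= norm a * norm b;
  ba_norm_one : norm ba_one <= 1 }.

Arguments ba_mul {_} _ _.
Arguments ba_one {_}.

Declare Scope ba_scope.
Delimit Scope ba_scope with ba.
Notation "a ** b" := (ba_mul a b) (at level 40, left associativity) : ba_scope.
Notation "z *: v" := (@scal C_AbsRing _ z v) (at level 40, left associativity) : ba_scope.
Local Open Scope ba_scope.

Definition operator_algebra (X : NormedModule C_AbsRing) (CX : norm_complete X) : banach_algebra :=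
  {| ba_mod := bop_NormedModule X;
     ba_mul := @mult (bop_Ring X);
     ba_one := (one : bop_Ring X);
     ba_complete := bop_norm_complete X CX;
     ba_assoc := fun a b c => bop_mult_assoc X a b c;
     ba_one_l := bop_mult_one_l X;
     ba_one_r := bop_mult_one_r X;
     ba_plus_l := mult_plus_l X;
     ba_plus_r := mult_plus_r X;
     ba_scal_l := mult_scal_l X;
     ba_scal_r := mult_scal_r X;
     ba_norm_mul := norm_mult;
     ba_norm_one := norm_one_le X |}.

Section Resolvents.

Variable B : banach_algebra.

Lemma ba_opp_l (a b : B) : opp a ** b = opp (a ** b).
Proof.
replace (opp a) with (RtoC (-1) *: a) by module B; rewrite ba_scal_l; module B.
Qed.

Lemma ba_opp_r (a b : B) : a ** opp b = opp (a ** b).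
Proof.
replace (opp b) with (RtoC (-1) *: b) by module B; rewrite ba_scal_r; module B.
Qed.

Lemma ba_minus_l (a b c : B) : minus a b ** c = minus (a ** c) (b ** c).
Proof. unfold minus; now rewrite ba_plus_l, ba_opp_l. Qed.

Lemma ba_minus_r (a b c : B) : a ** minus b c = minus (a ** b) (a ** c).
Proof. unfold minus; now rewrite ba_plus_r, ba_opp_r. Qed.

Lemma ba_zero_l (a : B) : zero ** a = zero.
Proof. replace (zero : B) with (RtoC 0 *: a) at 1 by module B; rewrite ba_scal_l; module B. Qed.

Lemma ba_zero_r (a : B) : a ** zero = zero.
Proof. replace (zero : B) with (RtoC 0 *: a) at 1 by module B; rewrite ba_scal_r; module B. Qed.

End Resolvents.

Ltac ba_expand :=
  repeat first
    [ rewrite ba_plus_l | rewrite ba_plus_r | rewrite ba_minus_l | rewrite ba_minus_r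
    | rewrite ba_opp_l | rewrite ba_opp_r | rewrite ba_scal_l | rewrite ba_scal_r
    | rewrite ba_one_l | rewrite ba_one_r | rewrite ba_zero_l | rewrite ba_zero_r
    | rewrite ba_assoc ].

Definition ba_inverse {B : banach_algebra} (a b : B) : Prop := a ** b = ba_one /\ b ** a = ba_one.

Definition ba_resolvent {B : banach_algebra} (z : C) (a r : B) : Prop :=
  ba_inverse r (minus (z *: ba_one) a).

(** * Neumann series *)

Section Neumann.

Variable B : banach_algebra.
Implicit Types a b c r s : B.

Lemma left_right_inverse a b c : b ** a = ba_one -> a ** c = ba_one -> b = c.
Proof.
intros H1 H2; rewrite <- (ba_one_r B b), <- H2, <- ba_assoc, H1; apply ba_one_l.
Qed.

Lemma ba_inverse_unique a b c : ba_inverse b a -> ba_inverse c a -> b = c.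
Proof. intros [H1 _] [_ H2]; now apply (left_right_inverse a). Qed.

(** Geometric series: [u n] is a partial sum, and its product with 1 - a telescopes to 1 - a^(n+1).
    The bound 2 is the sum of the powers of 1/2. *)
Lemma neumann_one a : norm a <= / 2 ->
  exists j, ba_inverse j (minus ba_one a) /\ norm j <= 2.
Proof.
intros Ha.
pose (p := fix p (n : nat) : B := match n with O => ba_one | S n => a ** p n end).
pose (u := fix u (n : nat) : B := match n with O => ba_one | S n => plus (u n) (p (S n)) end).
assert (Hp : forall n, norm (p n) <= (/ 2) ^ n).
{ induction n as [|n IH]; simpl; [apply ba_norm_one|].
  eapply Rle_trans; [apply ba_norm_mul|].
  apply Rmult_le_compat; try apply norm_ge_0; assumption. }
(* The algebra is not commutative and [p] multiplies by [a] on the left; this commutation gives the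
   telescoping on the other side. *)
assert (Hpc : forall n, p n ** a = a ** p n).
{ induction n as [|n IH]; simpl; [now rewrite ba_one_l, ba_one_r|].
  now rewrite ba_assoc, IH. }
assert (Hd : forall n k, norm (minus (u (k + n)%nat) (u n)) <= (/ 2) ^ n * (1 - (/ 2) ^ k)).
{ intros n; induction k as [|k IH].
  - simpl; rewrite norm_minus_self; lra.
  - change (u (S k + n)%nat) with (plus (u (k + n)%nat) (p (S (k + n)))).
    replace (minus (plus (u (k + n)%nat) (p (S (k + n)))) (u n))
      with (plus (minus (u (k + n)%nat) (u n)) (p (S (k + n)))) by module B.
    eapply Rle_trans; [apply norm_triangle|].
    pose proof (Hp (S (k + n))) as H.
    replace ((/ 2) ^ S (k + n)) with (/ 2 * ((/ 2) ^ k * (/ 2) ^ n)) in H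
      by (cbn [pow]; rewrite pow_add; ring).
    cbn [pow]; lra. }
assert (Hsmall : forall e, 0 < e -> exists N, (/ 2) ^ N < e).
{ intros e He; destruct (pow_lt_1_zero (/ 2) ltac:(rewrite Rabs_pos_eq; lra) e He) as [N HN].
  exists N; specialize (HN N (Nat.le_refl N)); rewrite Rabs_pos_eq in HN; [exact HN|].
  apply pow_le; lra. }
assert (Hpp : forall n, 0 < (/ 2) ^ n) by (intros n; apply pow_lt; lra).
destruct (filter_norm_cauchy (ba_complete B) eventually eventually_filter u) as [j Hj].
{ intros e He; destruct (Hsmall e He) as [N HN]; exists (u N), N; intros n Hn.
  replace n with (n - N + N)%nat by lia.
  eapply Rle_lt_trans; [apply Hd|].
  pose proof (Hpp N); pose proof (Hpp (n - N)%nat); nra. }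
assert (Hu : forall n, u n ** minus ba_one a = minus ba_one (p (S n)) /\
                       minus ba_one a ** u n = minus ba_one (p (S n))).
{ induction n as [|n [IH1 IH2]].
  - simpl; split; ba_expand; reflexivity.
  - change (u (S n)) with (plus (u n) (p (S n))).
    change (p (S (S n))) with (a ** p (S n)).
    rewrite ba_plus_l, ba_plus_r, IH1, IH2; split; [rewrite <- Hpc|]; ba_expand; module B. }
assert (Hlim : forall e, 0 < e -> exists n, norm (minus (u n) j) < e /\ norm (p (S n)) < e).
{ intros e He; destruct (Hj e He) as [N1 H1]; destruct (Hsmall e He) as [N2 H2].
  exists (N1 + N2)%nat; split; [apply H1; lia|].
  eapply Rle_lt_trans; [apply Hp|]; eapply Rle_lt_trans; [|exact H2].
  replace (S (N1 + N2)) with (S N1 + N2)%nat by lia; rewrite pow_add.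
  assert ((/ 2) ^ S N1 <= 1).
  { rewrite <- (pow1 (S N1)); apply pow_incr; lra. }
  pose proof (Hpp N2); nra. }
assert (Hoa : norm (minus ba_one a) <= 2).
{ unfold minus; eapply Rle_trans; [apply norm_triangle|]; rewrite norm_opp.
  pose proof (ba_norm_one B); lra. }
exists j; split; [split|].
- apply eq_of_norm_minus_small; intros e He.
  destruct (Hlim (e / 3) ltac:(lra)) as [n [H1 H2]].
  replace (minus (j ** minus ba_one a) ba_one)
    with (plus (opp (minus (u n) j ** minus ba_one a)) (opp (p (S n)))).
  2: { rewrite ba_minus_l, (proj1 (Hu n)); module B. }
  eapply Rle_trans; [apply norm_triangle|]; rewrite !norm_opp.
  pose proof (ba_norm_mul B (minus (u n) j) (minus ba_one a)).
  pose proof (norm_ge_0 (minus (u n) j)); pose proof (norm_ge_0 (minus ba_one a)); nra.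
- apply eq_of_norm_minus_small; intros e He.
  destruct (Hlim (e / 3) ltac:(lra)) as [n [H1 H2]].
  replace (minus (minus ba_one a ** j) ba_one)
    with (plus (opp (minus ba_one a ** minus (u n) j)) (opp (p (S n)))).
  2: { rewrite ba_minus_r, (proj2 (Hu n)); module B. }
  eapply Rle_trans; [apply norm_triangle|]; rewrite !norm_opp.
  pose proof (ba_norm_mul B (minus ba_one a) (minus (u n) j)).
  pose proof (norm_ge_0 (minus (u n) j)); pose proof (norm_ge_0 (minus ba_one a)); nra.
- apply Rnot_lt_le; intros Hlt.
  destruct (Hlim (norm j - 2) ltac:(lra)) as [n [H1 _]].
  pose proof (norm_le_minus j (u n)) as H2; rewrite (norm_minus_sym j) in H2.
  pose proof (Hd 0%nat n) as H3; rewrite Nat.add_0_r in H3; simpl in H3.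
  pose proof (norm_le_minus (u n) (ba_one : B)) as H4.
  pose proof (ba_norm_one B); pose proof (Hpp n); lra.
Qed.

Lemma neumann_scalar (c : C) a : c <> RtoC 0 -> norm a <= Cmod c / 2 ->
  exists j, ba_inverse j (minus (c *: ba_one) a) /\ norm j <= 2 / Cmod c.
Proof.
intros Hc Ha.
assert (Hc' : 0 < Cmod c) by now apply Cmod_gt_0.
destruct (neumann_one ((/ c)%C *: a)) as [j [[H1 H2] H3]].
{ eapply Rle_trans; [apply (norm_scal ((/ c)%C : C_AbsRing))|].
  change (abs (/ c)%C) with (Cmod (/ c)%C); rewrite Cmod_inv by assumption.
  apply Rmult_le_reg_l with (Cmod c); [assumption|].
  rewrite <- Rmult_assoc, Rinv_r, Rmult_1_l by lra; lra. }
assert (E : minus (c *: ba_one) a = c *: minus ba_one ((/ c)%C *: a)).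
{ module_coefs B; [field; assumption|ring]. }
exists ((/ c)%C *: j); split; [split|].
- rewrite E, ba_scal_l, ba_scal_r, H1; module_coefs B; now field.
- rewrite E, ba_scal_l, ba_scal_r, H2; module_coefs B; now field.
- eapply Rle_trans; [apply (norm_scal ((/ c)%C : C_AbsRing))|].
  change (abs (/ c)%C) with (Cmod (/ c)%C); rewrite Cmod_inv by assumption.
  unfold Rdiv; rewrite Rmult_comm; apply Rmult_le_compat_r; [|assumption].
  now apply Rlt_le, Rinv_0_lt_compat.
Qed.

End Neumann.

Lemma norm_Cscal {V : NormedModule C_AbsRing} (k : C) (v : V) : norm (k *: v) <= Cmod k * norm v.
Proof. apply (norm_scal (k : C_AbsRing)). Qed.

(** The axiom [norm_scal] is only an inequality; applying it again to the inverse scalar gives the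
    converse. *)
Lemma norm_Cscal_eq {V : NormedModule C_AbsRing} (k : C) (v : V) : norm (k *: v) = Cmod k * norm v.
Proof.
destruct (classic (k = RtoC 0)) as [->|Hk].
- rewrite scal_C0, Cmod_0, norm_0; ring.
- apply Rle_antisym; [apply norm_Cscal|].
  assert (Hp : 0 < Cmod k) by now apply Cmod_gt_0.
  replace v with ((/ k)%C *: (k *: v)) at 1.
  2: { rewrite <- scal_CM, Cinv_l by assumption; apply scal_C1. }
  apply Rle_trans with (Cmod k * (Cmod (/ k)%C * norm (k *: v))).
  + apply Rmult_le_compat_l; [lra|apply norm_Cscal].
  + rewrite Cmod_inv by assumption; right; field; lra.
Qed.

Ltac norm_rewrite V t :=
  apply Rle_trans with (norm (t : V)); [right; apply (f_equal (@norm C_AbsRing V)); cbv beta; module V|].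

(** * Complex differentiability and resolvents *)

(** The usual derivative with an explicit error term, for direct use in estimates;
    [cdiffable_ex_derive] links it to the notion in [holomorphic_on]. *)
Definition cdiff {V : NormedModule C_AbsRing} (F : C -> V) (z0 : C) (L : V) : Prop :=
  forall e, 0 < e -> exists d, 0 < d /\ forall z, Cmod (z - z0)%C < d ->
    norm (minus (minus (F z) (F z0)) ((z - z0)%C *: L)) <= e * Cmod (z - z0)%C.

Definition cdiffable {V : NormedModule C_AbsRing} (F : C -> V) (z0 : C) : Prop :=
  exists L, cdiff F z0 L.

Lemma cdiffable_ex_derive {V : NormedModule C_AbsRing} (F : C -> V) (z0 : C) :
  cdiffable F z0 <-> ex_derive (K := C_AbsRing) (V := V) F z0.
Proof.
split.
- intros [L HL]; exists L; split; [apply is_linear_scal_l|].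
  intros x Hx.
  apply (is_filter_lim_locally_unique (K := C_AbsRing) (V := AbsRing_NormedModule C_AbsRing) z0 x) in Hx.
  subst x; intros e.
  destruct (HL e (cond_pos e)) as [d [Hd H]].
  exists (mkposreal d Hd); intros z Hz; apply (H z Hz).
- intros [L [_ HL]]; exists L; intros e He.
  destruct (HL z0 (fun P HP => HP) (mkposreal e He)) as [d Hd].
  exists d; split; [apply cond_pos|]; intros z Hz; apply (Hd z Hz).
Qed.

Lemma cdiffable_bound {V : NormedModule C_AbsRing} (F : C -> V) (z0 : C) : cdiffable F z0 ->
  exists M d, 0 < d /\ 0 <= M /\ forall z, Cmod (z - z0)%C < d ->
    norm (minus (F z) (F z0)) <= M * Cmod (z - z0)%C.
Proof.
intros [L HL]; destruct (HL 1 Rlt_0_1) as [d [Hd H]].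
exists (1 + norm L), d; pose proof (norm_ge_0 L); repeat split; [assumption|lra|].
intros z Hz; specialize (H z Hz).
pose proof (norm_le_minus (minus (F z) (F z0)) ((z - z0)%C *: L)) as H1.
pose proof (norm_Cscal (z - z0)%C L); lra.
Qed.

Lemma cdiffable_continuous {V : NormedModule C_AbsRing} (F : C -> V) (z0 : C) : cdiffable F z0 ->
  forall e, 0 < e -> exists d, 0 < d /\ forall z, Cmod (z - z0)%C < d ->
    norm (minus (F z) (F z0)) < e.
Proof.
intros HF e He; destruct (cdiffable_bound F z0 HF) as [M [d [Hd [HM H]]]].
assert (Hq : 0 < e / (M + 1)) by (apply Rdiv_lt_0_compat; lra).
exists (Rmin d (e / (M + 1))); split; [now apply Rmin_glb_lt|]; intros z Hz.
assert (H1 := Rlt_le_trans _ _ _ Hz (Rmin_l _ _)).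
assert (H2 := Rlt_le_trans _ _ _ Hz (Rmin_r _ _)).
eapply Rle_lt_trans; [now apply H|].
apply Rle_lt_trans with (M * (e / (M + 1))).
{ apply Rmult_le_compat_l; lra. }
apply Rlt_le_trans with ((M + 1) * (e / (M + 1))); [|right; field; lra].
apply Rmult_lt_compat_r; lra.
Qed.

Lemma cdiffable_const {V : NormedModule C_AbsRing} (v : V) (z0 : C) : cdiffable (fun _ => v) z0.
Proof.
exists (zero : V); intros e He; exists 1; split; [lra|]; intros z _.
replace (minus (minus v v) ((z - z0)%C *: (zero : V))) with (zero : V) by module V.
rewrite norm_0; apply Rmult_le_pos; [lra|apply Cmod_ge_0].
Qed.

Lemma cdiffable_id (z0 : C) : cdiffable (V := C_NormedModule) (fun z => z) z0.
Proof.
exists (RtoC 1); intros e He; exists 1; split; [lra|]; intros z _.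
replace (minus (minus (z : C_NormedModule) z0) ((z - z0)%C *: (RtoC 1 : C_NormedModule)))
  with (zero : C_NormedModule).
- rewrite norm_0; apply Rmult_le_pos; [lra|apply Cmod_ge_0].
- change (RtoC 0 = ((z - z0) - (z - z0) * 1)%C); ring.
Qed.

Lemma cdiffable_plus {V : NormedModule C_AbsRing} (F G : C -> V) (z0 : C) :
  cdiffable F z0 -> cdiffable G z0 -> cdiffable (fun z => plus (F z) (G z)) z0.
Proof.
intros [L HL] [M HM]; exists (plus L M); intros e He.
destruct (HL (e / 2) ltac:(lra)) as [d1 [Hd1 H1]].
destruct (HM (e / 2) ltac:(lra)) as [d2 [Hd2 H2]].
exists (Rmin d1 d2); split; [now apply Rmin_glb_lt|]; intros z Hz.
specialize (H1 z (Rlt_le_trans _ _ _ Hz (Rmin_l _ _))).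
specialize (H2 z (Rlt_le_trans _ _ _ Hz (Rmin_r _ _))).
norm_rewrite V (plus (minus (minus (F z) (F z0)) ((z - z0)%C *: L))
             (minus (minus (G z) (G z0)) ((z - z0)%C *: M))).
eapply Rle_trans; [apply norm_triangle|]; lra.
Qed.

Lemma cdiffable_scal {V : NormedModule C_AbsRing} (f : C -> C) (F : C -> V) (z0 : C) :
  cdiffable (V := C_NormedModule) f z0 -> cdiffable F z0 -> cdiffable (fun z => f z *: F z) z0.
Proof.
intros Hf HF.
destruct (cdiffable_bound F z0 HF) as [M [d1 [Hd1 [HM H1]]]].
destruct Hf as [l Hl], HF as [L HL].
exists (plus (f z0 *: L) (l *: F z0)); intros e He.
set (a := Cmod (f z0)); set (b := norm (F z0)); set (c := Cmod l).
assert (Ha : 0 <= a) by apply Cmod_ge_0.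
assert (Hb : 0 <= b) by apply norm_ge_0.
assert (Hc : 0 <= c) by apply Cmod_ge_0.
set (k := a + b + c + 1).
destruct (HL (e / 3 / k)) as [d2 [Hd2 H2]].
{ apply Rdiv_lt_0_compat; unfold k; lra. }
set (e1 := e / 3 / k).
assert (He1 : 0 < e1) by (apply Rdiv_lt_0_compat; unfold k; lra).
assert (Hk : e1 * k = e / 3) by (unfold e1; field; unfold k; lra).
destruct (Hl e1 He1) as [d3 [Hd3 H3]].
(* The product of the two increments is quadratic, at most (c + e1) M t^2; the radius [d4] turns it
   into at most (e/3) t. *)
set (d4 := e / 3 / ((M + 1) * (c + e1 + 1))).
assert (Hd4 : 0 < d4) by (apply Rdiv_lt_0_compat; [lra|apply Rmult_lt_0_compat; lra]).
assert (Hd4' : d4 * ((M + 1) * (c + e1 + 1)) = e / 3) by (unfold d4; field; lra).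
exists (Rmin (Rmin d1 d2) (Rmin d3 d4)); split.
{ repeat apply Rmin_glb_lt; assumption. }
intros z Hz.
assert (Hz12 := Rlt_le_trans _ _ _ Hz (Rmin_l _ _)).
assert (Hz34 := Rlt_le_trans _ _ _ Hz (Rmin_r _ _)).
assert (Hz1 := Rlt_le_trans _ _ _ Hz12 (Rmin_l _ _)).
assert (Hz2 := Rlt_le_trans _ _ _ Hz12 (Rmin_r _ _)).
assert (Hz3 := Rlt_le_trans _ _ _ Hz34 (Rmin_l _ _)).
assert (Hz4 := Rlt_le_trans _ _ _ Hz34 (Rmin_r _ _)).
specialize (H1 z Hz1); specialize (H2 z Hz2); specialize (H3 z Hz3).
change (Cmod ((f z - f z0) - (z - z0) * l)%C <= e1 * Cmod (z - z0)%C) in H3.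
set (t := Cmod (z - z0)%C) in *.
assert (Ht : 0 <= t) by apply Cmod_ge_0.
assert (H4 : Cmod (f z - f z0)%C <= (c + e1) * t).
{ replace (f z - f z0)%C with (((f z - f z0) - (z - z0) * l) + (z - z0) * l)%C by ring.
  eapply Rle_trans; [apply Cmod_triangle|]; rewrite Cmod_mult; fold t c; lra. }
norm_rewrite V (plus (f z0 *: minus (minus (F z) (F z0)) ((z - z0)%C *: L))
       (plus (((f z - f z0) - (z - z0) * l)%C *: F z0)
             ((f z - f z0)%C *: minus (F z) (F z0)))).
eapply Rle_trans; [apply norm_triangle|].
eapply Rle_trans; [apply Rplus_le_compat_l, norm_triangle|].
rewrite !norm_Cscal_eq; fold a b.
set (n1 := norm (minus (minus (F z) (F z0)) ((z - z0)%C *: L))) in *.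
set (n2 := norm (minus (F z) (F z0))) in *.
assert (K1 : a * n1 <= a * (e1 * t)) by (apply Rmult_le_compat_l; [lra|exact H2]).
assert (K2 : Cmod (f z - f z0 - (z - z0) * l)%C * b <= e1 * t * b) by (apply Rmult_le_compat_r; lra).
assert (K3 : Cmod (f z - f z0)%C * n2 <= (c + e1) * t * (M * t)).
{ apply Rmult_le_compat; [apply Cmod_ge_0|apply norm_ge_0|exact H4|exact H1]. }
assert (K4 : (c + e1) * t * (M * t) <= e / 3 * t).
{ rewrite <- Hd4'.
  replace ((c + e1) * t * (M * t)) with ((t * ((c + e1) * M)) * t) by ring.
  apply Rmult_le_compat_r; [lra|].
  apply Rmult_le_compat; [lra|apply Rmult_le_pos; lra|lra|nra]. }
assert (K5 : a * (e1 * t) + e1 * t * b <= e / 3 * t).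
{ rewrite <- Hk; unfold k.
  assert (0 <= e1 * t) by (apply Rmult_le_pos; lra).
  assert (0 <= e1 * t * c) by (apply Rmult_le_pos; lra); nra. }
assert (0 <= e * t) by (apply Rmult_le_pos; lra); lra.
Qed.

Lemma cdiffable_linear {V W : NormedModule C_AbsRing} (l : V -> W) (F : C -> V) (z0 : C) :
  is_linear l -> cdiffable F z0 -> cdiffable (fun z => l (F z)) z0.
Proof.
intros Hl [L HL]; destruct (linear_norm _ Hl) as [M [HM Hn]].
exists (l L); intros e He.
destruct (HL (e / M)) as [d [Hd H]]; [now apply Rdiv_lt_0_compat|].
exists d; split; [assumption|]; intros z Hz; specialize (H z Hz).
replace (minus (minus (l (F z)) (l (F z0))) ((z - z0)%C *: l L))
  with (l (minus (minus (F z) (F z0)) ((z - z0)%C *: L))).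
2: { unfold minus; rewrite !(linear_plus _ Hl), !(linear_opp _ _ Hl), (linear_scal _ Hl); reflexivity. }
eapply Rle_trans; [apply Hn|].
apply Rle_trans with (M * (e / M * Cmod (z - z0)%C)); [apply Rmult_le_compat_l; lra|].
right; field; lra.
Qed.

Lemma cdiffable_ext {V : NormedModule C_AbsRing} (F G : C -> V) (z0 : C) :
  (forall z, F z = G z) -> cdiffable F z0 -> cdiffable G z0.
Proof. intros H; replace G with F; [auto|now apply functional_extensionality]. Qed.

Lemma cdiffable_reflect {V : NormedModule C_AbsRing} (F : C -> V) (z0 : C) :
  cdiffable F (1 - z0)%C -> cdiffable (fun z => F (1 - z)%C) z0.
Proof.
intros [L HL]; exists (opp L); intros e He; destruct (HL e He) as [d [Hd H]].
exists d; split; [assumption|]; intros z Hz.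
assert (E : Cmod (1 - z - (1 - z0))%C = Cmod (z - z0)%C).
{ rewrite <- Cmod_opp; f_equal; ring. }
specialize (H (1 - z)%C); rewrite E in H; specialize (H Hz).
eapply Rle_trans; [|exact H]; right; f_equal; module V.
Qed.

Section ResolventFunction.

Variable B : banach_algebra.
Variable a : B.
Variable r : C -> B.
Hypothesis Hr : forall z s, ba_resolvent z a s -> ba_resolvent z a (r z).

(** z - a is z0 - a times 1 - (z0 - z) r(z0), in either order, and the Neumann series inverts the
    second factor with norm at most 2. The two orders give a left and a right inverse, which
    coincide. [Hr] then passes from this inverse to [r z], a value that is arbitrary off the
    resolvent set. *)
Lemma resolvent_open (z0 : C) : ba_resolvent z0 a (r z0) ->
  exists d, 0 < d /\ forall z, Cmod (z - z0)%C < d -> ba_resolvent z a (r z) /\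
    norm (r z) <= 2 * norm (r z0).
Proof.
intros [H1 H2].
pose proof (norm_ge_0 (r z0)) as Hn.
exists (/ 2 / (norm (r z0) + 1)); split; [apply Rdiv_lt_0_compat; lra|]; intros z Hz.
destruct (neumann_one B ((z0 - z)%C *: r z0)) as [j [[J1 J2] J3]].
{ rewrite norm_Cscal_eq; replace (z0 - z)%C with (- (z - z0))%C by ring; rewrite Cmod_opp.
  apply Rle_trans with (/ 2 / (norm (r z0) + 1) * (norm (r z0) + 1)); [|right; field; lra].
  apply Rmult_le_compat; try lra; apply Cmod_ge_0. }
assert (E1 : minus (z *: ba_one) a
   = minus ba_one ((z0 - z)%C *: r z0) ** minus (z0 *: ba_one) a).
{ rewrite ba_minus_l, ba_scal_l, H1, ba_one_l; module B. }
assert (E2 : minus (z *: ba_one) a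
   = minus (z0 *: ba_one) a ** minus ba_one ((z0 - z)%C *: r z0)).
{ rewrite ba_minus_r, ba_scal_r, H2, ba_one_r; module B. }
assert (L : (r z0 ** j) ** minus (z *: ba_one) a = ba_one).
{ rewrite E1, ba_assoc, <- (ba_assoc B j), J1, ba_one_l; exact H1. }
assert (R : minus (z *: ba_one) a ** (j ** r z0) = ba_one).
{ rewrite E2, ba_assoc, <- (ba_assoc B _ j), J2, ba_one_l; exact H2. }
assert (E : r z0 ** j = j ** r z0) by exact (left_right_inverse B _ _ _ L R).
assert (Hs : ba_resolvent z a (r z0 ** j)).
{ split; [exact L|]; rewrite E; exact R. }
split; [exact (Hr z _ Hs)|].
rewrite (ba_inverse_unique B _ _ _ (Hr z _ Hs) Hs).
eapply Rle_trans; [apply ba_norm_mul|]; nra.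
Qed.

Lemma resolvent_identity (z w : C) : ba_resolvent z a (r z) -> ba_resolvent w a (r w) ->
  minus (r z) (r w) = (w - z)%C *: (r z ** r w).
Proof.
intros [H1 _] [_ H2].
transitivity (minus (r z ** (minus (w *: ba_one) a ** r w)) ((r z ** minus (z *: ba_one) a) ** r w)).
- now rewrite H1, H2, ba_one_l, ba_one_r.
- ba_expand; module B.
Qed.

(** The derivative is -r(z0)^2. Two uses of the resolvent identity show that the remainder is
    exactly (z0 - z)^2 r(z) r(z0)^2, and r(z) is at most twice r(z0) in norm near z0. *)
Lemma cdiffable_resolvent (z0 : C) : ba_resolvent z0 a (r z0) -> cdiffable r z0.
Proof.
intros H0; destruct (resolvent_open z0 H0) as [d [Hd H]].
pose proof (norm_ge_0 (r z0)) as Hn; set (n := norm (r z0)) in *.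
exists (opp (r z0 ** r z0)); intros e He.
exists (Rmin d (e / (2 * n * n * n + 1))).
assert (Hp0 : 0 <= n * n * n) by (repeat apply Rmult_le_pos; lra).
assert (Hp : 0 < 2 * n * n * n + 1) by lra.
split; [apply Rmin_glb_lt; [assumption|now apply Rdiv_lt_0_compat]|]; intros z Hz.
destruct (H z (Rlt_le_trans _ _ _ Hz (Rmin_l _ _))) as [Hz1 Hz2].
assert (Hz3 := Rlt_le_trans _ _ _ Hz (Rmin_r _ _)).
assert (E : minus (minus (r z) (r z0)) ((z - z0)%C *: opp (r z0 ** r z0))
  = ((z0 - z) * (z0 - z))%C *: (r z ** r z0 ** r z0)).
{ transitivity ((z0 - z)%C *: (minus (r z) (r z0) ** r z0)).
  - rewrite (resolvent_identity z z0) at 1 by assumption; rewrite ba_minus_l; module B.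
  - rewrite (resolvent_identity z z0) by assumption; rewrite ba_scal_l; module B. }
rewrite E, norm_Cscal_eq, Cmod_mult.
replace (z0 - z)%C with (- (z - z0))%C by ring; rewrite Cmod_opp.
set (t := Cmod (z - z0)%C) in *.
assert (Ht : 0 <= t) by apply Cmod_ge_0.
assert (Hm : norm (r z ** r z0 ** r z0) <= 2 * n * n * n).
{ eapply Rle_trans; [apply ba_norm_mul|]; fold n.
  apply Rmult_le_compat_r; [lra|].
  eapply Rle_trans; [apply ba_norm_mul|]; fold n.
  apply Rmult_le_compat_r; lra. }
apply Rle_trans with (t * (t * (2 * n * n * n))).
{ rewrite Rmult_assoc; repeat (apply Rmult_le_compat_l; [lra|]); exact Hm. }
rewrite Rmult_comm; apply Rmult_le_compat_r; [lra|].
apply Rle_trans with (e / (2 * n * n * n + 1) * (2 * n * n * n + 1)); [|right; field; lra].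
apply Rmult_le_compat; lra.
Qed.

End ResolventFunction.

Definition C_algebra : banach_algebra.
Proof.
refine {| ba_mod := C_NormedModule; ba_mul := Cmult; ba_one := RtoC 1; ba_complete := C_norm_complete |}.
- intros; symmetry; apply Cmult_assoc.
- apply Cmult_1_l.
- apply Cmult_1_r.
- intros a b c; apply Cmult_plus_distr_r.
- intros a b c; apply Cmult_plus_distr_l.
- intros k a b; symmetry; apply Cmult_assoc.
- intros k a b; change (a * (k * b) = k * (a * b))%C; ring.
- intros a b; right; apply (Cmod_mult a b).
- right; apply Cmod_1.
Defined.

(** 1/(z-w) is the resolvent of the element w of the algebra C. *)
Lemma cdiffable_Cinv_sub (w z0 : C) : z0 <> w ->
  cdiffable (V := C_NormedModule) (fun z => / (z - w))%C z0.
Proof.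
intros H.
assert (E : forall z s, @ba_resolvent C_algebra z w s -> @ba_resolvent C_algebra z w (/ (z - w))%C).
{ intros z s [H1 H2].
  change (s * (z * 1 - w) = 1)%C in H1.
  assert (Hz : (z - w)%C <> RtoC 0).
  { intros Hz; replace (z * 1 - w)%C with (z - w)%C in H1 by ring; rewrite Hz, Cmult_0_r in H1.
    apply RtoC_inj in H1; lra. }
  split; [change (/ (z - w) * (z * 1 - w) = 1)%C|change ((z * 1 - w) * / (z - w) = 1)%C]; field; assumption. }
apply (cdiffable_resolvent C_algebra w _ E).
assert (Hz : (z0 - w)%C <> RtoC 0).
{ intros Hz; apply H; replace z0 with (w + (z0 - w))%C by ring; rewrite Hz; ring. }
split; [change (/ (z0 - w) * (z0 * 1 - w) = 1)%C|change ((z0 * 1 - w) * / (z0 - w) = 1)%C]; field; assumption.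
Qed.

(** * Calculus of a real variable *)

Definition rcont {V : NormedModule C_AbsRing} (f : R -> V) (x : R) : Prop :=
  forall e, 0 < e -> exists d, 0 < d /\ forall y, Rabs (y - x) < d -> norm (minus (f y) (f x)) < e.

Definition rdiff {V : NormedModule C_AbsRing} (f : R -> V) (x : R) (l : V) : Prop :=
  forall e, 0 < e -> exists d, 0 < d /\ forall y, Rabs (y - x) < d ->
    norm (minus (minus (f y) (f x)) (RtoC (y - x) *: l)) <= e * Rabs (y - x).

Section RealVariable.

Context {V : NormedModule C_AbsRing}.
Implicit Types f g : R -> V.

Lemma rcont_continuous f x : rcont f x -> continuous (U := real_module V) f x.
Proof.
intros H; apply filterlim_locally; intros e.
destruct (H e (cond_pos e)) as [d [Hd Hy]]; exists (mkposreal d Hd); intros y H'.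
apply (norm_compat1 (V := V)); apply Hy; exact H'.
Qed.

Lemma rcont_const (v : V) x : rcont (fun _ => v) x.
Proof. intros e He; exists 1; split; [lra|]; intros y _; rewrite norm_minus_self; lra. Qed.

Lemma rcont_plus f g x : rcont f x -> rcont g x -> rcont (fun t => plus (f t) (g t)) x.
Proof.
intros Hf Hg e He.
destruct (Hf (e / 2) ltac:(lra)) as [d1 [Hd1 H1]].
destruct (Hg (e / 2) ltac:(lra)) as [d2 [Hd2 H2]].
exists (Rmin d1 d2); split; [now apply Rmin_glb_lt|]; intros y Hy.
specialize (H1 y (Rlt_le_trans _ _ _ Hy (Rmin_l _ _))).
specialize (H2 y (Rlt_le_trans _ _ _ Hy (Rmin_r _ _))).
apply Rle_lt_trans with (norm (minus (f y) (f x)) + norm (minus (g y) (g x))); [|lra].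
norm_rewrite V (plus (minus (f y) (f x)) (minus (g y) (g x))); apply norm_triangle.
Qed.

Lemma rcont_opp f x : rcont f x -> rcont (fun t => opp (f t)) x.
Proof.
intros Hf e He; destruct (Hf e He) as [d [Hd H]].
exists d; split; [assumption|]; intros y Hy; eapply Rle_lt_trans; [|exact (H y Hy)].
norm_rewrite V (opp (minus (f y) (f x))); rewrite norm_opp; apply Rle_refl.
Qed.

Lemma rcont_minus f g x : rcont f x -> rcont g x -> rcont (fun t => minus (f t) (g t)) x.
Proof. intros Hf Hg; apply rcont_plus; [|apply rcont_opp]; assumption. Qed.

Lemma rcont_scal (k : R -> C) f x :
  rcont (V := C_NormedModule) k x -> rcont f x -> rcont (fun t => k t *: f t) x.
Proof.
intros Hk Hf e He.
set (a := Cmod (k x)); set (b := norm (f x)).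
assert (Ha : 0 <= a) by apply Cmod_ge_0.
assert (Hb : 0 <= b) by apply norm_ge_0.
assert (He1 : 0 < e / 3 / (b + 1)) by (apply Rdiv_lt_0_compat; lra).
destruct (Hk _ He1) as [d1 [Hd1 H1]].
assert (He2 : 0 < e / 3 / (a + e / 3 / (b + 1) + 1)) by (apply Rdiv_lt_0_compat; lra).
destruct (Hf _ He2) as [d2 [Hd2 H2]].
exists (Rmin d1 d2); split; [now apply Rmin_glb_lt|]; intros y Hy.
specialize (H1 y (Rlt_le_trans _ _ _ Hy (Rmin_l _ _))).
specialize (H2 y (Rlt_le_trans _ _ _ Hy (Rmin_r _ _))).
change (Cmod (k y - k x)%C < e / 3 / (b + 1)) in H1.
set (e1 := e / 3 / (b + 1)) in *; set (e2 := e / 3 / (a + e1 + 1)) in *.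
assert (K1 : e1 * (b + 1) = e / 3) by (unfold e1; field; lra).
assert (K2 : e2 * (a + e1 + 1) = e / 3) by (unfold e2; field; lra).
eapply Rle_lt_trans.
{ norm_rewrite V (plus ((k y - k x)%C *: f x)
                   (plus ((k y - k x)%C *: minus (f y) (f x)) (k x *: minus (f y) (f x)))).
  eapply Rle_trans; [apply norm_triangle|].
  apply Rplus_le_compat_l, norm_triangle. }
rewrite !norm_Cscal_eq; fold a b.
assert (Hp := Cmod_ge_0 (k y - k x)%C); assert (Hq := norm_ge_0 (minus (f y) (f x))).
set (p := Cmod (k y - k x)%C) in *; set (q := norm (minus (f y) (f x))) in *.
assert (p * b <= e1 * b) by (apply Rmult_le_compat_r; lra).
assert (p * q <= e1 * e2) by (apply Rmult_le_compat; lra).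
assert (a * q <= a * e2) by (apply Rmult_le_compat_l; lra).
nra.
Qed.

Lemma rcont_cdiffable (F : C -> V) (h : R -> C) x :
  cdiffable F (h x) -> rcont (V := C_NormedModule) h x -> rcont (fun t => F (h t)) x.
Proof.
intros HF Hh e He; destruct (cdiffable_continuous F (h x) HF e He) as [d [Hd H]].
destruct (Hh d Hd) as [d' [Hd' H']].
exists d'; split; [assumption|]; intros y Hy; apply H, H', Hy.
Qed.

Lemma rdiff_rcont f x l : rdiff f x l -> rcont f x.
Proof.
intros H e He; destruct (H 1 Rlt_0_1) as [d [Hd Hy]].
pose proof (norm_ge_0 l) as Hn.
assert (He' : 0 < e / (norm l + 2)) by (apply Rdiv_lt_0_compat; lra).
exists (Rmin d (e / (norm l + 2))); split; [now apply Rmin_glb_lt|]; intros y Hxy.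
specialize (Hy y (Rlt_le_trans _ _ _ Hxy (Rmin_l _ _))).
assert (H2 := Rlt_le_trans _ _ _ Hxy (Rmin_r _ _)).
pose proof (norm_le_minus (minus (f y) (f x)) (RtoC (y - x) *: l)) as H1.
rewrite norm_Cscal_eq, Cmod_R in H1.
pose proof (Rabs_pos (y - x)).
assert (e / (norm l + 2) * (norm l + 2) = e) by (field; lra).
nra.
Qed.

Lemma rdiff_is_derive f x l : rdiff f x l -> is_derive (K := R_AbsRing) (V := real_module V) f x l.
Proof.
intros H; split; [apply (is_linear_scal_l (K := R_AbsRing) (V := real_module V))|].
intros x' Hx'.
apply (is_filter_lim_locally_unique (K := R_AbsRing) (V := R_NormedModule) x x') in Hx'.
subst x'; intros e; destruct (H e (cond_pos e)) as [d [Hd Hy]].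
exists (mkposreal d Hd); intros y H'; apply (Hy y H').
Qed.

End RealVariable.

Lemma rdiff_chain {V : NormedModule C_AbsRing} (F : C -> V) (h : R -> C) x (L : V) (l : C) :
  cdiff F (h x) L -> rdiff (V := C_NormedModule) h x l -> rdiff (fun t => F (h t)) x (l *: L).
Proof.
intros HF Hh e He.
set (m := Cmod l + 1); set (n := norm L + 1).
assert (Hm : 0 < m) by (unfold m; pose proof (Cmod_ge_0 l); lra).
assert (Hn : 0 < n) by (unfold n; pose proof (norm_ge_0 L); lra).
assert (He1 : 0 < e / 2 / m) by (apply Rdiv_lt_0_compat; lra).
(* The cap 1 keeps the increment of [h] below m t, against which the error of [F] is measured; e/2/n
   pays for the error of [h]. *)
assert (He2 : 0 < Rmin 1 (e / 2 / n)) by (apply Rmin_glb_lt; [lra|apply Rdiv_lt_0_compat; lra]).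
destruct (HF _ He1) as [d1 [Hd1 H1]].
destruct (rdiff_rcont _ _ _ Hh d1 Hd1) as [d2 [Hd2 H2]].
destruct (Hh _ He2) as [d3 [Hd3 H3]].
exists (Rmin d2 d3); split; [now apply Rmin_glb_lt|]; intros y Hy.
specialize (H2 y (Rlt_le_trans _ _ _ Hy (Rmin_l _ _))).
specialize (H3 y (Rlt_le_trans _ _ _ Hy (Rmin_r _ _))).
specialize (H1 (h y) H2).
set (e2 := Rmin 1 (e / 2 / n)) in *.
change (Cmod ((h y - h x) - RtoC (y - x) * l)%C <= e2 * Rabs (y - x)) in H3.
set (t := Rabs (y - x)) in *.
assert (Ht : 0 <= t) by apply Rabs_pos.
assert (H4 : Cmod (h y - h x)%C <= (Cmod l + e2) * t).
{ replace (h y - h x)%C with (((h y - h x) - RtoC (y - x) * l) + RtoC (y - x) * l)%C by ring.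
  eapply Rle_trans; [apply Cmod_triangle|]; rewrite Cmod_mult, Cmod_R; fold t; lra. }
norm_rewrite V (plus (minus (minus (F (h y)) (F (h x))) ((h y - h x)%C *: L))
                     (((h y - h x) - RtoC (y - x) * l)%C *: L)).
eapply Rle_trans; [apply norm_triangle|]; rewrite norm_Cscal_eq.
assert (E2 : e2 <= e / 2 / n) by apply Rmin_r.
assert (E3 : e2 <= 1) by apply Rmin_l.
assert (E4 : e2 * n <= e / 2).
{ apply Rle_trans with (e / 2 / n * n); [apply Rmult_le_compat_r; lra|right; field; lra]. }
assert (E5 : e / 2 / m * m = e / 2) by (field; lra).
assert (K1 : e / 2 / m * Cmod (h y - h x)%C <= e / 2 * t).
{ apply Rle_trans with (e / 2 / m * (m * t)); [|right; rewrite <- Rmult_assoc, E5; reflexivity].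
  apply Rmult_le_compat_l; [lra|]; eapply Rle_trans; [exact H4|]; apply Rmult_le_compat_r; unfold m; lra. }
assert (K2 : Cmod ((h y - h x) - RtoC (y - x) * l)%C * norm L <= e / 2 * t).
{ pose proof (norm_ge_0 L); apply Rle_trans with (e2 * t * n).
  - apply Rmult_le_compat; [apply Cmod_ge_0|assumption|assumption|unfold n; lra].
  - replace (e2 * t * n) with (e2 * n * t) by ring; apply Rmult_le_compat_r; lra. }
lra.
Qed.

Lemma Cmod_le_Re_Im (z : C) : Cmod z <= Rabs (Re z) + Rabs (Im z).
Proof.
replace z with (RtoC (Re z) + Ci * RtoC (Im z))%C at 1.
- eapply Rle_trans; [apply Cmod_triangle|]; rewrite Cmod_mult, !Cmod_R.
  unfold Ci, Cmod; simpl; replace (0 * (0 * 1) + 1 * (1 * 1)) with 1 by ring; rewrite sqrt_1; lra.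
- destruct z as [u v]; unfold Cplus, Cmult, Ci, RtoC; simpl; f_equal; ring.
Qed.

Lemma rdiff_pair (f : R -> C) (x : R) (l : C) :
  is_derive (fun t => Re (f t)) x (Re l) -> is_derive (fun t => Im (f t)) x (Im l) ->
  rdiff (V := C_NormedModule) f x l.
Proof.
assert (K : forall g l0, is_derive g x l0 -> forall e, 0 < e -> exists d, 0 < d /\ forall y,
   Rabs (y - x) < d -> Rabs (g y - g x - (y - x) * l0) <= e * Rabs (y - x)).
{ intros g l0 [_ H] e He; destruct (H x (fun P HP => HP) (mkposreal e He)) as [d Hd].
  exists d; split; [apply cond_pos|]; intros y Hy; exact (Hd y Hy). }
intros H1 H2 e He.
destruct (K _ _ H1 (e / 2) ltac:(lra)) as [d1 [Hd1 K1]].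
destruct (K _ _ H2 (e / 2) ltac:(lra)) as [d2 [Hd2 K2]].
exists (Rmin d1 d2); split; [now apply Rmin_glb_lt|]; intros y Hy.
specialize (K1 y (Rlt_le_trans _ _ _ Hy (Rmin_l _ _))).
specialize (K2 y (Rlt_le_trans _ _ _ Hy (Rmin_r _ _))).
change (Cmod ((f y - f x) - RtoC (y - x) * l)%C <= e * Rabs (y - x)).
eapply Rle_trans; [apply Cmod_le_Re_Im|].
replace (Re (f y - f x - RtoC (y - x) * l)%C) with (Re (f y) - Re (f x) - (y - x) * Re l)
  by (unfold Re, Im; simpl; ring).
replace (Im (f y - f x - RtoC (y - x) * l)%C) with (Im (f y) - Im (f x) - (y - x) * Im l)
  by (unfold Re, Im; simpl; ring).
lra.
Qed.

(** Dilating this circle by a real s gives coordinates (s,u): polar coordinates for c0 = 0 and c1 =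
    1, and for the values [stolz_c0], [stolz_c1] a system in which both the segments and the arc of
    a Stolz boundary are coordinate lines. *)
Definition circ (c0 c1 : C) (u : R) : C := (c0 + c1 * cis u)%C.

Lemma rdiff_circ (c0 c1 : C) (u : R) :
  rdiff (V := C_NormedModule) (circ c0 c1) u (c1 * (Ci * cis u))%C.
Proof.
destruct c0 as [a0 b0], c1 as [a1 b1].
apply rdiff_pair; unfold circ, cis, Re, Im; simpl; auto_derive; auto; ring.
Qed.

Lemma rdiff_ray (c : C) (t : R) : rdiff (V := C_NormedModule) (fun t => RtoC t * c)%C t c.
Proof.
destruct c as [a b].
apply rdiff_pair; unfold Re, Im; simpl; auto_derive; auto; ring.
Qed.

Lemma rdiff_scal {V : NormedModule C_AbsRing} (k : C) (f : R -> V) (x : R) (l : V) :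
  rdiff f x l -> rdiff (fun t => k *: f t) x (k *: l).
Proof.
intros H e He.
assert (Hk := Cmod_ge_0 k).
assert (He' : 0 < e / (Cmod k + 1)) by (apply Rdiv_lt_0_compat; lra).
destruct (H _ He') as [d [Hd Hy]]; exists d; split; [assumption|]; intros y Hxy.
specialize (Hy y Hxy).
norm_rewrite V (k *: minus (minus (f y) (f x)) (RtoC (y - x) *: l)).
rewrite norm_Cscal_eq.
assert (E : e / (Cmod k + 1) * (Cmod k + 1) = e) by (field; lra).
pose proof (norm_ge_0 (minus (minus (f y) (f x)) (RtoC (y - x) *: l))).
replace (e * Rabs (y - x)) with (e / (Cmod k + 1) * (Cmod k + 1) * Rabs (y - x)) by (rewrite E; reflexivity).
apply Rle_trans with ((Cmod k + 1) * norm (minus (minus (f y) (f x)) (RtoC (y - x) *: l))); [nra|].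
replace (e / (Cmod k + 1) * (Cmod k + 1) * Rabs (y - x))
  with ((Cmod k + 1) * (e / (Cmod k + 1) * Rabs (y - x))) by ring.
apply Rmult_le_compat_l; lra.
Qed.

(** * Riemann integrals with values in a complex normed module *)

Definition is_Int {V : NormedModule C_AbsRing} (f : R -> V) (a b : R) (l : V) : Prop :=
  is_RInt (V := real_module V) f a b l.

(** Choice gives the integral a name in any normed module, complete or not; the name is meaningful
    once some [is_Int] holds, and [Int_eq] then identifies it. *)
Definition CInt {V : NormedModule C_AbsRing} (f : R -> V) (a b : R) : V :=
  epsilon (inhabits zero) (is_Int f a b).

Section Integral.

Context {V : NormedModule C_AbsRing}.
Implicit Types f g : R -> V.

Lemma is_Int_unique f a b l l' : is_Int f a b l -> is_Int f a b l' -> l = l'.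
Proof.
intros H H'.
exact (filterlim_locally_unique (V := real_module V) _ _ _ H H').
Qed.

Lemma Int_eq f a b l : is_Int f a b l -> CInt f a b = l.
Proof.
intros H; apply (is_Int_unique f a b); [|exact H].
unfold CInt; apply epsilon_spec; now exists l.
Qed.

Lemma ex_Int (CV : norm_complete V) f a b : a <= b ->
  (forall x, a <= x <= b -> rcont f x) -> is_Int f a b (CInt f a b).
Proof.
intros Hab Hf; unfold CInt; apply epsilon_spec.
destruct (ex_RInt_continuous (V := real_complete_module V CV) f a b) as [l Hl].
{ intros z Hz; rewrite Rmin_left, Rmax_right in Hz by assumption; now apply rcont_continuous, Hf. }
now exists l.
Qed.

Lemma is_Int_ext f g a b l : a <= b -> (forall x, a < x < b -> f x = g x) ->
  is_Int f a b l -> is_Int g a b l.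
Proof.
intros Hab H; apply is_RInt_ext; intros x Hx.
rewrite Rmin_left, Rmax_right in Hx by assumption; now apply H.
Qed.

Lemma is_Int_plus f g a b l m :
  is_Int f a b l -> is_Int g a b m -> is_Int (fun t => plus (f t) (g t)) a b (plus l m).
Proof. apply (is_RInt_plus (V := real_module V)). Qed.

Lemma is_Int_opp f a b l : is_Int f a b l -> is_Int (fun t => opp (f t)) a b (opp l).
Proof. apply (is_RInt_opp (V := real_module V)). Qed.

Lemma is_Int_minus f g a b l m :
  is_Int f a b l -> is_Int g a b m -> is_Int (fun t => minus (f t) (g t)) a b (minus l m).
Proof. apply (is_RInt_minus (V := real_module V)). Qed.

Lemma is_Int_Chasles f a b c l m : is_Int f a b l -> is_Int f b c m -> is_Int f a c (plus l m).
Proof. apply (is_RInt_Chasles (V := real_module V)). Qed.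

Lemma is_Int_const (v : V) a b : is_Int (fun _ => v) a b (RtoC (b - a) *: v).
Proof. apply (is_RInt_const (V := real_module V)). Qed.

Lemma is_Int_point f a : is_Int f a a zero.
Proof. apply (is_RInt_point (V := real_module V)). Qed.

Lemma norm_is_Int_le f a b l (M : R) : a <= b -> (forall x, a <= x <= b -> norm (f x) <= M) ->
  is_Int f a b l -> norm l <= (b - a) * M.
Proof. apply (norm_RInt_le_const (V := real_module V)). Qed.

Lemma norm_is_Int_le_fun f (g : R -> R) a b l m : a <= b ->
  (forall x, a <= x <= b -> norm (f x) <= g x) -> is_Int f a b l -> is_RInt g a b m -> norm l <= m.
Proof. apply (norm_RInt_le (V := real_module V)). Qed.

Lemma is_Int_rdiff (CV : norm_complete V) f df a b : a <= b ->
  (forall x, a <= x <= b -> rdiff f x (df x)) -> (forall x, a <= x <= b -> rcont df x) ->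
  is_Int df a b (minus (f b) (f a)).
Proof.
intros Hab H1 H2.
apply (is_RInt_derive (V := real_complete_module V CV) f df a b); intros x Hx;
  rewrite Rmin_left, Rmax_right in Hx by assumption.
- exact (rdiff_is_derive (V := V) _ _ _ (H1 x Hx)).
- exact (rcont_continuous (V := V) _ _ (H2 x Hx)).
Qed.

End Integral.

(** A bounded linear map commutes with Riemann sums and, being continuous, with their limit. *)
Lemma is_Int_linear {V W : NormedModule C_AbsRing} (l : V -> W) (f : R -> V) a b I :
  is_linear l -> is_Int f a b I -> is_Int (fun t => l (f t)) a b (l I).
Proof.
intros Hl H.
assert (Hs : forall (k : R) v, l (scal (k : R_Ring) (v : real_module V)) = scal (k : R_Ring) (l v : real_module W)).
{ intros k v; apply (linear_scal l Hl). }
assert (Hc : filterlim l (locally (T := real_module V) I) (locally (T := real_module W) (l I))).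
{ exact (linear_cont l I Hl). }
unfold is_Int, is_RInt in *.
apply filterlim_ext with (fun ptd => l (scal (sign (b - a)) (Riemann_sum (V := real_module V) f ptd))).
- intros ptd; rewrite Hs; f_equal.
  apply (SF_cons_ind (fun ptd => l (Riemann_sum (V := real_module V) f ptd) = Riemann_sum (V := real_module W) (fun t => l (f t)) ptd)).
  + intros x0; apply (linear_zero l Hl).
  + intros h s IH; rewrite !Riemann_sum_cons; rewrite <- IH, <- Hs; apply (linear_plus l Hl).
- exact (filterlim_comp _ _ _ _ l _ _ _ H Hc).
Qed.

Lemma is_Int_scal {V : NormedModule C_AbsRing} (k : C) (f : R -> V) a b I :
  is_Int f a b I -> is_Int (fun t => k *: f t) a b (k *: I).
Proof.
intros H; apply (is_Int_linear (fun v => k *: v)); [|exact H].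
apply (is_linear_scal_r (V := V) (k : C_AbsRing) Cmult_comm).
Qed.

Lemma is_Int_scal_vec {V : NormedModule C_AbsRing} (k : R -> C) (v : V) a b (I : C) :
  is_Int (V := C_NormedModule) k a b I -> is_Int (fun t => k t *: v) a b (I *: v).
Proof.
intros H; apply (is_Int_linear (V := C_NormedModule) (fun c => c *: v)); [|exact H].
split.
- intros x y; apply scal_CD.
- intros c x; apply scal_CM.
- exists (norm v + 1); pose proof (norm_ge_0 v); split; [lra|]; intros c.
  change (norm (c *: v) <= (norm v + 1) * Cmod c).
  rewrite norm_Cscal_eq; pose proof (Cmod_ge_0 c); nra.
Qed.

Lemma is_linear_ba_mul_r (B : banach_algebra) (b : B) : is_linear (fun x : B => x ** b).
Proof.
split.
- intros x y; apply ba_plus_l.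
- intros c x; apply ba_scal_l.
- exists (norm b + 1); pose proof (norm_ge_0 b); split; [lra|]; intros x.
  eapply Rle_trans; [apply ba_norm_mul|]; pose proof (norm_ge_0 x); nra.
Qed.

(** The intervals starting at a n with length p/2^n are nested, and the supremum of their left ends
    lies in all of them. *)
Lemma nested_point (a : nat -> R) (p : R) : 0 <= p ->
  (forall n, a n <= a (S n) <= a n + p * (/ 2) ^ S n) ->
  exists x, forall n, a n <= x <= a n + p * (/ 2) ^ n.
Proof.
intros Hp H.
assert (Hq : forall n, 0 <= p * (/ 2) ^ n).
{ intros n; apply Rmult_le_pos; [assumption|apply pow_le; lra]. }
assert (Hup : forall n k, a n <= a (k + n)%nat).
{ intros n; induction k as [|k IH]; [apply Rle_refl|].
  simpl; pose proof (H (k + n)%nat); lra. }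
assert (Hdn : forall n k, a (k + n)%nat + p * (/ 2) ^ (k + n) <= a n + p * (/ 2) ^ n).
{ intros n; induction k as [|k IH]; [apply Rle_refl|].
  pose proof (H (k + n)%nat) as H1; simpl in *; lra. }
assert (Hall : forall m n, a m <= a n + p * (/ 2) ^ n).
{ intros m n; destruct (Nat.le_ge_cases m n) as [Hmn|Hmn].
  - pose proof (Hup m (n - m)%nat) as H1; replace (n - m + m)%nat with n in H1 by lia.
    pose proof (Hq n); lra.
  - pose proof (Hdn n (m - n)%nat) as H1; replace (m - n + n)%nat with m in H1 by lia.
    pose proof (Hq m); lra. }
destruct (completeness (fun r => exists n, r = a n)) as [x [Hx1 Hx2]].
- exists (a 0%nat + p * (/ 2) ^ 0); intros r [n ->]; apply Hall.
- exists (a 0%nat); now exists 0%nat.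
- exists x; intros n; split; [apply Hx1; now exists n|].
  apply Hx2; intros r [m ->]; apply Hall.
Qed.

Lemma Cmod_cis (u : R) : Cmod (cis u) = 1.
Proof.
unfold Cmod, cis; simpl.
replace (cos u * (cos u * 1) + sin u * (sin u * 1)) with 1; [apply sqrt_1|].
pose proof (sin2_cos2 u) as H; unfold Rsqr in H; lra.
Qed.

Lemma Cmod_Ci : Cmod Ci = 1.
Proof. unfold Cmod, Ci; simpl; replace (0 * (0 * 1) + 1 * (1 * 1)) with 1 by ring; apply sqrt_1. Qed.

Definition dcirc (c1 : C) (u : R) : C := (c1 * (Ci * cis u))%C.

Lemma Cmod_dcirc (c1 : C) (u : R) : Cmod (dcirc c1 u) = Cmod c1.
Proof. unfold dcirc; rewrite !Cmod_mult, Cmod_Ci, Cmod_cis; ring. Qed.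

Lemma Cmod_circ_le (c0 c1 : C) (u : R) : Cmod (circ c0 c1 u) <= Cmod c0 + Cmod c1.
Proof.
unfold circ; eapply Rle_trans; [apply Cmod_triangle|]; rewrite Cmod_mult, Cmod_cis; lra.
Qed.

Lemma rcont_dcirc (c1 : C) (u : R) : rcont (V := C_NormedModule) (dcirc c1) u.
Proof.
assert (H := rdiff_rcont _ _ _ (rdiff_circ (RtoC 0) (c1 * Ci)%C u)).
intros e He; destruct (H e He) as [d [Hd Hy]]; exists d; split; [assumption|]; intros y Hxy.
specialize (Hy y Hxy); eapply Rle_lt_trans; [right|exact Hy].
change (Cmod (dcirc c1 y - dcirc c1 u)%C = Cmod (circ (RtoC 0) (c1 * Ci) y - circ (RtoC 0) (c1 * Ci) u)%C).
f_equal; unfold dcirc, circ; ring.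
Qed.

(** Mean value inequality: integrate the velocity [dcirc], whose modulus is constant. *)
Lemma Cmod_circ_sub (c0 c1 : C) (u v : R) : u <= v ->
  Cmod (circ c0 c1 v - circ c0 c1 u)%C <= Cmod c1 * (v - u).
Proof.
intros H; rewrite Rmult_comm.
apply (norm_is_Int_le (V := C_NormedModule) (dcirc c1) u v); [assumption| |].
- intros x _; right; apply Cmod_dcirc.
- apply (is_Int_rdiff C_norm_complete (circ c0 c1) (dcirc c1) u v H).
  + intros x _; apply rdiff_circ.
  + intros x _; apply rcont_dcirc.
Qed.

Lemma Cmod_circ_sub_abs (c0 c1 : C) (u v : R) :
  Cmod (circ c0 c1 v - circ c0 c1 u)%C <= Cmod c1 * Rabs (v - u).
Proof.
destruct (Rle_lt_dec u v) as [H|H].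
- rewrite Rabs_pos_eq by lra; now apply Cmod_circ_sub.
- rewrite Rabs_left by lra; rewrite <- Cmod_opp.
  replace (- (circ c0 c1 v - circ c0 c1 u))%C with (circ c0 c1 u - circ c0 c1 v)%C by ring.
  eapply Rle_trans; [apply Cmod_circ_sub; lra|]; right; ring.
Qed.

(** * Cauchy's theorem on a scaled arc *)

Section Goursat.

Variable V : NormedModule C_AbsRing.
Hypothesis CV : norm_complete V.
Variable F : C -> V.
Variables c0 c1 : C.

Let h (s u : R) : C := (RtoC s * circ c0 c1 u)%C.

(** [ray_form] and [arc_form] are the pullbacks of F(z) dz to the lines u = const and s = const.
    Working on parameter rectangles spares all topology of the image, where the map need not even be
    injective. *)
Definition ray_form (u s : R) : V := circ c0 c1 u *: F (RtoC s * circ c0 c1 u)%C.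
Definition arc_form (s u : R) : V := (RtoC s * dcirc c1 u)%C *: F (RtoC s * circ c0 c1 u)%C.

Lemma rdiff_h_s u s : rdiff (V := C_NormedModule) (fun s => h s u) s (circ c0 c1 u).
Proof. apply rdiff_ray. Qed.

Lemma rdiff_h_u s u : rdiff (V := C_NormedModule) (fun u => h s u) u (RtoC s * dcirc c1 u)%C.
Proof. apply (rdiff_scal (V := C_NormedModule) (RtoC s) (circ c0 c1)), rdiff_circ. Qed.

Lemma rcont_ray_form u s : cdiffable F (h s u) -> rcont (ray_form u) s.
Proof.
intros H; apply rcont_scal; [apply (rcont_const (V := C_NormedModule))|].
apply (rcont_cdiffable F (fun s => h s u)); [exact H|]; eapply rdiff_rcont, rdiff_h_s.
Qed.

Lemma rcont_arc_form s u : cdiffable F (h s u) -> rcont (arc_form s) u.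
Proof.
intros H; apply rcont_scal.
- apply (rcont_scal (V := C_NormedModule) (fun _ => RtoC s) (dcirc c1));
    [apply (rcont_const (V := C_NormedModule))|apply rcont_dcirc].
- apply (rcont_cdiffable F (fun u => h s u)); [exact H|]; eapply rdiff_rcont, rdiff_h_u.
Qed.

(** The integral of F(z) dz around the image of the rectangle with sides [a,b] in s and [c,d] in
    u. *)
Definition circulation (a b c d : R) : V :=
  minus (plus (CInt (ray_form c) a b) (CInt (arc_form b) c d))
        (plus (CInt (ray_form d) a b) (CInt (arc_form a) c d)).

Variables a0 b0 u0 u1 : R.
Hypothesis Ha0 : 0 <= a0.
Hypothesis HF : forall s u, a0 <= s <= b0 -> u0 <= u <= u1 -> cdiffable F (h s u).

Lemma is_Int_ray u a b : a0 <= a -> a <= b -> b <= b0 -> u0 <= u <= u1 ->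
  is_Int (ray_form u) a b (CInt (ray_form u) a b).
Proof.
intros Ha Hab Hb Hu; apply ex_Int; [exact CV|assumption|].
intros x Hx; apply rcont_ray_form, HF; lra.
Qed.

Lemma is_Int_arc s c d : a0 <= s <= b0 -> u0 <= c -> c <= d -> d <= u1 ->
  is_Int (arc_form s) c d (CInt (arc_form s) c d).
Proof.
intros Hs Hc Hcd Hd; apply ex_Int; [exact CV|assumption|].
intros x Hx; apply rcont_arc_form, HF; lra.
Qed.

Lemma circulation_split_s a m b c d :
  a0 <= a -> a <= m -> m <= b -> b <= b0 -> u0 <= c -> c <= d -> d <= u1 ->
  circulation a b c d = plus (circulation a m c d) (circulation m b c d).
Proof.
intros Ha Ham Hmb Hb Hc Hcd Hd; unfold circulation.
assert (E : forall u, u0 <= u <= u1 ->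
  CInt (ray_form u) a b = plus (CInt (ray_form u) a m) (CInt (ray_form u) m b)).
{ intros u Hu; apply Int_eq, is_Int_Chasles with m; apply is_Int_ray; lra. }
rewrite (E c), (E d) by lra; module V.
Qed.

Lemma circulation_split_u a b c m d :
  a0 <= a -> a <= b -> b <= b0 -> u0 <= c -> c <= m -> m <= d -> d <= u1 ->
  circulation a b c d = plus (circulation a b c m) (circulation a b m d).
Proof.
intros Ha Hab Hb Hc Hcm Hmd Hd; unfold circulation.
assert (E : forall s, a0 <= s <= b0 ->
  CInt (arc_form s) c d = plus (CInt (arc_form s) c m) (CInt (arc_form s) m d)).
{ intros s Hs; apply Int_eq, is_Int_Chasles with m; apply is_Int_arc; lra. }
rewrite (E a), (E b) by lra; module V.
Qed.

(** A Lipschitz constant of [h] for a0 <= s <= b0 that also dominates both of its partial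
    derivatives. *)
Let K : R := Cmod c0 + (1 + b0) * Cmod c1 + 1.

Lemma Cmod_h_sub s u s' u' : a0 <= s <= b0 ->
  Cmod (h s' u' - h s u)%C <= K * (Rabs (s' - s) + Rabs (u' - u)).
Proof.
intros Hs.
replace (h s' u' - h s u)%C
  with (RtoC (s' - s) * circ c0 c1 u' + RtoC s * (circ c0 c1 u' - circ c0 c1 u))%C
  by (unfold h; rewrite RtoC_minus; ring).
eapply Rle_trans; [apply Cmod_triangle|]; rewrite !Cmod_mult, !Cmod_R, (Rabs_pos_eq s) by lra.
assert (H1 := Cmod_circ_le c0 c1 u'); assert (H2 := Cmod_circ_sub_abs c0 c1 u u').
pose proof (Cmod_ge_0 c0); pose proof (Cmod_ge_0 c1); pose proof (Rabs_pos (s' - s)); pose proof (Rabs_pos (u' - u)).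
unfold K; rewrite Rmult_plus_distr_l; apply Rplus_le_compat.
- rewrite Rmult_comm; apply Rmult_le_compat_r; [assumption|nra].
- apply Rle_trans with (s * (Cmod c1 * Rabs (u' - u))); [apply Rmult_le_compat_l; lra|].
  rewrite <- Rmult_assoc; apply Rmult_le_compat_r; [assumption|nra].
Qed.

Lemma K_pos : a0 <= b0 -> 1 <= K.
Proof.
intros H; unfold K; pose proof (Cmod_ge_0 c0); pose proof (Cmod_ge_0 c1).
assert (0 <= (1 + b0) * Cmod c1) by (apply Rmult_le_pos; lra); lra.
Qed.

Lemma Cmod_circ_le_K u : a0 <= b0 -> Cmod (circ c0 c1 u) <= K.
Proof.
intros H; eapply Rle_trans; [apply Cmod_circ_le|]; unfold K.
pose proof (Cmod_ge_0 c1); nra.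
Qed.

Lemma Cmod_dcirc_le_K s u : a0 <= s <= b0 -> Cmod (RtoC s * dcirc c1 u)%C <= K.
Proof.
intros H; rewrite Cmod_mult, Cmod_R, Rabs_pos_eq, Cmod_dcirc by lra; unfold K.
pose proof (Cmod_ge_0 c1); pose proof (Cmod_ge_0 c0); nra.
Qed.

(* The affine approximation of F at z0 has the primitive P, so only the error
   term of the approximation contributes to the circulation. *)
Lemma circulation_local s u : a0 <= s <= b0 -> u0 <= u <= u1 -> forall e, 0 < e ->
  exists dl, 0 < dl /\ forall a b c d,
    a0 <= a <= s -> s <= b <= b0 -> u0 <= c <= u -> u <= d <= u1 -> (b - a) + (d - c) < dl ->
    norm (circulation a b c d) <= e * ((b - a) + (d - c)) ^ 2.
Proof.
intros Hs Hu e He.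
pose proof (K_pos ltac:(lra)) as HK.
set (z0 := h s u).
destruct (HF s u Hs Hu) as [L HL]; fold z0 in HL.
(* An edge of parameter length x contributes at most x K (e1 K l): one K bounds the speed, the other
   the distance to [z0]. The four edges have total length 2 l, whence the divisor 2 K^2. *)
assert (He' : 0 < e / (2 * K * K)) by (apply Rdiv_lt_0_compat; nra).
destruct (HL _ He') as [dl [Hdl Hloc]].
exists (dl / K); split; [apply Rdiv_lt_0_compat; lra|].
intros a b c d Ha Hb Hc Hd Hsmall.
set (l := (b - a) + (d - c)) in *.
assert (Hl : 0 <= l) by (unfold l; lra).
assert (HlK : K * l < dl).
{ apply Rlt_le_trans with (K * (dl / K)); [apply Rmult_lt_compat_l; lra|right; field; lra]. }
set (e1 := e / (2 * K * K)) in *.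
set (P := fun z : C => plus ((z - z0)%C *: F z0) (((z - z0) * (z - z0) * RtoC (/ 2))%C *: L)).
set (G := fun z : C => plus (F z0) ((z - z0)%C *: L)).
assert (HP : forall z, cdiff P z (G z)).
{ intros z e2 He2.
  exists (e2 / (norm L + 1)); pose proof (norm_ge_0 L) as Hn; split; [apply Rdiv_lt_0_compat; lra|].
  intros y Hy.
  apply Rle_trans with (norm (((y - z) * (y - z) * RtoC (/ 2))%C *: L)).
  { right; apply (f_equal (@norm C_AbsRing V)); unfold P, G.
    assert (Hh : (RtoC (/ 2) + RtoC (/ 2) = 1)%C) by (rewrite <- RtoC_plus; f_equal; field).
    module_coefs V; [|ring].
    transitivity ((y - z) * (y - z) * RtoC (/ 2) + ((RtoC (/ 2) + RtoC (/ 2)) - 1) * ((y - z) * (z - z0)))%C;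
      [ring|rewrite Hh; ring]. }
  rewrite norm_Cscal_eq, !Cmod_mult, Cmod_R, Rabs_pos_eq by lra.
  pose proof (Cmod_ge_0 (y - z)%C) as Hyz.
  assert (E : e2 / (norm L + 1) * (norm L + 1) = e2) by (field; lra).
  set (t := Cmod (y - z)%C) in *.
  assert (t * norm L <= e2).
  { rewrite <- E; apply Rmult_le_compat; lra. }
  nra. }
assert (HE : forall s' u', a <= s' <= b -> c <= u' <= d ->
  norm (minus (F (h s' u')) (G (h s' u'))) <= e1 * (K * l)).
{ intros s' u' Hs' Hu'.
  assert (H1 : Cmod (h s' u' - z0)%C <= K * l).
  { unfold z0; eapply Rle_trans; [apply Cmod_h_sub; assumption|].
    apply Rmult_le_compat_l; [lra|]; unfold l; apply Rplus_le_compat; apply Rabs_le; lra. }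
  apply Rle_trans with (e1 * Cmod (h s' u' - z0)%C); [|apply Rmult_le_compat_l; lra].
  eapply Rle_trans; [|apply Hloc; lra].
  right; apply (f_equal (@norm C_AbsRing V)); unfold G; module V. }
assert (Hray : forall u', c <= u' <= d ->
  norm (minus (CInt (ray_form u') a b) (minus (P (h b u')) (P (h a u')))) <= (b - a) * (K * (e1 * (K * l)))).
{ intros u' Hu'.
  assert (I : is_Int (fun s => circ c0 c1 u' *: G (h s u')) a b (minus (P (h b u')) (P (h a u')))).
  { apply (is_Int_rdiff CV (fun s => P (h s u'))); [lra| |].
    - intros x Hx; apply (rdiff_chain P (fun s => h s u')); [apply HP|apply rdiff_h_s].
    - intros x Hx; apply rcont_scal; [apply (rcont_const (V := C_NormedModule))|].
      apply (rcont_cdiffable G (fun s => h s u')); [|eapply rdiff_rcont, rdiff_h_s].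
      apply cdiffable_plus; [apply cdiffable_const|].
      apply (cdiffable_scal (fun z => z - z0)%C); [|apply cdiffable_const].
      apply (cdiffable_plus (V := C_NormedModule)); [apply cdiffable_id|].
      apply (cdiffable_const (V := C_NormedModule)). }
  apply (norm_is_Int_le _ a b _ _ ltac:(lra)) with (2 := is_Int_minus _ _ _ _ _ _ (is_Int_ray u' a b ltac:(lra) ltac:(lra) ltac:(lra) ltac:(lra)) I).
  intros x Hx; unfold ray_form; fold (h x u').
  norm_rewrite V (circ c0 c1 u' *: minus (F (h x u')) (G (h x u'))).
  rewrite norm_Cscal_eq; apply Rmult_le_compat; [apply Cmod_ge_0|apply norm_ge_0| |].
  - apply Cmod_circ_le_K; lra.
  - apply HE; assumption. }
assert (Harc : forall s', a <= s' <= b ->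
  norm (minus (CInt (arc_form s') c d) (minus (P (h s' d)) (P (h s' c)))) <= (d - c) * (K * (e1 * (K * l)))).
{ intros s' Hs'.
  assert (I : is_Int (fun u => (RtoC s' * dcirc c1 u)%C *: G (h s' u)) c d (minus (P (h s' d)) (P (h s' c)))).
  { apply (is_Int_rdiff CV (fun u => P (h s' u))); [lra| |].
    - intros x Hx; apply (rdiff_chain P (fun u => h s' u)); [apply HP|apply rdiff_h_u].
    - intros x Hx; apply rcont_scal.
      { apply (rcont_scal (V := C_NormedModule) (fun _ => RtoC s') (dcirc c1));
          [apply (rcont_const (V := C_NormedModule))|apply rcont_dcirc]. }
      apply (rcont_cdiffable G (fun u => h s' u)); [|eapply rdiff_rcont, rdiff_h_u].
      apply cdiffable_plus; [apply cdiffable_const|].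
      apply (cdiffable_scal (fun z => z - z0)%C); [|apply cdiffable_const].
      apply (cdiffable_plus (V := C_NormedModule)); [apply cdiffable_id|].
      apply (cdiffable_const (V := C_NormedModule)). }
  apply (norm_is_Int_le _ c d _ _ ltac:(lra)) with (2 := is_Int_minus _ _ _ _ _ _ (is_Int_arc s' c d ltac:(lra) ltac:(lra) ltac:(lra) ltac:(lra)) I).
  intros x Hx; unfold arc_form; fold (h s' x).
  norm_rewrite V ((RtoC s' * dcirc c1 x)%C *: minus (F (h s' x)) (G (h s' x))).
  rewrite norm_Cscal_eq; apply Rmult_le_compat; [apply Cmod_ge_0|apply norm_ge_0| |].
  - apply Cmod_dcirc_le_K; lra.
  - apply HE; assumption. }
(* The values of the primitive [P] at the four corners cancel around the boundary. *)
assert (E : circulation a b c d =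
  minus (plus (minus (CInt (ray_form c) a b) (minus (P (h b c)) (P (h a c))))
              (minus (CInt (arc_form b) c d) (minus (P (h b d)) (P (h b c)))))
        (plus (minus (CInt (ray_form d) a b) (minus (P (h b d)) (P (h a d))))
              (minus (CInt (arc_form a) c d) (minus (P (h a d)) (P (h a c)))))).
{ unfold circulation.
  generalize (P (h b c)) (P (h a c)) (P (h b d)) (P (h a d)); intros; module V. }
rewrite E; unfold minus at 1.
eapply Rle_trans; [apply norm_triangle|]; rewrite norm_opp.
eapply Rle_trans; [apply Rplus_le_compat; apply norm_triangle|].
assert (R1 := Hray c ltac:(lra)); assert (R2 := Hray d ltac:(lra)).
assert (A1 := Harc a ltac:(lra)); assert (A2 := Harc b ltac:(lra)).
apply Rle_trans with (2 * (l * (K * (e1 * (K * l))))); [unfold l at 1; lra|].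
right; unfold e1; field; lra.
Qed.

(** Goursat's argument in the parameter rectangle: a circulation above eta survives repeated
    quartering as more than eta/4^n on rectangles shrinking to a point, where [circulation_local]
    contradicts it. *)
Lemma circulation_zero : a0 <= b0 -> u0 <= u1 -> circulation a0 b0 u0 u1 = zero.
Proof.
intros Hab Hu.
set (p := b0 - a0); set (q := u1 - u0).
assert (Hp : 0 <= p) by (unfold p; lra).
assert (Hq : 0 <= q) by (unfold q; lra).
assert (Hw : forall n, 0 < (/ 2) ^ n) by (intros n; apply pow_lt; lra).
apply eq_of_norm_minus_small; intros eta Heta.
replace (minus (circulation a0 b0 u0 u1) (zero : V)) with (circulation a0 b0 u0 u1) by module V.
apply Rnot_lt_le; intros Hbig.
(* The size of a rectangle is fixed by n, so only its lower left corner is recorded. *)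
set (bad := fun (n : nat) (x : R * R) =>
  a0 <= fst x /\ fst x + p * (/ 2) ^ n <= b0 /\ u0 <= snd x /\ snd x + q * (/ 2) ^ n <= u1 /\
  eta * (/ 2) ^ n * (/ 2) ^ n <
    norm (circulation (fst x) (fst x + p * (/ 2) ^ n) (snd x) (snd x + q * (/ 2) ^ n))).
assert (Hstep : forall n x, bad n x -> exists y, bad (S n) y /\
  (fst x <= fst y <= fst x + p * (/ 2) ^ S n) /\ (snd x <= snd y <= snd x + q * (/ 2) ^ S n)).
{ intros n [a c] (B1 & B2 & B3 & B4 & B5); cbn [fst snd] in *.
  set (p' := p * (/ 2) ^ S n); set (q' := q * (/ 2) ^ S n).
  assert (Hp' : 0 <= p') by (unfold p'; apply Rmult_le_pos; [lra|apply Rlt_le, Hw]).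
  assert (Hq' : 0 <= q') by (unfold q'; apply Rmult_le_pos; [lra|apply Rlt_le, Hw]).
  assert (Ep : p * (/ 2) ^ n = p' + p') by (unfold p'; cbn [pow]; field).
  assert (Eq : q * (/ 2) ^ n = q' + q') by (unfold q'; cbn [pow]; field).
  rewrite Ep in B2, B5; rewrite Eq in B4, B5; rewrite <- (Rplus_assoc a p' p') in B2, B5; rewrite <- (Rplus_assoc c q' q') in B4, B5.
  rewrite (circulation_split_s a (a + p')) in B5 by lra.
  rewrite (circulation_split_u a (a + p') c (c + q')) in B5 by lra.
  rewrite (circulation_split_u (a + p') (a + p' + p') c (c + q')) in B5 by lra.
  set (t := eta * (/ 2) ^ S n * (/ 2) ^ S n).
  assert (Et : eta * (/ 2) ^ n * (/ 2) ^ n = t + t + t + t) by (unfold t; cbn [pow]; field).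
  rewrite Et in B5.
  pose proof (norm_triangle (plus (circulation a (a + p') c (c + q')) (circulation a (a + p') (c + q') (c + q' + q')))
    (plus (circulation (a + p') (a + p' + p') c (c + q')) (circulation (a + p') (a + p' + p') (c + q') (c + q' + q')))) as T1.
  pose proof (norm_triangle (circulation a (a + p') c (c + q')) (circulation a (a + p') (c + q') (c + q' + q'))) as T2.
  pose proof (norm_triangle (circulation (a + p') (a + p' + p') c (c + q')) (circulation (a + p') (a + p' + p') (c + q') (c + q' + q'))) as T3.
  destruct (Rlt_le_dec t (norm (circulation a (a + p') c (c + q')))) as [G1|G1].
  { exists (a, c); unfold bad; cbn [fst snd]; fold p' q' t; repeat split; lra. }
  destruct (Rlt_le_dec t (norm (circulation a (a + p') (c + q') (c + q' + q')))) as [G2|G2].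
  { exists (a, c + q'); unfold bad; cbn [fst snd]; fold p' q' t; repeat split; lra. }
  destruct (Rlt_le_dec t (norm (circulation (a + p') (a + p' + p') c (c + q')))) as [G3|G3].
  { exists (a + p', c); unfold bad; cbn [fst snd]; fold p' q' t; repeat split; lra. }
  exists (a + p', c + q'); unfold bad; cbn [fst snd]; fold p' q' t; repeat split; lra. }
assert (H0 : bad 0%nat (a0, u0)).
{ unfold bad; cbn [fst snd pow]; rewrite !Rmult_1_r.
  replace (a0 + p) with b0 by (unfold p; ring); replace (u0 + q) with u1 by (unfold q; ring).
  repeat split; lra. }
set (next := fun n (x : {x | bad n x}) =>
  let s := constructive_indefinite_description _ (Hstep n (proj1_sig x) (proj2_sig x)) in
  exist (bad (S n)) (proj1_sig s) (proj1 (proj2_sig s))).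
set (sq := fix sq (n : nat) : {x | bad n x} :=
  match n with O => exist _ _ H0 | S n => next n (sq n) end).
set (x := fun n => proj1_sig (sq n)).
assert (Hx : forall n, bad n (x n)) by (intros n; exact (proj2_sig (sq n))).
assert (Hxs : forall n, (fst (x n) <= fst (x (S n)) <= fst (x n) + p * (/ 2) ^ S n) /\
                        (snd (x n) <= snd (x (S n)) <= snd (x n) + q * (/ 2) ^ S n)).
{ intros n; unfold x; cbn [sq]; unfold next; cbn [proj1_sig].
  exact (proj2 (proj2_sig (constructive_indefinite_description _ (Hstep n (proj1_sig (sq n)) (proj2_sig (sq n)))))). }
destruct (nested_point (fun n => fst (x n)) p Hp (fun n => proj1 (Hxs n))) as [s Hs].
destruct (nested_point (fun n => snd (x n)) q Hq (fun n => proj2 (Hxs n))) as [u Hu'].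
(* The sides of the n-th rectangle add up to (p+q)/2^n, so the local bound is e (p+q)^2/4^n, at most
   eta/4^n; the 1 covers a degenerate rectangle. *)
set (e := eta / ((p + q) ^ 2 + 1)).
assert (Hden : 0 < (p + q) ^ 2 + 1) by (pose proof (pow2_ge_0 (p + q)); lra).
assert (He : 0 < e) by (apply Rdiv_lt_0_compat; assumption).
assert (Bs : a0 <= s <= b0).
{ pose proof (Hs 0%nat) as H1; destruct (Hx 0%nat) as (B1 & B2 & _); lra. }
assert (Bu : u0 <= u <= u1).
{ pose proof (Hu' 0%nat) as H1; destruct (Hx 0%nat) as (_ & _ & B3 & B4 & _); lra. }
destruct (circulation_local s u Bs Bu e He) as [dl [Hdl Hloc]].
assert (Hd2 : 0 < dl / (p + q + 1)) by (apply Rdiv_lt_0_compat; lra).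
destruct (pow_lt_1_zero (/ 2) ltac:(rewrite Rabs_pos_eq; lra) _ Hd2) as [n Hn].
specialize (Hn n (Nat.le_refl n)); rewrite Rabs_pos_eq in Hn by (apply Rlt_le, Hw).
destruct (Hx n) as (B1 & B2 & B3 & B4 & B5).
pose proof (Hs n) as Hsn; pose proof (Hu' n) as Hun; cbv beta in Hsn, Hun.
set (w := (/ 2) ^ n) in *; assert (Hwn : 0 < w) by apply Hw.
assert (Hsz : (fst (x n) + p * w - fst (x n)) + (snd (x n) + q * w - snd (x n)) = (p + q) * w) by ring.
assert (Hlt : (p + q) * w < dl).
{ apply Rle_lt_trans with ((p + q + 1) * w); [nra|].
  replace dl with ((p + q + 1) * (dl / (p + q + 1))) by (field; lra).
  apply Rmult_lt_compat_l; lra. }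
specialize (Hloc (fst (x n)) (fst (x n) + p * w) (snd (x n)) (snd (x n) + q * w)).
rewrite Hsz in Hloc.
assert (Hfin := Hloc ltac:(lra) ltac:(lra) ltac:(lra) ltac:(lra) Hlt).
apply (Rlt_irrefl (eta * w * w)).
eapply Rlt_le_trans; [exact B5|]; eapply Rle_trans; [exact Hfin|].
replace (e * ((p + q) * w) ^ 2) with (e * (p + q) ^ 2 * (w * w)) by ring.
rewrite (Rmult_assoc eta w w); apply Rmult_le_compat_r; [nra|].
apply Rle_trans with (e * ((p + q) ^ 2 + 1)); [nra|].
right; unfold e; field; lra.
Qed.

Theorem cauchy_scaled : a0 <= b0 -> u0 <= u1 ->
  plus (CInt (ray_form u0) a0 b0) (CInt (arc_form b0) u0 u1) =
  plus (CInt (ray_form u1) a0 b0) (CInt (arc_form a0) u0 u1).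
Proof.
intros H1 H2; pose proof (circulation_zero H1 H2) as H; unfold circulation in H.
set (v := plus (CInt (ray_form u0) a0 b0) (CInt (arc_form b0) u0 u1)) in *.
set (w := plus (CInt (ray_form u1) a0 b0) (CInt (arc_form a0) u0 u1)) in *.
apply eq_of_norm_minus_small; intros e He; rewrite H, norm_0; lra.
Qed.

End Goursat.

Lemma is_derive_Rpower (y t : R) : 0 < t ->
  is_derive (fun x => Rpower x y) t (y * Rpower t (y - 1)).
Proof. intros Ht; apply is_derive_Reals, derivable_pt_lim_power; exact Ht. Qed.

Lemma continuous_Rpower (y t : R) : 0 < t -> continuous (fun x => Rpower x y) t.
Proof. intros Ht; apply (ex_derive_continuous (V := R_NormedModule)); eexists; now apply is_derive_Rpower. Qed.

Lemma Rpower_small (p : R) : 0 < p -> forall e, 0 < e ->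
  exists d, 0 < d /\ forall t, 0 < t < d -> Rpower t p < e.
Proof.
intros Hp e He; exists (Rpower e (/ p)); split; [apply exp_pos|]; intros t Ht.
replace e with (Rpower (Rpower e (/ p)) p).
- apply Rlt_Rpower_l; assumption.
- rewrite Rpower_mult, Rinv_l by lra; now apply Rpower_1.
Qed.

Lemma Rpower_neg_small (p : R) : 0 < p -> forall e, 0 < e ->
  exists M, 0 < M /\ forall t, M < t -> Rpower t (- p) < e.
Proof.
intros Hp e He; destruct (Rpower_small p Hp e He) as [d [Hd H]].
exists (/ d); split; [now apply Rinv_0_lt_compat|]; intros t Ht.
assert (Hd' : 0 < / d) by now apply Rinv_0_lt_compat.
assert (Ht0 : 0 < t) by lra.
assert (Ht' : 0 < / t) by now apply Rinv_0_lt_compat.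
replace (Rpower t (- p)) with (Rpower (/ t) p).
- apply H; split; [assumption|].
  rewrite <- (Rinv_inv d); apply Rinv_lt_contravar; [nra|assumption].
- rewrite Rpower_Ropp; unfold Rpower; rewrite ln_Rinv by assumption.
  rewrite <- exp_Ropp; f_equal; ring.
Qed.

(** * Improper integrals *)

Section Improper.

Context {V : NormedModule C_AbsRing}.
Hypothesis CV : norm_complete V.

Lemma ex_Int_pos (f : R -> V) a b : 0 < a -> 0 < b ->
  (forall t, 0 < t -> rcont f t) -> is_Int f a b (CInt f a b).
Proof.
intros Ha Hb Hf; unfold CInt; apply epsilon_spec.
destruct (ex_RInt_continuous (V := real_complete_module V CV) f a b) as [l Hl].
{ intros z Hz; apply (rcont_continuous (V := V)), Hf.
  apply Rlt_le_trans with (Rmin a b); [now apply Rmin_glb_lt|apply Hz]. }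
now exists l.
Qed.

(** Comparison test: [G] is a primitive of the majorant and converges along [Fl], so the integrals
    from b are Cauchy. The ends 0 and infinity are treated at once, hence [Rmin] and [Rmax]. *)
Lemma is_RInt_gen_majorized (Fl : (R -> Prop) -> Prop) (PF : ProperFilter Fl)
    (f : R -> V) (g G : R -> R) (b l : R) :
  0 < b -> Fl (fun t => 0 < t) ->
  (forall t, 0 < t -> rcont f t) ->
  (forall t, 0 < t -> is_derive G t (g t)) -> (forall t, 0 < t -> continuous g t) ->
  Fl (fun t => forall x, Rmin b t <= x <= Rmax b t -> norm (f x) <= g x) ->
  (forall e, 0 < e -> Fl (fun t => Rabs (G t - l) < e)) ->
  exists I, is_RInt_gen (V := real_module V) f (at_point b) Fl I.
Proof.
intros Hb Hpos Hf HG Hg Hfg Hl.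
assert (Hgi : forall x y, 0 < x -> 0 < y -> is_RInt g x y (G y - G x)).
{ intros x y Hx Hy; apply (is_RInt_derive (V := R_CompleteNormedModule)).
  - intros z Hz; apply HG, Rlt_le_trans with (Rmin x y); [now apply Rmin_glb_lt|apply Hz].
  - intros z Hz; apply Hg, Rlt_le_trans with (Rmin x y); [now apply Rmin_glb_lt|apply Hz]. }
set (ok := fun t => 0 < t /\ forall x, Rmin b t <= x <= Rmax b t -> norm (f x) <= g x).
assert (Hok : Fl ok) by (apply filter_and; assumption).
assert (Hdiff : forall x y, ok x -> ok y -> norm (minus (CInt f b y) (CInt f b x)) <= Rabs (G y - G x)).
{ assert (Hle : forall x y, ok x -> ok y -> x <= y ->
    norm (minus (CInt f b y) (CInt f b x)) <= Rabs (G y - G x)).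
  { intros x y [Hx Bx] [Hy By] Hxy.
    assert (I := ex_Int_pos f x y Hx Hy Hf).
    replace (minus (CInt f b y) (CInt f b x)) with (CInt f x y).
    2: { rewrite (Int_eq f b y (plus (CInt f b x) (CInt f x y))).
         - module V.
         - apply is_Int_Chasles with x; apply ex_Int_pos; assumption. }
    eapply Rle_trans; [|apply Rle_abs].
    apply (norm_is_Int_le_fun f g x y _ _ Hxy); [|exact I|now apply Hgi].
    (* A point between x and y lies between b and x if it is below b, and between b and y otherwise,
       so one of the two majorizations applies. *)
    intros z Hz; destruct (Rle_lt_dec z b) as [Hzb|Hzb].
    - apply Bx; split; [eapply Rle_trans; [apply Rmin_r|lra]|eapply Rle_trans; [exact Hzb|apply Rmax_l]].
    - apply By; split; [eapply Rle_trans; [apply Rmin_l|lra]|eapply Rle_trans; [apply Hz|apply Rmax_r]]. }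
  intros x y Hx Hy; destruct (Rle_lt_dec x y) as [H|H]; [now apply Hle|].
  rewrite norm_minus_sym, Rabs_minus_sym; apply Hle; auto; lra. }
destruct (filter_norm_cauchy CV Fl PF (fun t => CInt f b t)) as [I HI].
{ intros e He.
  assert (H2 := filter_and (F := Fl) _ _ Hok (Hl (e / 2) ltac:(lra))).
  destruct (filter_ex (F := Fl) _ H2) as [x [Hx Hx2]].
  exists (CInt f b x); eapply filter_imp; [|exact H2]; intros y [Hy Hy2].
  eapply Rle_lt_trans; [now apply Hdiff|].
  replace (G y - G x) with ((G y - l) - (G x - l)) by ring.
  eapply Rle_lt_trans; [apply Rabs_triang|]; rewrite Rabs_Ropp; lra. }
exists I; unfold is_RInt_gen.
apply filterlimi_locally; intros e.
apply (Filter_prod _ _ _ (fun x => x = b) (fun t => 0 < t /\ norm (minus (CInt f b t) I) < e)).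
- reflexivity.
- apply filter_and; [assumption|apply HI, cond_pos].
- intros x y -> [Hy HyI]; exists (CInt f b y); split.
  + apply ex_Int_pos; assumption.
  + apply (norm_compat1 (V := V)); exact HyI.
Qed.

Lemma is_RInt_gen_infty (f : R -> V) (b c p : R) : 0 < b -> 0 < p ->
  (forall t, 0 < t -> rcont f t) -> (forall t, b <= t -> norm (f t) <= c * Rpower t (- p - 1)) ->
  exists I, is_RInt_gen (V := real_module V) f (at_point b) (Rbar_locally p_infty) I.
Proof.
intros Hb Hp Hf Hc.
apply (is_RInt_gen_majorized _ _ f (fun t => c * Rpower t (- p - 1)) (fun t => (- c / p) * Rpower t (- p)) b 0 Hb).
- exists 0; auto.
- exact Hf.
- intros t Ht; evar_last.
  + apply (is_derive_scal (fun t => Rpower t (- p)) t (- c / p)), is_derive_Rpower, Ht.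
  + simpl; field; lra.
- intros t Ht; apply (continuous_scal_r (K := R_AbsRing) (V := R_NormedModule) c (fun t => Rpower t (- p - 1))), continuous_Rpower, Ht.
- exists b; intros t Ht x Hx; rewrite Rmin_left in Hx by lra; apply Hc; lra.
- intros e He.
  assert (Hq : 0 < e / (Rabs (- c / p) + 1)) by (apply Rdiv_lt_0_compat; [lra|pose proof (Rabs_pos (- c / p)); lra]).
  destruct (Rpower_neg_small p Hp _ Hq) as [M [HM H]]; exists M; intros t Ht.
  rewrite Rminus_0_r, Rabs_mult, (Rabs_pos_eq (Rpower t (- p))) by (apply Rlt_le, exp_pos).
  specialize (H t Ht); pose proof (Rabs_pos (- c / p)) as Hr.
  assert (E : e / (Rabs (- c / p) + 1) * (Rabs (- c / p) + 1) = e) by (field; lra).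
  assert (0 < Rpower t (- p)) by apply exp_pos; nra.
Qed.

Lemma is_RInt_gen_zero (f : R -> V) (b c p : R) : 0 < b -> 0 < p ->
  (forall t, 0 < t -> rcont f t) -> (forall t, 0 < t <= b -> norm (f t) <= c * Rpower t (p - 1)) ->
  exists I, is_RInt_gen (V := real_module V) f (at_point b) (at_right 0) I.
Proof.
intros Hb Hp Hf Hc.
apply (is_RInt_gen_majorized _ _ f (fun t => c * Rpower t (p - 1)) (fun t => (c / p) * Rpower t p) b 0 Hb).
- exists (mkposreal 1 Rlt_0_1); auto.
- exact Hf.
- intros t Ht; evar_last.
  + apply (is_derive_scal (fun t => Rpower t p) t (c / p)), is_derive_Rpower, Ht.
  + simpl; field; lra.
- intros t Ht; apply (continuous_scal_r (K := R_AbsRing) (V := R_NormedModule) c (fun t => Rpower t (p - 1))), continuous_Rpower, Ht.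
- exists (mkposreal b Hb); intros t Ht Ht0 x Hx.
  assert (Htb : t < b).
  { change (Rabs (t - 0) < b) in Ht; rewrite Rminus_0_r, Rabs_pos_eq in Ht; lra. }
  rewrite Rmin_right, Rmax_left in Hx by lra; apply Hc; lra.
- intros e He.
  assert (Hq : 0 < e / (Rabs (c / p) + 1)) by (apply Rdiv_lt_0_compat; [lra|pose proof (Rabs_pos (c / p)); lra]).
  destruct (Rpower_small p Hp _ Hq) as [d [Hd H]]; exists (mkposreal d Hd); intros t Ht Ht0.
  assert (Htb : t < d).
  { change (Rabs (t - 0) < d) in Ht; rewrite Rminus_0_r, Rabs_pos_eq in Ht; lra. }
  rewrite Rminus_0_r, Rabs_mult, (Rabs_pos_eq (Rpower t p)) by (apply Rlt_le, exp_pos).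
  specialize (H t (conj Ht0 Htb)); pose proof (Rabs_pos (c / p)) as Hr.
  assert (E : e / (Rabs (c / p) + 1) * (Rabs (c / p) + 1) = e) by (field; lra).
  assert (0 < Rpower t p) by apply exp_pos; nra.
Qed.

(** Functions on a Stolz domain live on a bounded piece of a ray only; composing with [Rmin t b]
    extends them continuously by a constant. *)
Lemma is_RInt_gen_zero_local (f : R -> V) (b c p : R) : 0 < b -> 0 < p ->
  (forall t, 0 < t <= b -> rcont f t) -> (forall t, 0 < t <= b -> norm (f t) <= c * Rpower t (p - 1)) ->
  exists I, is_RInt_gen (V := real_module V) f (at_point b) (at_right 0) I.
Proof.
intros Hb Hp Hf Hc.
destruct (is_RInt_gen_zero (fun t => f (Rmin t b)) b c p Hb Hp) as [I HI].
- intros t Ht e He.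
  destruct (Hf (Rmin t b) (conj (Rmin_glb_lt _ _ _ Ht Hb) (Rmin_r _ _)) e He) as [d [Hd H]].
  exists d; split; [assumption|]; intros y Hy; apply H.
  eapply Rle_lt_trans; [|exact Hy]; unfold Rmin.
  destruct (Rle_dec y b), (Rle_dec t b); unfold Rabs;
    repeat match goal with |- context [Rcase_abs ?x] => destruct (Rcase_abs x) end; lra.
- intros t Ht; rewrite Rmin_left by lra; now apply Hc.
- exists I; revert HI; apply is_RInt_gen_ext.
  apply (Filter_prod _ _ _ (fun x => x = b) (fun t => 0 < t < b)).
  + reflexivity.
  + exists (mkposreal b Hb); intros t Ht Ht0.
    change (Rabs (t - 0) < b) in Ht; rewrite Rminus_0_r, Rabs_pos_eq in Ht; lra.
  + intros x y -> Hy z Hz; simpl in Hz; rewrite Rmin_right, Rmax_left in Hz by lra.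
    rewrite (Rmin_left z b) by lra; reflexivity.
Qed.

Lemma is_RInt_gen_eq (Fa Fb : (R -> Prop) -> Prop) (PFa : ProperFilter' Fa) (PFb : ProperFilter' Fb)
    (f : R -> V) (l l' : V) :
  is_RInt_gen (V := real_module V) f Fa Fb l -> is_RInt_gen (V := real_module V) f Fa Fb l' -> l = l'.
Proof.
intros H H'.
rewrite <- (is_RInt_gen_unique (V := real_complete_module V CV) f l H).
apply (is_RInt_gen_unique (V := real_complete_module V CV) f l' H').
Qed.

End Improper.

Lemma is_RInt_gen_sector_limit {V : NormedModule C_AbsRing} (f : R -> V) (l : V) :
  is_RInt_gen (V := real_module V) f (at_right 0) (Rbar_locally p_infty) l ->
  forall e, 0 < e -> exists d M, 0 < d /\ forall t S, 0 < t < d -> M < S ->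
    norm (minus (CInt f t S) l) < e.
Proof.
intros H e He.
destruct (ball_norm_minus l (mkposreal e He)) as [d Hd].
destruct (proj1 (filterlimi_locally _ _) H d) as [P Q HP HQ HPQ].
destruct HP as [d' Hd']; destruct HQ as [M HM].
exists d', M; split; [apply cond_pos|]; intros t S Ht HS.
destruct (HPQ t S) as [z [Hz1 Hz2]].
- apply Hd'; [|lra]; change (Rabs (t - 0) < d'); rewrite Rminus_0_r, Rabs_pos_eq; lra.
- apply HM, HS.
- rewrite (Int_eq f t S z Hz1); apply Hd; exact Hz2.
Qed.

Lemma is_RInt_gen_point_limit {V : NormedModule C_AbsRing} (Fl : (R -> Prop) -> Prop) (PF : ProperFilter Fl)
    (f : R -> V) (b : R) (l : V) :
  is_RInt_gen (V := real_module V) f (at_point b) Fl l ->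
  forall e, 0 < e -> Fl (fun t => norm (minus (CInt f b t) l) < e).
Proof.
intros H e He.
destruct (ball_norm_minus l (mkposreal e He)) as [d Hd].
destruct (proj1 (filterlimi_locally _ _) H d) as [P Q HP HQ HPQ].
eapply filter_imp; [|exact HQ]; intros t Ht.
destruct (HPQ b t HP Ht) as [z [Hz1 Hz2]].
rewrite (Int_eq f b t z Hz1); apply Hd; exact Hz2.
Qed.

(** Cauchy's theorem between the scales b and S, then S to infinity: the outer arc has length O(S)
    against a bound O(S^(-p-1)). Differentiability on the two end rays is asked for all s > 0
    because [is_RInt_gen_infty] works with continuity there. *)
Lemma arc_eq_rays {V : NormedModule C_AbsRing} (CV : norm_complete V) (F : C -> V) (c0 c1 : C)
    (b c p u0 u1 : R) :
  0 < b -> 0 < p -> 0 <= c -> u0 <= u1 ->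
  (forall s u, 0 < s -> u = u0 \/ u = u1 -> cdiffable F (RtoC s * circ c0 c1 u)%C) ->
  (forall s u, b <= s -> u0 <= u <= u1 -> cdiffable F (RtoC s * circ c0 c1 u)%C) ->
  (forall s u, b <= s -> u0 <= u <= u1 -> norm (F (RtoC s * circ c0 c1 u)%C) <= c * Rpower s (- p - 1)) ->
  exists l0 l1,
    is_RInt_gen (V := real_module V) (ray_form V F c0 c1 u0) (at_point b) (Rbar_locally p_infty) l0 /\
    is_RInt_gen (V := real_module V) (ray_form V F c0 c1 u1) (at_point b) (Rbar_locally p_infty) l1 /\
    CInt (arc_form V F c0 c1 b) u0 u1 = minus l0 l1.
Proof.
intros Hb Hp Hc Hu Hd0 Hd Hn.
assert (Hex : forall u, u = u0 \/ u = u1 -> exists l,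
  is_RInt_gen (V := real_module V) (ray_form V F c0 c1 u) (at_point b) (Rbar_locally p_infty) l).
{ intros u Hu'; apply (is_RInt_gen_infty CV _ b (Cmod (circ c0 c1 u) * c) p Hb Hp).
  - intros t Ht; apply rcont_ray_form; now apply Hd0.
  - intros t Ht; unfold ray_form; rewrite norm_Cscal_eq, Rmult_assoc.
    apply Rmult_le_compat_l; [apply Cmod_ge_0|]; apply Hn; [assumption|destruct Hu'; lra]. }
destruct (Hex u0 ltac:(auto)) as [l0 H0]; destruct (Hex u1 ltac:(auto)) as [l1 H1].
exists l0, l1; split; [exact H0|split; [exact H1|]].
apply eq_of_norm_minus_small; intros e He.
assert (G0 := is_RInt_gen_point_limit _ _ _ _ _ H0 (e / 3) ltac:(lra)).
assert (G1 := is_RInt_gen_point_limit _ _ _ _ _ H1 (e / 3) ltac:(lra)).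
destruct G0 as [M0 G0]; destruct G1 as [M1 G1].
set (m := Cmod c1 * c * (u1 - u0)).
assert (Hm : 0 <= m) by (unfold m; pose proof (Cmod_ge_0 c1); repeat apply Rmult_le_pos; lra).
assert (Hq : 0 < e / 3 / (m + 1)) by (apply Rdiv_lt_0_compat; lra).
destruct (Rpower_neg_small p Hp _ Hq) as [M2 [HM2 G2]].
set (S := Rmax (Rmax M0 M1) (Rmax M2 b) + 1).
assert (HS : M0 < S /\ M1 < S /\ M2 < S /\ b < S).
{ unfold S; pose proof (Rmax_l (Rmax M0 M1) (Rmax M2 b)); pose proof (Rmax_r (Rmax M0 M1) (Rmax M2 b)).
  pose proof (Rmax_l M0 M1); pose proof (Rmax_r M0 M1); pose proof (Rmax_l M2 b); pose proof (Rmax_r M2 b).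
  repeat split; lra. }
destruct HS as (HS0 & HS1 & HS2 & HSb).
specialize (G0 S HS0); specialize (G1 S HS1); specialize (G2 S HS2).
assert (Hcd : forall s u, b <= s <= S -> u0 <= u <= u1 -> cdiffable F (RtoC s * circ c0 c1 u)%C).
{ intros s u Hs Hu'; apply Hd; lra. }
assert (E := cauchy_scaled V CV F c0 c1 b S u0 u1 (Rlt_le _ _ Hb) Hcd ltac:(lra) Hu).
assert (HA : norm (CInt (arc_form V F c0 c1 S) u0 u1) <= e / 3).
{ eapply Rle_trans.
  - apply (norm_is_Int_le (arc_form V F c0 c1 S) u0 u1 _ (Cmod c1 * c * Rpower S (- p)) Hu).
    2: { apply (is_Int_arc V CV F c0 c1 b S u0 u1 Hcd); lra. }
    intros x Hx; unfold arc_form; rewrite norm_Cscal_eq, Cmod_mult, Cmod_R, Rabs_pos_eq, Cmod_dcirc by lra.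
    replace (Rpower S (- p)) with (S * Rpower S (- p - 1)).
    2: { rewrite <- (Rpower_1 S) at 1 by lra; rewrite <- Rpower_plus; f_equal; ring. }
    assert (H := Hn S x ltac:(lra) Hx); pose proof (Cmod_ge_0 c1).
    apply Rle_trans with (S * Cmod c1 * (c * Rpower S (- p - 1))); [|right; ring].
    apply Rmult_le_compat_l; [apply Rmult_le_pos; lra|exact H].
  - assert (Eq : e / 3 / (m + 1) * (m + 1) = e / 3) by (field; lra).
    assert (Hrp : 0 < Rpower S (- p)) by apply exp_pos.
    apply Rle_trans with (m * Rpower S (- p)); [right; unfold m; ring|]; nra. }
assert (E' : minus (CInt (arc_form V F c0 c1 b) u0 u1) (minus l0 l1) =
  plus (plus (minus (CInt (ray_form V F c0 c1 u0) b S) l0) (CInt (arc_form V F c0 c1 S) u0 u1))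
       (opp (minus (CInt (ray_form V F c0 c1 u1) b S) l1))).
{ replace (CInt (arc_form V F c0 c1 b) u0 u1) with
    (minus (plus (CInt (ray_form V F c0 c1 u1) b S) (CInt (arc_form V F c0 c1 b) u0 u1)) (CInt (ray_form V F c0 c1 u1) b S)) by module V.
  rewrite <- E; module V. }
rewrite E'.
eapply Rle_trans; [apply norm_triangle|]; rewrite norm_opp.
eapply Rle_trans; [apply Rplus_le_compat_r, norm_triangle|]; lra.
Qed.

Lemma Cmod_lower (z w : C) : Cmod z - Cmod w <= Cmod (z - w)%C.
Proof.
replace z with ((z - w) + w)%C at 1 by ring; pose proof (Cmod_triangle (z - w)%C w); lra.
Qed.

Lemma cis_neg_period (u : R) : cis (2 * PI - u) = cis (- u).
Proof.
unfold cis; f_equal.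
- rewrite cos_minus, cos_2PI, sin_2PI, cos_neg; ring.
- rewrite sin_minus, cos_2PI, sin_2PI, sin_neg; ring.
Qed.

Lemma circ_unit (u : R) : circ (RtoC 0) (RtoC 1) u = cis u.
Proof. unfold circ; ring. Qed.

Lemma Cmod_scal_cis (s u : R) : 0 <= s -> Cmod (RtoC s * cis u)%C = s.
Proof. intros H; rewrite Cmod_mult, Cmod_R, Cmod_cis, Rabs_pos_eq by assumption; ring. Qed.

Lemma Re_scal_cis (s u : R) : Re (RtoC s * cis u)%C = s * cos u.
Proof. unfold Re; simpl; ring. Qed.

Lemma Csub_neq_0 (z w : C) : z <> w -> (z - w)%C <> RtoC 0.
Proof. intros H E; apply H; replace z with ((z - w) + w)%C by ring; rewrite E; ring. Qed.

Lemma RtoC_m1 : RtoC (-1) = (- (1))%C.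
Proof. unfold Copp, RtoC; simpl; f_equal; ring. Qed.

(** * Functional calculus of the kernel *)

(* The Cauchy kernel 1/(z-w), made to vanish at z = 0 without losing its decay at infinity. *)
Definition kern (w z : C) : C := (/ (z - w) + / w * / (z + 1))%C.

Section SectorIntegral.

Variable B : banach_algebra.
Variable a : B.
Variable r : C -> B.
Hypothesis Hr : forall z s, ba_resolvent z a s -> ba_resolvent z a (r z).
Variables nu M : R.
Hypothesis Hnu : 0 < nu < PI / 2.
Hypothesis Hres : forall z, z <> RtoC 0 -> Re z <= cos nu * Cmod z ->
  ba_resolvent z a (r z) /\ Cmod z * norm (r z) <= M.

Variable w : C.
Hypothesis Hw : Re w < cos nu * Cmod w.

(** The value of [kern w] at [a]: since [r z] inverts z - a, the function 1/(z-w) becomes the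
    opposite of [r w], and 1/(z+1) the opposite of the resolvent at -1. *)
Definition kern_op : B := opp (plus (r w) ((/ w)%C *: r (RtoC (-1)))).

Let b1 : B := opp (r w).
Let b2 : B := opp (r (RtoC (-1))).

Lemma cos_nu_pos : 0 < cos nu.
Proof. apply cos_gt_0; lra. Qed.

Lemma w_neq_0 : w <> RtoC 0.
Proof.
intros E; pose proof Hw as H; rewrite E, Cmod_0 in H; unfold Re in H; simpl in H; lra.
Qed.

Lemma m1_neq_0 : RtoC (-1) <> RtoC 0.
Proof. intros H; apply RtoC_inj in H; lra. Qed.

Lemma res_w : ba_resolvent w a (r w).
Proof. apply Hres; [apply w_neq_0|lra]. Qed.

Lemma res_m1 : ba_resolvent (RtoC (-1)) a (r (RtoC (-1))).
Proof.
apply Hres; [apply m1_neq_0|].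
rewrite Cmod_R, Rabs_left by lra; pose proof cos_nu_pos; unfold Re; simpl; lra.
Qed.

Lemma M_nonneg : 0 <= M.
Proof.
destruct (Hres w w_neq_0 ltac:(lra)) as [_ H].
eapply Rle_trans; [|exact H]; apply Rmult_le_pos; [apply Cmod_ge_0|apply norm_ge_0].
Qed.

(** [q] is rational with poles [w] and -1 outside the sector, hence holomorphic inside; [G] is
    holomorphic outside. Writing the integrand as G - q lets each part be closed up on its own side
    of the contour. *)
Let q (z : C) : B := plus ((/ (z - w))%C *: b1) ((/ w * / (z - RtoC (-1)))%C *: b2).
Let G (z : C) : B := r z ** kern_op.

Lemma kern_op_eq : kern_op = plus b1 ((/ w)%C *: b2).
Proof. unfold kern_op, b1, b2; module B. Qed.

(** The resolvent identity divided by z - v. It separates a product of resolvents from a scalar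
    rational function with a fixed operator coefficient. *)
Lemma resolvent_kernel z v : ba_resolvent z a (r z) -> ba_resolvent v a (r v) -> z <> v ->
  (/ (z - v))%C *: r z = minus (r z ** opp (r v)) ((/ (z - v))%C *: opp (r v)).
Proof.
intros Hz Hv Hne.
assert (E := resolvent_identity B a r z v Hz Hv).
assert (E' : r z ** r v = (/ (v - z))%C *: minus (r z) (r v)).
{ rewrite E, <- scal_CM, Cinv_l, scal_C1; [reflexivity|].
  apply Csub_neq_0; intros H; apply Hne; now rewrite H. }
rewrite ba_opp_r, E'.
assert (H1 := Csub_neq_0 _ _ Hne).
assert (H2 : (v - z)%C <> RtoC 0) by (apply Csub_neq_0; intros H; apply Hne; now rewrite H).
module_coefs B; field; auto.
Qed.

Lemma kern_decomposition z : z <> w -> z <> RtoC (-1) -> ba_resolvent z a (r z) ->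
  kern w z *: r z = minus (G z) (q z).
Proof.
intros H1 H2 Hz; unfold kern.
assert (E1 := resolvent_kernel z w Hz res_w H1).
assert (E2 := resolvent_kernel z (RtoC (-1)) Hz res_m1 H2).
replace (z + 1)%C with (z - RtoC (-1))%C by (rewrite RtoC_m1; ring).
rewrite scal_CD, scal_CM, E1, E2; unfold G, q; rewrite kern_op_eq; fold b1 b2.
rewrite ba_plus_r, ba_scal_r; module B.
Qed.

Lemma resolvent_mul_z z : ba_resolvent z a (r z) -> z *: r z = plus ba_one (r z ** a).
Proof.
intros [H _]; rewrite ba_minus_r, ba_scal_r, ba_one_r in H.
rewrite <- H; module B.
Qed.

Lemma resolvent_mul_z_comm z : ba_resolvent z a (r z) -> z *: r z = plus ba_one (a ** r z).
Proof.
intros [_ H]; rewrite ba_minus_l, ba_scal_l, ba_one_l in H.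
rewrite <- H; module B.
Qed.

(* The factor a of kern_op cancels the singularity of r at 0. *)
Lemma kern_op_factor : kern_op = (/ w)%C *: (a ** minus (r (RtoC (-1))) (r w)).
Proof.
assert (E1 := resolvent_mul_z_comm w res_w).
assert (E2 := resolvent_mul_z_comm _ res_m1).
rewrite ba_minus_r.
replace (a ** r (RtoC (-1))) with (minus (RtoC (-1) *: r (RtoC (-1))) ba_one) by (rewrite E2; module B).
replace (a ** r w) with (minus (w *: r w) ba_one) by (rewrite E1; module B).
unfold kern_op; rewrite RtoC_m1; module_coefs B; try ring; field; apply w_neq_0.
Qed.

Lemma norm_G_bounded : exists K, 0 <= K /\ forall z, z <> RtoC 0 -> Re z <= cos nu * Cmod z -> norm (G z) <= K.
Proof.
exists (Cmod (/ w)%C * ((M + 1) * norm (minus (r (RtoC (-1))) (r w)))).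
pose proof M_nonneg; pose proof (norm_ge_0 (minus (r (RtoC (-1))) (r w))); pose proof (Cmod_ge_0 (/ w)%C).
split; [repeat apply Rmult_le_pos; lra|]; intros z Hz1 Hz2.
destruct (Hres z Hz1 Hz2) as [Hz3 Hz4]; unfold G; rewrite kern_op_factor, ba_scal_r, norm_Cscal_eq.
apply Rmult_le_compat_l; [assumption|].
rewrite <- ba_assoc; eapply Rle_trans; [apply ba_norm_mul|].
apply Rmult_le_compat_r; [assumption|].
replace (r z ** a) with (minus (z *: r z) ba_one) by (rewrite resolvent_mul_z by assumption; module B).
eapply Rle_trans; [apply norm_minus_triangle|]; rewrite norm_Cscal_eq.
pose proof (ba_norm_one B); lra.
Qed.

(** Since z r(z) = 1 + r(z) a, the difference is r(z) times the fixed element a [kern_op], and r(z)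
    is O(1/|z|). *)
Lemma norm_G_infty : exists K, 0 <= K /\ forall z, z <> RtoC 0 -> Re z <= cos nu * Cmod z ->
  norm (minus (z *: G z) kern_op) <= K / Cmod z.
Proof.
exists (M * (norm a * norm kern_op)).
pose proof M_nonneg; pose proof (norm_ge_0 a); pose proof (norm_ge_0 kern_op).
split; [repeat apply Rmult_le_pos; lra|]; intros z Hz1 Hz2.
destruct (Hres z Hz1 Hz2) as [Hz3 Hz4].
assert (Hp : 0 < Cmod z) by now apply Cmod_gt_0.
replace (minus (z *: G z) kern_op) with (r z ** (a ** kern_op)).
2: { unfold G; rewrite <- ba_scal_l, resolvent_mul_z by assumption; ba_expand; module B. }
eapply Rle_trans; [apply ba_norm_mul|].
assert (Hn := ba_norm_mul B a kern_op); pose proof (norm_ge_0 (r z)); pose proof (norm_ge_0 (a ** kern_op)).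
apply Rle_trans with (norm (r z) * (norm a * norm kern_op)); [apply Rmult_le_compat_l; assumption|].
unfold Rdiv; replace (M * (norm a * norm kern_op) * / Cmod z) with (M * / Cmod z * (norm a * norm kern_op)) by ring.
apply Rmult_le_compat_r; [apply Rmult_le_pos; assumption|].
apply Rmult_le_reg_l with (Cmod z); [assumption|].
replace (Cmod z * (M * / Cmod z)) with M by (field; lra); exact Hz4.
Qed.

Lemma norm_q_bounded : exists K d, 0 <= K /\ 0 < d /\ forall z, Cmod z <= d -> norm (q z) <= K.
Proof.
assert (Hwp : 0 < Cmod w) by apply Cmod_gt_0, w_neq_0.
pose proof (norm_ge_0 b1); pose proof (norm_ge_0 b2).
assert (Hiw : 0 < / Cmod w) by now apply Rinv_0_lt_compat.
exists (/ (Cmod w / 2) * norm b1 + / Cmod w * 2 * norm b2), (Rmin (Cmod w / 2) (/ 2)).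
split; [|split].
- assert (0 < / (Cmod w / 2)) by (apply Rinv_0_lt_compat; lra).
  apply Rplus_le_le_0_compat; repeat apply Rmult_le_pos; lra.
- apply Rmin_glb_lt; lra.
- intros z Hz.
  assert (Z1 := Rle_trans _ _ _ Hz (Rmin_l _ _)); assert (Z2 := Rle_trans _ _ _ Hz (Rmin_r _ _)).
  assert (L1 : Cmod w / 2 <= Cmod (z - w)%C).
  { replace (z - w)%C with (- (w - z))%C by ring; rewrite Cmod_opp; pose proof (Cmod_lower w z); lra. }
  assert (L2 : / 2 <= Cmod (z - RtoC (-1))%C).
  { replace (z - RtoC (-1))%C with (- (RtoC (-1) - z))%C by ring; rewrite Cmod_opp.
    pose proof (Cmod_lower (RtoC (-1)) z) as H1; rewrite Cmod_R, Rabs_left in H1 by lra; lra. }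
  unfold q; eapply Rle_trans; [apply norm_triangle|]; rewrite !norm_Cscal_eq, Cmod_mult.
  rewrite !Cmod_inv by (try apply w_neq_0; intros E; rewrite E, Cmod_0 in *; lra).
  apply Rplus_le_compat; apply Rmult_le_compat_r; try assumption.
  + apply Rinv_le_contravar; lra.
  + apply Rmult_le_compat_l; [lra|]; rewrite <- (Rinv_inv 2); apply Rinv_le_contravar; lra.
Qed.

Lemma norm_q_infty : exists K d, 0 <= K /\ 0 < d /\ forall z, d <= Cmod z ->
  norm (minus (z *: q z) kern_op) <= K / Cmod z.
Proof.
assert (Hwp : 0 < Cmod w) by apply Cmod_gt_0, w_neq_0.
pose proof (norm_ge_0 b1); pose proof (norm_ge_0 b2).
assert (Hiw : 0 < / Cmod w) by now apply Rinv_0_lt_compat.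
exists (2 * Cmod w * norm b1 + 2 * / Cmod w * norm b2), (2 * Cmod w + 2).
split; [|split; [lra|]].
- apply Rplus_le_le_0_compat; repeat apply Rmult_le_pos; lra.
- intros z Hz.
  assert (L1 : Cmod z / 2 <= Cmod (z - w)%C) by (pose proof (Cmod_lower z w); lra).
  assert (L2 : Cmod z / 2 <= Cmod (z - RtoC (-1))%C).
  { pose proof (Cmod_lower z (RtoC (-1))) as H1; rewrite Cmod_R, Rabs_left in H1 by lra; lra. }
  assert (N1 : (z - w)%C <> RtoC 0) by (intros E; rewrite E, Cmod_0 in *; lra).
  assert (N2 : (z - RtoC (-1))%C <> RtoC 0) by (intros E; rewrite E, Cmod_0 in *; lra).
  apply Rle_trans with (norm (plus ((w * / (z - w))%C *: b1) ((- (/ w * / (z - RtoC (-1))))%C *: b2))).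
  { right; apply (f_equal (@norm C_AbsRing B)); rewrite kern_op_eq; unfold q.
    assert (E1 : (z * / (z - w) = 1 + w * / (z - w))%C) by (field; exact N1).
    assert (E2 : (z * / (z - RtoC (-1)) = 1 - / (z - RtoC (-1)))%C).
    { replace z with ((z - RtoC (-1)) - 1)%C at 1 by (rewrite RtoC_m1; ring); field; exact N2. }
    set (i1 := (/ (z - w))%C) in *; set (i2 := (/ (z - RtoC (-1)))%C) in *; set (iw := (/ w)%C).
    transitivity (minus (plus ((z * i1)%C *: b1) ((iw * (z * i2))%C *: b2)) (plus b1 (iw *: b2))); [module B|].
    rewrite E1, E2; module B. }
  eapply Rle_trans; [apply norm_triangle|]; rewrite !norm_Cscal_eq, Cmod_opp, !Cmod_mult.
  rewrite !Cmod_inv by (assumption || apply w_neq_0).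
  assert (Hz0 : 0 < Cmod z) by lra.
  assert (I1 : / Cmod (z - w)%C <= 2 / Cmod z).
  { replace (2 / Cmod z) with (/ (Cmod z / 2)) by (field; lra); apply Rinv_le_contravar; lra. }
  assert (I2 : / Cmod (z - RtoC (-1))%C <= 2 / Cmod z).
  { replace (2 / Cmod z) with (/ (Cmod z / 2)) by (field; lra); apply Rinv_le_contravar; lra. }
  apply Rle_trans with (Cmod w * (2 / Cmod z) * norm b1 + / Cmod w * (2 / Cmod z) * norm b2); [|right; field; lra].
  apply Rplus_le_compat; (apply Rmult_le_compat_r; [assumption|]); apply Rmult_le_compat_l; lra.
Qed.

Lemma cos_le_exterior u : nu <= u <= 2 * PI - nu -> cos u <= cos nu.
Proof.
intros H; pose proof PI_RGT_0; destruct (Rle_lt_dec u PI) as [Hu|Hu].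
- apply cos_decr_1; lra.
- replace (cos u) with (cos (2 * PI - u)); [apply cos_decr_1; lra|].
  rewrite cos_minus, cos_2PI, sin_2PI; ring.
Qed.

Lemma cos_ge_interior u : - nu <= u <= nu -> cos nu <= cos u.
Proof.
intros H; pose proof PI_RGT_0; destruct (Rle_lt_dec 0 u) as [Hu|Hu].
- apply cos_decr_1; lra.
- rewrite <- (cos_neg u); apply cos_decr_1; lra.
Qed.

Lemma exterior_region s u : 0 < s -> nu <= u <= 2 * PI - nu ->
  (RtoC s * circ (RtoC 0) (RtoC 1) u)%C <> RtoC 0 /\
  Re (RtoC s * circ (RtoC 0) (RtoC 1) u)%C <= cos nu * Cmod (RtoC s * circ (RtoC 0) (RtoC 1) u)%C /\
  Cmod (RtoC s * circ (RtoC 0) (RtoC 1) u)%C = s.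
Proof.
intros Hs Hu; rewrite circ_unit, Re_scal_cis, Cmod_scal_cis by lra; repeat split.
- intros E; assert (E' := Cmod_scal_cis s u (Rlt_le _ _ Hs)); rewrite E, Cmod_0 in E'; lra.
- rewrite Rmult_comm; apply Rmult_le_compat_r; [lra|now apply cos_le_exterior].
Qed.

Lemma interior_region s u : 0 < s -> - nu <= u <= nu ->
  (RtoC s * circ (RtoC 0) (RtoC 1) u)%C <> w /\
  (RtoC s * circ (RtoC 0) (RtoC 1) u)%C <> RtoC (-1) /\
  Cmod (RtoC s * circ (RtoC 0) (RtoC 1) u)%C = s.
Proof.
intros Hs Hu; rewrite circ_unit, Cmod_scal_cis by lra.
assert (Hc := cos_ge_interior u Hu); pose proof cos_nu_pos; repeat split; intros E.
- pose proof Hw as H1; rewrite <- E, Re_scal_cis, Cmod_scal_cis in H1 by lra; nra.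
- assert (E' : s * cos u = -1) by (rewrite <- Re_scal_cis, E; reflexivity); nra.
Qed.

Lemma cdiffable_G z : z <> RtoC 0 -> Re z <= cos nu * Cmod z -> cdiffable G z.
Proof.
intros H1 H2; apply (cdiffable_linear (fun x : B => x ** kern_op) r).
- apply is_linear_ba_mul_r.
- apply (cdiffable_resolvent B a r Hr); now apply Hres.
Qed.

Lemma cdiffable_kern_quotient z : z <> w -> z <> RtoC (-1) -> cdiffable q z.
Proof.
intros H1 H2; unfold q; apply cdiffable_plus.
- apply (cdiffable_scal (fun z => / (z - w))%C); [now apply cdiffable_Cinv_sub|apply cdiffable_const].
- apply (cdiffable_scal (fun z => / w * / (z - RtoC (-1)))%C); [|apply cdiffable_const].
  apply (cdiffable_scal (V := C_NormedModule) (fun _ => / w)%C (fun z => / (z - RtoC (-1)))%C).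
  + apply (cdiffable_const (V := C_NormedModule)).
  + now apply cdiffable_Cinv_sub.
Qed.

Let F (z : C) : B := kern w z *: r z.
Let ray (H : C -> B) (u : R) : R -> B := ray_form B H (RtoC 0) (RtoC 1) u.
Let arc (H : C -> B) (s : R) : R -> B := arc_form B H (RtoC 0) (RtoC 1) s.

Lemma ray_F_split u t S : u = nu \/ u = - nu -> 0 < t -> t <= S ->
  CInt (ray F u) t S = minus (CInt (ray G u) t S) (CInt (ray q u) t S).
Proof.
intros Hu Ht HS.
assert (Hreg : forall s, 0 < s ->
  (RtoC s * circ (RtoC 0) (RtoC 1) u)%C <> RtoC 0 /\
  Re (RtoC s * circ (RtoC 0) (RtoC 1) u)%C <= cos nu * Cmod (RtoC s * circ (RtoC 0) (RtoC 1) u)%C).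
{ intros s Hs; rewrite circ_unit, Re_scal_cis, Cmod_scal_cis by lra; split.
  - intros E; assert (E' := Cmod_scal_cis s u (Rlt_le _ _ Hs)); rewrite E, Cmod_0 in E'; lra.
  - destruct Hu as [-> | ->]; [|rewrite cos_neg]; lra. }
assert (Hint : - nu <= u <= nu) by (destruct Hu; lra).
apply Int_eq.
apply is_Int_ext with (fun s => minus (ray G u s) (ray q u s)); [assumption| |].
- intros s Hs; unfold ray, ray_form.
  destruct (Hreg s ltac:(lra)) as [R1 R2]; destruct (interior_region s u ltac:(lra) Hint) as (R3 & R4 & _).
  unfold F; rewrite kern_decomposition by (try assumption; now apply Hres).
  module B.
- apply is_Int_minus; (apply ex_Int; [apply ba_complete|assumption|]); intros s Hs; apply rcont_ray_form.
  + apply cdiffable_G; apply Hreg; lra.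
  + apply cdiffable_kern_quotient; apply (interior_region s u); lra.
Qed.

Lemma ray_period (H : C -> B) : ray H (2 * PI - nu) = ray H (- nu).
Proof. apply functional_extensionality; intros s; unfold ray, ray_form; now rewrite !circ_unit, cis_neg_period. Qed.

(** On a circle about 0 one has dz = i z du, so the integral is i times that of z H(z), which stays
    close to k. *)
Lemma arc_near (H : C -> B) u0 u1 s k e : u0 <= u1 -> 0 < s ->
  (forall u, u0 <= u <= u1 -> cdiffable H (RtoC s * circ (RtoC 0) (RtoC 1) u)%C) ->
  (forall u, u0 <= u <= u1 ->
    norm (minus ((RtoC s * circ (RtoC 0) (RtoC 1) u)%C *: H (RtoC s * circ (RtoC 0) (RtoC 1) u)%C) k) <= e) ->
  norm (minus (CInt (arc H s) u0 u1) ((RtoC (u1 - u0) * Ci)%C *: k)) <= (u1 - u0) * e.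
Proof.
intros Hu Hs Hd Hn.
assert (I1 : is_Int (arc H s) u0 u1 (CInt (arc H s) u0 u1)).
{ apply ex_Int; [apply ba_complete|assumption|]; intros u Hu'; apply rcont_arc_form, Hd, Hu'. }
assert (I2 := is_Int_minus _ _ _ _ _ _ I1 (is_Int_const (Ci *: k) u0 u1)).
rewrite scal_CM.
apply (norm_is_Int_le _ u0 u1 _ e Hu) with (2 := I2).
intros u Hu'; specialize (Hn u Hu'); unfold arc, arc_form.
replace (RtoC s * dcirc (RtoC 1) u)%C with (Ci * (RtoC s * circ (RtoC 0) (RtoC 1) u))%C
  by (unfold circ, dcirc; ring).
set (z := (RtoC s * circ (RtoC 0) (RtoC 1) u)%C) in *.
norm_rewrite B (Ci *: minus (z *: H z) k).
rewrite norm_Cscal_eq, Cmod_Ci; lra.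
Qed.

(** Both parts of the integrand are holomorphic where they are closed up and bounded near 0, so only
    their common behaviour [kern_op]/z at infinity contributes. *)
Theorem sector_integral_kern (l u : B) :
  is_RInt_gen (V := real_module B) (ray F (- nu)) (at_right 0) (Rbar_locally p_infty) l ->
  is_RInt_gen (V := real_module B) (ray F nu) (at_right 0) (Rbar_locally p_infty) u ->
  minus l u = (2 * RtoC PI * Ci)%C *: kern_op.
Proof.
intros Hl Hu.
pose proof PI_RGT_0 as HPI.
apply eq_of_norm_minus_small; intros e He.
destruct (is_RInt_gen_sector_limit _ _ Hl (e / 6) ltac:(lra)) as [d1 [M1 [Hd1 H1]]].
destruct (is_RInt_gen_sector_limit _ _ Hu (e / 6) ltac:(lra)) as [d2 [M2 [Hd2 H2]]].
destruct norm_G_bounded as [K1 [HK1 HG1]].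
destruct norm_G_infty as [K2 [HK2 HG2]].
destruct norm_q_bounded as [K3 [d3 [HK3 [Hd3 Hq3]]]].
destruct norm_q_infty as [K4 [d4 [HK4 [Hd4 Hq4]]]].
(* Six errors of size e/6: two improper integrals and four arcs. An arc has opening at most 2 pi, so
   its integrand may deviate by [T]. *)
set (T := e / 6 / (2 * PI)).
assert (HT : 0 < T) by (unfold T; repeat apply Rdiv_lt_0_compat; lra).
assert (HT2 : 2 * PI * T = e / 6) by (unfold T; field; lra).
set (t := Rmin (Rmin d1 d2) (Rmin d3 (Rmin (T / (K1 + 1)) (T / (K3 + 1)))) / 2).
assert (Ht : 0 < t /\ t < d1 /\ t < d2 /\ t <= d3 /\ t <= T / (K1 + 1) /\ t <= T / (K3 + 1)).
{ assert (P1 : 0 < T / (K1 + 1)) by (apply Rdiv_lt_0_compat; lra).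
  assert (P3 : 0 < T / (K3 + 1)) by (apply Rdiv_lt_0_compat; lra).
  set (m := Rmin (Rmin d1 d2) (Rmin d3 (Rmin (T / (K1 + 1)) (T / (K3 + 1))))) in *.
  assert (Hm : 0 < m) by (unfold m; repeat apply Rmin_glb_lt; assumption).
  assert (m <= Rmin d1 d2) by apply Rmin_l.
  assert (m <= Rmin d3 (Rmin (T / (K1 + 1)) (T / (K3 + 1)))) by apply Rmin_r.
  pose proof (Rmin_l d1 d2); pose proof (Rmin_r d1 d2).
  pose proof (Rmin_l d3 (Rmin (T / (K1 + 1)) (T / (K3 + 1)))).
  pose proof (Rmin_r d3 (Rmin (T / (K1 + 1)) (T / (K3 + 1)))).
  pose proof (Rmin_l (T / (K1 + 1)) (T / (K3 + 1))); pose proof (Rmin_r (T / (K1 + 1)) (T / (K3 + 1))).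
  unfold t; repeat split; lra. }
destruct Ht as (Ht0 & Ht1 & Ht2 & Ht3 & Ht4 & Ht5); clearbody t.
set (S := t + Rabs M1 + Rabs M2 + d4 + K2 / T + K4 / T + 1).
assert (HKT2 : 0 <= K2 / T) by (apply Rdiv_le_0_compat; assumption).
assert (HKT4 : 0 <= K4 / T) by (apply Rdiv_le_0_compat; assumption).
pose proof (Rle_abs M1); pose proof (Rle_abs M2); pose proof (Rabs_pos M1); pose proof (Rabs_pos M2).
assert (HS0 : t < S) by (unfold S; lra).
assert (HS1 : M1 < S) by (unfold S; lra).
assert (HS2 : M2 < S) by (unfold S; lra).
assert (HS3 : d4 <= S) by (unfold S; lra).
assert (HS4 : K2 / S <= T).
{ apply Rmult_le_reg_r with S; [lra|]; unfold Rdiv; rewrite Rmult_assoc, Rinv_l, Rmult_1_r by lra.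
  apply Rle_trans with (T * (K2 / T)); [right; field; lra|apply Rmult_le_compat_l; unfold S; lra]. }
assert (HS5 : K4 / S <= T).
{ apply Rmult_le_reg_r with S; [lra|]; unfold Rdiv; rewrite Rmult_assoc, Rinv_l, Rmult_1_r by lra.
  apply Rle_trans with (T * (K4 / T)); [right; field; lra|apply Rmult_le_compat_l; unfold S; lra]. }
clearbody S.
specialize (H1 t S (conj Ht0 Ht1) HS1); specialize (H2 t S (conj Ht0 Ht2) HS2).
rewrite ray_F_split in H1 by (auto; lra); rewrite ray_F_split in H2 by (auto; lra).
assert (DG : forall s v, t <= s <= S -> nu <= v <= 2 * PI - nu -> cdiffable G (RtoC s * circ (RtoC 0) (RtoC 1) v)%C).
{ intros s v Hs Hv; destruct (exterior_region s v ltac:(lra) Hv) as (E1 & E2 & _); now apply cdiffable_G. }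
assert (Dq : forall s v, t <= s <= S -> - nu <= v <= nu -> cdiffable q (RtoC s * circ (RtoC 0) (RtoC 1) v)%C).
{ intros s v Hs Hv; destruct (interior_region s v ltac:(lra) Hv) as (E1 & E2 & _); now apply cdiffable_kern_quotient. }
assert (CG := cauchy_scaled B (ba_complete B) G (RtoC 0) (RtoC 1) t S nu (2 * PI - nu) ltac:(lra) DG ltac:(lra) ltac:(lra)).
assert (Cq := cauchy_scaled B (ba_complete B) q (RtoC 0) (RtoC 1) t S (- nu) nu ltac:(lra) Dq ltac:(lra) ltac:(lra)).
fold (ray G nu) (ray G (2 * PI - nu)) (arc G S) (arc G t) in CG; rewrite ray_period in CG.
fold (ray q nu) (ray q (- nu)) (arc q S) (arc q t) in Cq.
assert (A1 : norm (minus (CInt (arc G S) nu (2 * PI - nu)) ((RtoC (2 * PI - nu - nu) * Ci)%C *: kern_op)) <= e / 6).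
{ eapply Rle_trans; [apply (arc_near G _ _ _ _ T); try lra|].
  - intros v Hv; apply DG; lra.
  - intros v Hv; destruct (exterior_region S v ltac:(lra) Hv) as (E1 & E2 & E3).
    eapply Rle_trans; [now apply HG2|]; rewrite E3; exact HS4.
  - rewrite <- HT2; apply Rmult_le_compat_r; lra. }
assert (A2 : norm (minus (CInt (arc q S) (- nu) nu) ((RtoC (nu - - nu) * Ci)%C *: kern_op)) <= e / 6).
{ eapply Rle_trans; [apply (arc_near q _ _ _ _ T); try lra|].
  - intros v Hv; apply Dq; lra.
  - intros v Hv; destruct (interior_region S v ltac:(lra) Hv) as (E1 & E2 & E3).
    eapply Rle_trans; [apply Hq4; rewrite E3; exact HS3|]; rewrite E3; exact HS5.
  - rewrite <- HT2; apply Rmult_le_compat_r; lra. }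
assert (Hsmall : forall K z (v : B), 0 <= K -> Cmod z = t -> t <= T / (K + 1) -> norm v <= K -> norm (minus (z *: v) zero) <= T).
{ intros K z v HK Hz Htk Hv.
  norm_rewrite B (z *: v); rewrite norm_Cscal_eq, Hz.
  apply Rle_trans with (T / (K + 1) * (K + 1)); [|right; field; lra].
  apply Rmult_le_compat; try lra; apply norm_ge_0. }
assert (A3 : norm (CInt (arc G t) nu (2 * PI - nu)) <= e / 6).
{ replace (CInt (arc G t) nu (2 * PI - nu))
    with (minus (CInt (arc G t) nu (2 * PI - nu)) ((RtoC (2 * PI - nu - nu) * Ci)%C *: zero)) by module B.
  eapply Rle_trans; [apply (arc_near G _ _ _ _ T); try lra|].
  - intros v Hv; apply DG; lra.
  - intros v Hv; destruct (exterior_region t v ltac:(lra) Hv) as (E1 & E2 & E3).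
    apply (Hsmall K1); try assumption; now apply HG1.
  - rewrite <- HT2; apply Rmult_le_compat_r; lra. }
assert (A4 : norm (CInt (arc q t) (- nu) nu) <= e / 6).
{ replace (CInt (arc q t) (- nu) nu)
    with (minus (CInt (arc q t) (- nu) nu) ((RtoC (nu - - nu) * Ci)%C *: zero)) by module B.
  eapply Rle_trans; [apply (arc_near q _ _ _ _ T); try lra|].
  - intros v Hv; apply Dq; lra.
  - intros v Hv; destruct (interior_region t v ltac:(lra) Hv) as (E1 & E2 & E3).
    apply (Hsmall K3); try assumption; apply Hq3; lra.
  - rewrite <- HT2; apply Rmult_le_compat_r; lra. }
set (x1 := CInt (ray G (- nu)) t S) in *; set (x2 := CInt (ray q (- nu)) t S) in *.
set (x3 := CInt (ray G nu) t S) in *; set (x4 := CInt (ray q nu) t S) in *.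
set (y1 := CInt (arc G S) nu (2 * PI - nu)) in *; set (y2 := CInt (arc q S) (- nu) nu) in *.
(* In the next identity the exterior arc of [G], of opening 2 pi - 2 nu, and the interior arc of
   [q], of opening 2 nu, add up to the full 2 pi. *)
set (y3 := CInt (arc G t) nu (2 * PI - nu)) in *; set (y4 := CInt (arc q t) (- nu) nu) in *.
assert (E : minus (minus l u) ((2 * RtoC PI * Ci)%C *: kern_op) =
  plus (plus (opp (minus (minus x1 x2) l)) (minus (minus x3 x4) u))
  (plus (plus (minus y1 ((RtoC (2 * PI - nu - nu) * Ci)%C *: kern_op)) (minus y2 ((RtoC (nu - - nu) * Ci)%C *: kern_op)))
   (opp (plus y3 y4)))).
{ replace x1 with (minus (plus x3 y1) y3) by (rewrite CG; module B).
  replace x4 with (minus (plus x2 y2) y4) by (rewrite Cq; module B).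
  rewrite !RtoC_minus, RtoC_mult, RtoC_opp; module B. }
rewrite E.
apply Rle_trans with ((e / 6 + e / 6) + ((e / 6 + e / 6) + (e / 6 + e / 6))); [|lra].
apply norm_plus_le; apply norm_plus_le.
- apply norm_opp_le, Rlt_le, H1.
- apply Rlt_le, H2.
- apply norm_plus_le; assumption.
- apply norm_opp_le, norm_plus_le; assumption.
Qed.

End SectorIntegral.

Lemma Re_minus (z w : C) : Re (z - w)%C = Re z - Re w.
Proof. reflexivity. Qed.

Lemma Re_le_Cmod (z : C) : Re z <= Cmod z.
Proof. eapply Rle_trans; [apply Rle_abs|apply re_le_Cmod]. Qed.

(** If |w| is at most (1 + (x-y)/2) |z|, real parts separate the points; otherwise their moduli do.
    The second bound follows from the first when |w| <= 2|z|, and from |w| - |z| >= |w|/2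
    otherwise. *)
Lemma cone_separation (z w : C) (x y : R) : 0 <= y -> y < x -> x <= 1 ->
  x * Cmod z <= Re z -> Re w <= y * Cmod w ->
  (x - y) / 2 * Cmod z <= Cmod (z - w)%C /\ (x - y) / 4 * Cmod w <= Cmod (z - w)%C.
Proof.
intros Hy Hxy Hx Hz Hw.
pose proof (Cmod_ge_0 z) as Hz0; pose proof (Cmod_ge_0 w) as Hw0.
pose proof (Re_le_Cmod (z - w)%C) as H1; rewrite Re_minus in H1.
assert (H2 : Cmod w - Cmod z <= Cmod (z - w)%C).
{ replace (z - w)%C with (- (w - z))%C by ring; rewrite Cmod_opp; apply Cmod_lower. }
set (d := x - y) in *.
assert (Hd : 0 < d <= 1) by (unfold d; lra).
assert (K1 : d / 2 * Cmod z <= Cmod (z - w)%C).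
{ destruct (Rle_lt_dec (Cmod w) (Cmod z * (1 + d / 2))) as [H|H].
  - assert (y * Cmod w <= y * (Cmod z * (1 + d / 2))) by (apply Rmult_le_compat_l; lra).
    assert (y * (Cmod z * (1 + d / 2)) = y * Cmod z + d / 2 * (y * Cmod z)) by ring.
    assert (d / 2 * (y * Cmod z) <= d / 2 * (1 * Cmod z)).
    { apply Rmult_le_compat_l; [lra|]; apply Rmult_le_compat_r; unfold d in *; lra. }
    unfold d in *; nra.
  - nra. }
split; [exact K1|].
destruct (Rle_lt_dec (Cmod w) (2 * Cmod z)) as [H|H]; nra.
Qed.

Lemma Cmod_Cinv_le (z : C) (m : R) : 0 < m -> m <= Cmod z -> Cmod (/ z)%C <= / m.
Proof.
intros Hm H; rewrite Cmod_inv; [apply Rinv_le_contravar; assumption|].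
intros E; rewrite E, Cmod_0 in H; lra.
Qed.

Lemma Cmod_Cinv_le_1 (z : C) : 1 <= Cmod z -> Cmod (/ z)%C <= 1.
Proof. intros H; rewrite <- Rinv_1; apply Cmod_Cinv_le; lra. Qed.

Lemma Cmod_ge_neq_0 (z : C) (m : R) : 0 < m -> m <= Cmod z -> z <> RtoC 0.
Proof. intros Hm H E; rewrite E, Cmod_0 in H; lra. Qed.

Lemma Cmod_plus_1 (z : C) : 0 <= Re z -> 1 <= Cmod (z + 1)%C.
Proof.
intros H; eapply Rle_trans; [|apply Re_le_Cmod]; unfold Re in *; simpl; lra.
Qed.

Lemma cdiffable_Cinv (z0 : C) : z0 <> RtoC 0 -> cdiffable (V := C_NormedModule) (fun z => / z)%C z0.
Proof.
intros H; apply (cdiffable_ext (V := C_NormedModule) (fun z => / (z - RtoC 0))%C).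
- intros z; change (/ (z - RtoC 0) = / z)%C; now replace (z - RtoC 0)%C with z by ring.
- now apply cdiffable_Cinv_sub.
Qed.

Lemma cdiffable_Cinv_rsub (v w : C) : v <> w -> cdiffable (V := C_NormedModule) (fun z => / (v - z))%C w.
Proof.
intros H; apply (cdiffable_ext (V := C_NormedModule) (fun z => RtoC (-1) * / (z - v))%C).
- intros z; change (RtoC (-1) * / (z - v) = / (v - z))%C; destruct (classic (z = v)) as [->|Hz].
  (* [cdiffable_ext] asks for equality at the pole too; there both sides are the default value 0 of
     [Cinv] at 0. *)
  + replace (v - v)%C with (RtoC 0) by ring; rewrite RtoC_m1.
    unfold Cinv, RtoC; simpl; unfold Rdiv, Cmult, Copp; simpl; f_equal; ring.
  + rewrite RtoC_m1; field; split; apply Csub_neq_0; auto.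
- apply (cdiffable_scal (V := C_NormedModule) (fun _ => RtoC (-1))).
  + apply (cdiffable_const (V := C_NormedModule)).
  + apply cdiffable_Cinv_sub; auto.
Qed.

(** * Scalar estimates *)

Section ScalarEstimate.

Variables (x y b N : R) (c0 c1 : C) (u0 u1 : R) (Phi : C -> C).
Hypothesis Hy : 0 <= y.
Hypothesis Hxy : y < x.
Hypothesis Hx : x <= 1.
Hypothesis Hb : 0 < b.
Hypothesis Hu : u0 <= u1 <= u0 + 2 * PI.
Hypothesis Hge : forall u, u0 <= u <= u1 -> 1 <= Cmod (circ c0 c1 u).
Hypothesis Hend : forall u, u = u0 \/ u = u1 ->
  Cmod (circ c0 c1 u) = 1 /\ Re (circ c0 c1 u) <= y.
Hypothesis HPhi : forall s u, 0 < s <= b -> u0 <= u <= u1 ->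
  cdiffable (V := C_NormedModule) Phi (RtoC s * circ c0 c1 u)%C /\
  Cmod (Phi (RtoC s * circ c0 c1 u)%C) <= N.

Notation ray H := (ray_form C_NormedModule H c0 c1).
Notation arc H := (arc_form C_NormedModule H c0 c1).

Let pt (s u : R) : C := (RtoC s * circ c0 c1 u)%C.

Lemma N_nonneg : 0 <= N.
Proof.
eapply Rle_trans; [apply Cmod_ge_0|]; apply (HPhi b u0); lra.
Qed.

Lemma Cmod_pt s u : 0 < s -> u0 <= u <= u1 -> s <= Cmod (pt s u).
Proof.
intros Hs Hu'; unfold pt; rewrite Cmod_mult, Cmod_R, Rabs_pos_eq by lra.
specialize (Hge u Hu'); nra.
Qed.

Lemma Cmod_pt_end s u : 0 < s -> u = u0 \/ u = u1 -> Cmod (pt s u) = s.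
Proof.
intros Hs Hu'; unfold pt; rewrite Cmod_mult, Cmod_R, Rabs_pos_eq by lra.
rewrite (proj1 (Hend u Hu')); ring.
Qed.

Lemma Re_pt_end s u : 0 < s -> u = u0 \/ u = u1 -> Re (pt s u) <= y * Cmod (pt s u).
Proof.
intros Hs Hu'; rewrite Cmod_pt_end by assumption.
replace (Re (pt s u)) with (s * Re (circ c0 c1 u)) by (unfold pt, Re; simpl; ring).
pose proof (proj2 (Hend u Hu')); nra.
Qed.

Lemma end_range u : u = u0 \/ u = u1 -> u0 <= u <= u1.
Proof. intros [-> | ->]; lra. Qed.

(** Cauchy's theorem trades the two rays for the arcs s = m and s = b. Each arc has length at most 2
    pi s |c1|, which compensates K/s exactly, so no logarithm of b/m appears. *)
Lemma ray_difference_bound (H : C -> C) (m K : R) : 0 < m <= b -> 0 <= K ->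
  (forall s u, m <= s <= b -> u0 <= u <= u1 -> cdiffable (V := C_NormedModule) H (pt s u)) ->
  (forall s u, m <= s <= b -> u0 <= u <= u1 -> Cmod (H (pt s u)) <= K / s) ->
  Cmod (CInt (ray H u0) m b - CInt (ray H u1) m b)%C <= 4 * PI * Cmod c1 * K.
Proof.
intros Hm HK Hd Hn.
assert (E := cauchy_scaled C_NormedModule C_norm_complete H c0 c1 m b u0 u1 ltac:(lra) Hd ltac:(lra) ltac:(lra)).
assert (A : forall s, m <= s <= b -> Cmod (CInt (arc H s) u0 u1) <= 2 * PI * (Cmod c1 * K)).
{ intros s Hs.
  apply Rle_trans with ((u1 - u0) * (Cmod c1 * K)).
  - apply (norm_is_Int_le (V := C_NormedModule) (arc H s)); [lra| |].
    + intros u Hu'; unfold arc_form; rewrite norm_Cscal_eq, Cmod_mult, Cmod_R, Rabs_pos_eq, Cmod_dcirc by lra.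
      apply Rle_trans with (s * Cmod c1 * (K / s)); [|right; field; lra].
      apply Rmult_le_compat_l; [apply Rmult_le_pos; [lra|apply Cmod_ge_0]|now apply Hn].
    + apply (is_Int_arc C_NormedModule C_norm_complete H c0 c1 m b u0 u1 Hd); lra.
  - apply Rmult_le_compat_r; [apply Rmult_le_pos; [apply Cmod_ge_0|assumption]|lra]. }
replace (CInt (ray H u0) m b - CInt (ray H u1) m b)%C
  with (CInt (arc H m) u0 u1 - CInt (arc H b) u0 u1)%C.
- replace (CInt (arc H m) u0 u1 - CInt (arc H b) u0 u1)%C
    with (CInt (arc H m) u0 u1 + - CInt (arc H b) u0 u1)%C by ring.
  eapply Rle_trans; [apply Cmod_triangle|]; rewrite Cmod_opp.
  eapply Rle_trans; [apply Rplus_le_compat; [apply (A m ltac:(lra))|apply (A b ltac:(lra))]|]; lra.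
- change (CInt (ray H u0) m b + CInt (arc H b) u0 u1 = CInt (ray H u1) m b + CInt (arc H m) u0 u1)%C in E.
  set (v0 := CInt (ray H u0) m b : C) in *; set (v1 := CInt (ray H u1) m b : C) in *.
  set (w0 := CInt (arc H m) u0 u1 : C) in *; set (w1 := CInt (arc H b) u0 u1 : C) in *.
  replace v0 with ((v0 + w1) - w1)%C by ring; rewrite E; ring.
Qed.

Lemma int_inv_bound (d : R) : 0 < d <= b ->
  Cmod (CInt (ray (fun w => / w * Phi w)%C u0) d b - CInt (ray (fun w => / w * Phi w)%C u1) d b)%C
    <= 4 * PI * Cmod c1 * N.
Proof.
intros Hd; apply ray_difference_bound; [assumption|apply N_nonneg| |].
- intros s u Hs Hu'; apply (cdiffable_scal (V := C_NormedModule) (fun w => / w)%C Phi).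
  + apply cdiffable_Cinv, (Cmod_ge_neq_0 _ s); [lra|apply Cmod_pt; lra].
  + apply HPhi; lra.
- intros s u Hs Hu'; rewrite Cmod_mult, Rmult_comm; unfold Rdiv.
  apply Rmult_le_compat; try apply Cmod_ge_0; [apply HPhi; lra|].
  apply Cmod_Cinv_le; [lra|apply Cmod_pt; lra].
Qed.

(** Origin of the constant: below s = 2|z| the distance |z-w| is at least (x-y)|z|/2 on a piece of
    length at most 2|z|, which gives 4N/(x-y) for each ray; above it |z-w| >= s/2, so
    [ray_difference_bound] applies with K = 2N. *)
Lemma int_cauchy_bound (z : C) (d : R) : 0 < d <= b -> z <> RtoC 0 -> x * Cmod z <= Re z ->
  Cmod (CInt (ray (fun w => / (z - w) * Phi w)%C u0) d b - CInt (ray (fun w => / (z - w) * Phi w)%C u1) d b)%C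
    <= (8 * PI * Cmod c1 + 8 / (x - y)) * N.
Proof.
intros Hd Hz0 Hz.
set (H := fun w => (/ (z - w) * Phi w)%C).
assert (Hzp : 0 < Cmod z) by now apply Cmod_gt_0.
pose proof N_nonneg as HN; pose proof (Cmod_ge_0 c1) as Hc1; pose proof PI_RGT_0 as HPI.
assert (Hsep : forall s u, 0 < s -> u = u0 \/ u = u1 -> (x - y) / 2 * Cmod z <= Cmod (z - pt s u)%C).
{ intros s u Hs Hu'; apply (cone_separation z (pt s u) x y); try assumption; now apply Re_pt_end. }
assert (Hxyz : 0 < (x - y) / 2 * Cmod z) by (apply Rmult_lt_0_compat; lra).
assert (Hdray : forall s u, 0 < s <= b -> u = u0 \/ u = u1 -> cdiffable (V := C_NormedModule) H (pt s u)).
{ intros s u Hs Hu'; apply (cdiffable_scal (V := C_NormedModule) (fun w => / (z - w))%C Phi).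
  - apply cdiffable_Cinv_rsub; intros E; specialize (Hsep s u ltac:(lra) Hu').
    rewrite <- E in Hsep; replace (z - z)%C with (RtoC 0) in Hsep by ring; rewrite Cmod_0 in Hsep; lra.
  - apply HPhi; [lra|now apply end_range]. }
assert (Hint : forall u p q, u = u0 \/ u = u1 -> 0 < p -> p <= q -> q <= b ->
  is_Int (V := C_NormedModule) (ray H u) p q (CInt (ray H u) p q)).
{ intros u p q Hu' Hp Hpq Hq; apply ex_Int; [apply C_norm_complete|assumption|].
  intros s Hs; apply rcont_ray_form, Hdray; [lra|assumption]. }
assert (Hnear : forall u p q, u = u0 \/ u = u1 -> 0 < p -> p <= q -> q <= b -> q <= 2 * Cmod z ->
  Cmod (CInt (ray H u) p q) <= 4 / (x - y) * N).
{ intros u p q Hu' Hp Hpq Hq Hqz.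
  apply Rle_trans with ((q - p) * (/ ((x - y) / 2 * Cmod z) * N)).
  - apply (norm_is_Int_le (V := C_NormedModule) (ray H u) p q); [assumption| |now apply Hint].
    intros s Hs; unfold ray_form; rewrite norm_Cscal_eq, (proj1 (Hend u Hu')), Rmult_1_l.
    unfold H; change (Cmod (/ (z - pt s u) * Phi (pt s u))%C <= / ((x - y) / 2 * Cmod z) * N).
    rewrite Cmod_mult; apply Rmult_le_compat; try apply Cmod_ge_0.
    + apply Cmod_Cinv_le; [assumption|apply Hsep; [lra|assumption]].
    + apply HPhi; [lra|now apply end_range].
  - assert (Hi : 0 < / ((x - y) / 2 * Cmod z)) by now apply Rinv_0_lt_compat.
    apply Rle_trans with (2 * Cmod z * (/ ((x - y) / 2 * Cmod z) * N)).
    + apply Rmult_le_compat_r; [apply Rmult_le_pos; lra|lra].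
    + right; field; lra. }
assert (Hfar : forall m, d <= m <= b -> 2 * Cmod z <= m ->
  Cmod (CInt (ray H u0) m b - CInt (ray H u1) m b)%C <= 4 * PI * Cmod c1 * (2 * N)).
{ intros m Hm Hmz; apply ray_difference_bound; [lra|lra| |].
  - intros s u Hs Hu'; apply (cdiffable_scal (V := C_NormedModule) (fun w => / (z - w))%C Phi).
    + apply cdiffable_Cinv_rsub; intros E.
      assert (Hp := Cmod_pt s u ltac:(lra) Hu'); rewrite <- E in Hp; lra.
    + apply HPhi; [lra|assumption].
  - intros s u Hs Hu'; unfold H; rewrite Cmod_mult.
    apply Rle_trans with (/ (s / 2) * N); [|right; field; lra].
    apply Rmult_le_compat; try apply Cmod_ge_0; [|apply HPhi; [lra|assumption]].
    apply Cmod_Cinv_le; [lra|].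
    replace (z - pt s u)%C with (- (pt s u - z))%C by ring; rewrite Cmod_opp.
    assert (Hp := Cmod_pt s u ltac:(lra) Hu'); pose proof (Cmod_lower (pt s u) z); lra. }
assert (Hk : 4 / (x - y) * N + 4 / (x - y) * N = 8 / (x - y) * N) by (field; lra).
assert (Hk0 : 0 <= 4 / (x - y) * N).
{ apply Rmult_le_pos; [apply Rdiv_le_0_compat; lra|assumption]. }
assert (Hk1 : 0 <= 4 * PI * Cmod c1 * (2 * N)) .
{ replace (4 * PI * Cmod c1 * (2 * N)) with (8 * (PI * Cmod c1 * N)) by ring.
  apply Rmult_le_pos; [lra|]; apply Rmult_le_pos; [apply Rmult_le_pos|]; lra. }
fold H.
assert (Hsub : forall v0 v1 : C, Cmod (v0 - v1)%C <= Cmod v0 + Cmod v1).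
{ intros v0 v1; unfold Cminus; eapply Rle_trans; [apply Cmod_triangle|]; rewrite Cmod_opp; lra. }
destruct (Rle_lt_dec (2 * Cmod z) d) as [C1|C1].
{ eapply Rle_trans; [apply Hfar; lra|]; lra. }
destruct (Rle_lt_dec b (2 * Cmod z)) as [C2|C2].
{ eapply Rle_trans; [apply Hsub|].
  assert (B0 := Hnear u0 d b ltac:(auto) ltac:(lra) ltac:(lra) ltac:(lra) C2).
  assert (B1 := Hnear u1 d b ltac:(auto) ltac:(lra) ltac:(lra) ltac:(lra) C2). lra. }
set (m := 2 * Cmod z) in *.
assert (S : forall u, u = u0 \/ u = u1 -> CInt (ray H u) d b = (CInt (ray H u) d m + CInt (ray H u) m b)%C).
{ intros u Hu'; apply Int_eq, (is_Int_Chasles (V := C_NormedModule)) with m; apply Hint; auto; lra. }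
rewrite (S u0), (S u1) by auto.
replace (CInt (ray H u0) d m + CInt (ray H u0) m b - (CInt (ray H u1) d m + CInt (ray H u1) m b))%C
  with ((CInt (ray H u0) d m - CInt (ray H u1) d m) + (CInt (ray H u0) m b - CInt (ray H u1) m b))%C by ring.
eapply Rle_trans; [apply Cmod_triangle|].
apply Rle_trans with ((4 / (x - y) * N + 4 / (x - y) * N) + 4 * PI * Cmod c1 * (2 * N)); [|lra].
apply Rplus_le_compat; [|apply Hfar; unfold m in *; lra].
eapply Rle_trans; [apply Hsub|].
apply Rplus_le_compat; apply Hnear; auto; unfold m in *; lra.
Qed.

End ScalarEstimate.

Lemma Re_sq_Im_sq (z : C) : Re z ^ 2 + Im z ^ 2 = Cmod z ^ 2.
Proof.
unfold Cmod; change (Cmod z) with (sqrt (fst z ^ 2 + snd z ^ 2)).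
rewrite pow2_sqrt; [reflexivity|]; pose proof (pow2_ge_0 (fst z)); pose proof (pow2_ge_0 (snd z)); lra.
Qed.

(** |Arg z| is the arc cosine of Re z/|z|, and the cosine decreases on [0, pi]. The strict
    inequality excludes z = 0 by itself; the geometry below uses this form only. *)
Lemma sector_iff (w : R) (z : C) : 0 < w < PI -> sector w z <-> Cmod z * cos w < Re z.
Proof.
intros Hw.
assert (HC : forall z, z <> RtoC 0 -> Rabs (Carg z) = acos (Re z / Cmod z)).
{ intros z' _; unfold Carg; pose proof (acos_bound (Re z' / Cmod z')).
  destruct (Rle_dec 0 (Im z')); [rewrite Rabs_pos_eq|rewrite Rabs_Ropp, Rabs_pos_eq]; lra. }
assert (HR : forall z, z <> RtoC 0 -> -1 <= Re z / Cmod z <= 1).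
{ intros z' Hz'; assert (Hp : 0 < Cmod z') by now apply Cmod_gt_0.
  pose proof (re_le_Cmod z') as H; apply Rabs_le_between in H.
  set (m := Cmod z') in *; set (q := Re z') in *.
  split; apply Rmult_le_reg_r with m; try assumption;
    unfold Rdiv; rewrite Rmult_assoc, Rinv_l by lra; lra. }
split.
- intros [Hz H]; rewrite HC in H by assumption.
  assert (Hp : 0 < Cmod z) by now apply Cmod_gt_0.
  pose proof (acos_bound (Re z / Cmod z)) as Hb.
  assert (Hcos := cos_decreasing_1 (acos (Re z / Cmod z)) w (proj1 Hb) (proj2 Hb) ltac:(lra) ltac:(lra) H).
  rewrite cos_acos in Hcos by (apply HR; assumption).
  apply Rmult_lt_reg_r with (/ Cmod z); [now apply Rinv_0_lt_compat|].
  replace (Cmod z * cos w * / Cmod z) with (cos w) by (field; lra); exact Hcos.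
- intros H.
  assert (Hz : z <> RtoC 0).
  { intros E; rewrite E, Cmod_0 in H; unfold Re in H; simpl in H; lra. }
  assert (Hp : 0 < Cmod z) by now apply Cmod_gt_0.
  split; [assumption|]; rewrite HC by assumption.
  pose proof (acos_bound (Re z / Cmod z)) as Hb.
  apply cos_decreasing_0; try lra.
  rewrite cos_acos by (apply HR; assumption).
  apply Rmult_lt_reg_r with (Cmod z); [assumption|].
  unfold Rdiv; rewrite Rmult_assoc, Rinv_l by lra; lra.
Qed.

(** [0 <= M] covers the empty domain, where the supremum is [m_infty] and [real] returns 0. *)
Lemma sup_norm_on_le (D : C -> Prop) (f : C -> C) (M : R) :
  0 <= M -> (forall z, D z -> Cmod (f z) <= M) -> sup_norm_on D f <= M.
Proof.
intros HM H; unfold sup_norm_on.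
destruct (Lub_Rbar_correct (fun r => exists z, D z /\ r = Cmod (f z))) as [_ H2].
assert (HU : is_ub_Rbar (fun r => exists z, D z /\ r = Cmod (f z)) M).
{ intros r [z [Hz ->]]; now apply H. }
specialize (H2 M HU); destruct (Lub_Rbar _) as [l| |]; simpl in *; [assumption|contradiction|assumption].
Qed.

Section RiemannSums.

Context {V : NormedModule C_AbsRing}.

(** Left-endpoint Riemann sums with equal steps. Being finite, they commute with the calculus by
    linearity alone, which spares a Fubini theorem for operator-valued integrals. *)
Fixpoint rsum (H : R -> V) (d h : R) (n : nat) : V :=
  match n with
  | O => zero
  | S k => plus (rsum H d h k) (RtoC h *: H (d + INR k * h))
  end.

Lemma rsum_near (H : R -> V) (d h e : R) (n : nat) : 0 <= h ->
  (forall p q, d <= p -> p <= q -> q <= d + INR n * h -> is_Int H p q (CInt H p q)) ->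
  (forall p q, d <= p -> p <= q -> q <= d + INR n * h -> q - p <= h -> norm (minus (H q) (H p)) <= e) ->
  norm (minus (CInt H d (d + INR n * h)) (rsum H d h n)) <= INR n * h * e.
Proof.
intros Hh Hint Hunif.
assert (K : forall k, (k <= n)%nat ->
  norm (minus (CInt H d (d + INR k * h)) (rsum H d h k)) <= INR k * h * e).
{ induction k as [|k IH]; intros Hk.
  - simpl; replace (d + 0 * h) with d by ring.
    rewrite (Int_eq H d d zero (is_Int_point H d)).
    norm_rewrite V (zero : V); rewrite norm_0; lra.
  - specialize (IH ltac:(lia)).
    assert (Hkn : INR k + 1 <= INR n) by (rewrite <- S_INR; now apply le_INR).
    pose proof (pos_INR k) as Hk0.
    rewrite S_INR.
    assert (Hkn' : (INR k + 1) * h <= INR n * h) by (apply Rmult_le_compat_r; lra).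
    assert (Hkh : 0 <= INR k * h) by (apply Rmult_le_pos; lra).
    set (p := d + INR k * h) in *.
    replace (d + (INR k + 1) * h) with (p + h) by (unfold p; ring).
    assert (I1 := Hint d p ltac:(lra) ltac:(unfold p; lra) ltac:(unfold p; lra)).
    assert (I2 := Hint p (p + h) ltac:(unfold p; lra) ltac:(lra) ltac:(unfold p; lra)).
    rewrite (Int_eq H d (p + h) _ (is_Int_Chasles _ _ _ _ _ _ I1 I2)); cbn [rsum]; fold p.
    assert (J : norm (minus (CInt H p (p + h)) (RtoC h *: H p)) <= h * e).
    { assert (I3 := is_Int_minus _ _ _ _ _ _ I2 (is_Int_const (H p) p (p + h))).
      replace (p + h - p) with h in I3 by ring.
      replace (h * e) with ((p + h - p) * e) by ring.
      apply (norm_is_Int_le _ p (p + h) _ e ltac:(lra)) with (2 := I3).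
      intros t Ht; apply Hunif; unfold p in *; lra. }
    norm_rewrite V (plus (minus (CInt H d p) (rsum H d h k)) (minus (CInt H p (p + h)) (RtoC h *: H p))).
    replace ((INR k + 1) * h * e) with (INR k * h * e + h * e) by ring.
    apply norm_plus_le; assumption. }
now apply K.
Qed.

End RiemannSums.

Lemma rcont_uniform {V : NormedModule C_AbsRing} (f : R -> V) (a b : R) :
  (forall t, a <= t <= b -> rcont f t) -> forall e, 0 < e ->
  exists d, 0 < d /\ forall p q, a <= p <= b -> a <= q <= b -> Rabs (q - p) < d ->
    norm (minus (f q) (f p)) < e.
Proof.
intros Hf e He.
destruct (unifcont_normed_1d (V := V) f a b (fun x Hx => rcont_continuous f x (Hf x Hx)) (mkposreal e He)) as [d Hd].
exists d; split; [apply cond_pos|]; intros p q Hp Hq Hpq.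
exact (Hd p q Hp Hq Hpq).
Qed.

(** The factored form exhibits the zero at z = 0 and the decay of order 1/|z| at infinity. *)
Lemma kern_product (w z : C) : w <> RtoC 0 -> z <> w -> z <> RtoC (-1) ->
  kern w z = (z * (w + 1) * (/ w * (/ (z + 1) * / (z - w))))%C.
Proof.
intros H1 H2 H3; unfold kern; field.
assert (H4 : (z + 1)%C <> RtoC 0).
{ intros E; apply H3; replace z with ((z + 1) - 1)%C by ring; rewrite E, RtoC_m1; ring. }
assert (H5 := Csub_neq_0 _ _ H2).
repeat split; assumption.
Qed.

(** The decay condition of [H0_sector] with exponent s = 1. Fixing the exponent makes closure under
    sums a mere addition of constants. *)
Definition sector_decay (th : R) (f : C -> C) : Prop :=
  (forall z, sector th z -> cdiffable (V := C_NormedModule) f z) /\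
  exists c, 0 <= c /\ forall z, sector th z -> Cmod (f z) <= c * (Cmod z / (1 + Cmod z ^ 2)).

Lemma sector_decay_H0 (th : R) (f : C -> C) : sector_decay th f -> H0_sector th f.
Proof.
intros [Hd [c [Hc Hf]]]; split; [|split].
- intros z Hz; apply cdiffable_ex_derive, Hd, Hz.
- exists c; intros z Hz; eapply Rle_trans; [now apply Hf|].
  rewrite <- (Rmult_1_r c) at 2; apply Rmult_le_compat_l; [assumption|].
  pose proof (Cmod_ge_0 z); apply Rmult_le_reg_r with (1 + Cmod z ^ 2); [nra|].
  unfold Rdiv; rewrite Rmult_assoc, Rinv_l by nra; nra.
- exists 1, (c + 1); split; [lra|split; [lra|]]; intros z Hz.
  assert (Hp : 0 < Cmod z) by (apply Cmod_gt_0, Hz).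
  rewrite Rpower_1 by assumption.
  replace (Rpower (Cmod z) (2 * 1)) with (Cmod z ^ 2).
  2: { rewrite <- (Rpower_pow 2) by assumption; f_equal; simpl; ring. }
  eapply Rle_trans; [now apply Hf|].
  apply Rmult_le_compat_r; [|lra]; apply Rdiv_le_0_compat; nra.
Qed.

Lemma sector_decay_plus (th : R) (f g : C -> C) :
  sector_decay th f -> sector_decay th g -> sector_decay th (fun z => f z + g z)%C.
Proof.
intros [Hf [c [Hc Hf']]] [Hg [c' [Hc' Hg']]]; split.
- intros z Hz; apply (cdiffable_plus (V := C_NormedModule)); auto.
- exists (c + c'); split; [lra|]; intros z Hz.
  eapply Rle_trans; [apply Cmod_triangle|]; rewrite Rmult_plus_distr_r; apply Rplus_le_compat; auto.
Qed.

Lemma sector_decay_scal (th : R) (k : C) (f : C -> C) :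
  sector_decay th f -> sector_decay th (fun z => k * f z)%C.
Proof.
intros [Hf [c [Hc Hf']]]; split.
- intros z Hz; apply (cdiffable_scal (V := C_NormedModule) (fun _ => k) f); auto.
  apply (cdiffable_const (V := C_NormedModule)).
- exists (Cmod k * c); pose proof (Cmod_ge_0 k); split; [now apply Rmult_le_pos|]; intros z Hz.
  rewrite Cmod_mult, Rmult_assoc; apply Rmult_le_compat_l; auto.
Qed.

Lemma sector_decay_zero (th : R) : sector_decay th (fun _ => RtoC 0).
Proof.
split.
- intros z _; apply (cdiffable_const (V := C_NormedModule)).
- exists 0; split; [lra|]; intros z _; rewrite Cmod_0; lra.
Qed.

Lemma sector_decay_kern (th y : R) (w : C) : 0 < th < PI / 2 -> 0 <= y < cos th ->
  w <> RtoC 0 -> Re w <= y * Cmod w -> sector_decay th (kern w).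
Proof.
intros Hth Hy Hw0 Hw.
pose proof PI_RGT_0 as HPI; pose proof (COS_bound th) as Hcos.
assert (Hwp : 0 < Cmod w) by now apply Cmod_gt_0.
assert (Hreg : forall z, sector th z -> 0 < Cmod z /\ 0 <= Re z /\
   (cos th - y) / 2 * Cmod z <= Cmod (z - w)%C /\ (cos th - y) / 4 * Cmod w <= Cmod (z - w)%C).
{ intros z Hz; assert (Hz' := proj1 (sector_iff th z ltac:(lra)) Hz).
  pose proof (Cmod_ge_0 z) as Hz0.
  split; [apply Cmod_gt_0, Hz|split; [nra|]].
  apply (cone_separation z w (cos th) y); lra. }
assert (Hne : forall z, sector th z -> z <> w /\ z <> RtoC (-1)).
{ intros z Hz; destruct (Hreg z Hz) as (H1 & H2 & H3 & H4); split; intros E.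
  - rewrite E in H4; replace (w - w)%C with (RtoC 0) in H4 by ring; rewrite Cmod_0 in H4; nra.
  - rewrite E in H2; unfold Re in H2; simpl in H2; lra. }
split.
- intros z Hz; destruct (Hne z Hz) as [N1 N2]; unfold kern.
  apply (cdiffable_plus (V := C_NormedModule)); [now apply cdiffable_Cinv_sub|].
  apply (cdiffable_scal (V := C_NormedModule) (fun _ => / w)%C (fun z => / (z + 1))%C).
  + apply (cdiffable_const (V := C_NormedModule)).
  + apply (cdiffable_ext (V := C_NormedModule) (fun z => / (z - RtoC (-1)))%C).
    * intros z'; change (/ (z' - RtoC (-1)) = / (z' + 1))%C; rewrite RtoC_m1; f_equal; ring.
    * now apply cdiffable_Cinv_sub.
- set (k := (cos th - y) / 4).
  assert (Hk : 0 < k) by (unfold k; lra).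
  set (k2 := Rmin (k * Cmod w) k / 2).
  assert (Hk2 : 0 < k2) by (unfold k2; assert (0 < Rmin (k * Cmod w) k) by (apply Rmin_glb_lt; nra); lra).
  exists (Cmod (w + 1)%C * (/ Cmod w * / k2)).
  assert (Hi : 0 < / Cmod w) by now apply Rinv_0_lt_compat.
  assert (Hi2 : 0 < / k2) by now apply Rinv_0_lt_compat.
  split; [apply Rmult_le_pos; [apply Cmod_ge_0|apply Rmult_le_pos; lra]|].
  intros z Hz; destruct (Hne z Hz) as [N1 N2]; destruct (Hreg z Hz) as (H1 & H2 & H3 & H4).
  rewrite kern_product, !Cmod_mult by assumption.
  set (s := Cmod z) in *; set (m := Cmod (z - w)%C) in *; set (n := Cmod (z + 1)%C).
  assert (L1 : 1 <= n) by now apply Cmod_plus_1.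
  assert (L2 : s <= n).
  { unfold s, n; apply Rsqr_incr_0; try apply Cmod_ge_0.
    rewrite !Rsqr_pow2, <- !Re_sq_Im_sq; unfold Re, Im in *; simpl; nra. }
  assert (Hkw : k2 <= k * Cmod w / 2) by (unfold k2; pose proof (Rmin_l (k * Cmod w) k); lra).
  assert (Hkk : k2 <= k / 2) by (unfold k2; pose proof (Rmin_r (k * Cmod w) k); lra).
  (* For s <= 1 use n >= 1 and m >= k |w|; for s > 1 use n >= s and m >= k s. This is why [k2] is
     half the minimum of k |w| and k. *)
  assert (L3 : k2 * (1 + s ^ 2) <= n * m).
  { assert (Hm : 0 < m) by (fold k in H4; nra).
    destruct (Rle_lt_dec s 1) as [Hs|Hs].
    - assert (s ^ 2 <= 1) by (simpl; nra).
      apply Rle_trans with (k * Cmod w); [nra|]; fold k in H4.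
      assert (1 * m <= n * m) by (apply Rmult_le_compat_r; lra); lra.
    - apply Rle_trans with (s * (k * s)).
      + assert (1 <= s ^ 2) by (simpl; nra).
        apply Rle_trans with (k / 2 * (2 * s ^ 2)); [|right; field].
        apply Rmult_le_compat; lra.
      + apply Rmult_le_compat; try nra; unfold k in *; lra. }
  assert (Hnm : 0 < n * m) by (eapply Rlt_le_trans; [|exact L3]; nra).
  assert (Hmp : 0 < m) by (fold k in H4; nra).
  rewrite !Cmod_inv by (first [assumption | apply (Cmod_ge_neq_0 _ n); [lra|apply Rle_refl] | apply (Cmod_ge_neq_0 _ m); [lra|apply Rle_refl]]).
  fold n m.
  replace (s * Cmod (w + 1)%C * (/ Cmod w * (/ n * / m))) with (Cmod (w + 1)%C * / Cmod w * s * / (n * m)) by (field; lra).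
  replace (Cmod (w + 1)%C * (/ Cmod w * / k2) * (s / (1 + s ^ 2)))
    with (Cmod (w + 1)%C * / Cmod w * s * / (k2 * (1 + s ^ 2))) by (field; repeat split; nra).
  apply Rmult_le_compat_l.
  + pose proof (Cmod_ge_0 (w + 1)%C); repeat apply Rmult_le_pos; lra.
  + apply Rinv_le_contravar; [nra|assumption].
Qed.

Lemma is_RInt_gen_linear {V W : NormedModule C_AbsRing} (Fa Fb : (R -> Prop) -> Prop)
    (FFa : Filter Fa) (FFb : Filter Fb) (l : V -> W) (f : R -> V) (I : V) : is_linear l ->
  is_RInt_gen (V := real_module V) f Fa Fb I ->
  is_RInt_gen (V := real_module W) (fun t => l (f t)) Fa Fb (l I).
Proof.
intros Hl H; apply filterlimi_locally; intros e.
destruct (proj1 (filterlim_locally l (l I)) (linear_cont l I Hl) e) as [d Hd].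
eapply filter_imp; [|exact (proj1 (filterlimi_locally _ _) H d)].
intros ab [z [Hz1 Hz2]]; exists (l z); split.
- exact (is_Int_linear l f _ _ z Hl Hz1).
- apply Hd; exact Hz2.
Qed.

Lemma Re_cis (u : R) : Re (cis u) = cos u.
Proof. reflexivity. Qed.

(** * Transfer to operators *)

Section OperatorBound.

Variable B : banach_algebra.
Variable a : B.
Variable r : C -> B.
Hypothesis Hr : forall z s, ba_resolvent z a s -> ba_resolvent z a (r z).
Variables th nu M K : R.
Hypothesis Hth : 0 < th < PI / 2.
Hypothesis Hnu : 0 < nu < th.
Hypothesis Hres : forall z, z <> RtoC 0 -> Re z <= cos nu * Cmod z ->
  ba_resolvent z a (r z) /\ Cmod z * norm (r z) <= M.
Hypothesis HK : 0 <= K.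

Notation sector_ray f u := (ray_form B (fun z => f z *: r z) (RtoC 0) (RtoC 1) u).
Notation is_ray_integral f u l :=
  (is_RInt_gen (V := real_module B) (sector_ray f u) (at_right 0) (Rbar_locally p_infty) l).

Hypothesis Hcal : forall f, H0_sector th f -> exists l u : B,
  is_ray_integral f (- nu) l /\ is_ray_integral f nu u /\
  norm (minus l u) <= K * sup_norm_on (sector th) f.

(** k is f(A): l and u run outward on the lower and the upper ray, and l - u is the counterclockwise
    contour integral. [Hcal] bounds some convergent integrals without naming their value; this
    relation supplies the name. *)
Definition attained (f : C -> C) (k : B) : Prop :=
  sector_decay th f /\ exists l u : B,
  is_ray_integral f (- nu) l /\ is_ray_integral f nu u /\ minus l u = (2 * RtoC PI * Ci)%C *: k.

Lemma attained_norm (f : C -> C) (k : B) : attained f k -> norm k <= K * sup_norm_on (sector th) f.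
Proof.
intros [Hf (l & u & Hl & Hu & E)].
destruct (Hcal f (sector_decay_H0 th f Hf)) as (l' & u' & Hl' & Hu' & Hn).
rewrite <- (is_RInt_gen_eq (ba_complete B) _ _ _ _ _ _ _ Hl Hl') in Hn.
rewrite <- (is_RInt_gen_eq (ba_complete B) _ _ _ _ _ _ _ Hu Hu') in Hn.
rewrite E, norm_Cscal_eq, !Cmod_mult, Cmod_Ci, !Cmod_R, !Rabs_pos_eq in Hn by (pose proof PI_RGT_0; lra).
(* The factor 2 pi on the left is at least 1 and is dropped. *)
pose proof PI2_1; pose proof (norm_ge_0 k); nra.
Qed.

Lemma attained_plus f g k l : attained f k -> attained g l -> attained (fun z => f z + g z)%C (plus k l).
Proof.
intros [Hf (lf & uf & Hlf & Huf & Ef)] [Hg (lg & ug & Hlg & Hug & Eg)].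
assert (Hray : forall u, sector_ray (fun z => (f z + g z)%C) u = fun t => plus (sector_ray f u t) (sector_ray g u t)).
{ intros u; apply functional_extensionality; intros t; unfold ray_form; module B. }
split; [now apply sector_decay_plus|]; exists (plus lf lg), (plus uf ug); split; [|split].
- rewrite Hray; apply (is_RInt_gen_plus (V := real_module B) _ _ _ _ Hlf Hlg).
- rewrite Hray; apply (is_RInt_gen_plus (V := real_module B) _ _ _ _ Huf Hug).
- transitivity (plus (minus lf uf) (minus lg ug)); [module B|]; rewrite Ef, Eg; module B.
Qed.

Lemma attained_scal (c : C) f k : attained f k -> attained (fun z => c * f z)%C (c *: k).
Proof.
intros [Hf (lf & uf & Hlf & Huf & Ef)].
assert (Hray : forall u, sector_ray (fun z => (c * f z)%C) u = fun t => c *: sector_ray f u t).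
{ intros u; apply functional_extensionality; intros t; unfold ray_form; module B. }
assert (Hlin : is_linear (fun v : B => c *: v)) by apply (is_linear_scal_r (V := B) (c : C_AbsRing) Cmult_comm).
split; [now apply sector_decay_scal|]; exists (c *: lf), (c *: uf); split; [|split].
- rewrite Hray; apply (is_RInt_gen_linear (V := B) (W := B) _ _ _ _ _ _ _ Hlin Hlf).
- rewrite Hray; apply (is_RInt_gen_linear (V := B) (W := B) _ _ _ _ _ _ _ Hlin Huf).
- transitivity (c *: minus lf uf); [module B|]; rewrite Ef; module B.
Qed.

Lemma attained_kern (y : R) (w : C) : 0 <= y < cos th -> w <> RtoC 0 -> Re w <= y * Cmod w ->
  attained (kern w) (kern_op B r w).
Proof.
intros Hy Hw0 Hw.
assert (Hd := sector_decay_kern th y w Hth Hy Hw0 Hw).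
split; [exact Hd|].
destruct (Hcal _ (sector_decay_H0 th _ Hd)) as (l & u & Hl & Hu & _).
exists l, u; split; [exact Hl|split; [exact Hu|]].
assert (Hwp : 0 < Cmod w) by now apply Cmod_gt_0.
pose proof PI_RGT_0.
assert (cos th < cos nu) by (apply cos_decreasing_1; lra).
apply (sector_integral_kern B a r Hr nu M ltac:(lra) Hres w); [nra|exact Hl|exact Hu].
Qed.

Lemma attained_rsum (F : C -> R -> C) (H : R -> B) (d h : R) (n : nat) :
  (forall k, (k < n)%nat -> attained (fun z => F z (d + INR k * h)) (H (d + INR k * h))) ->
  attained (fun z => rsum (V := C_NormedModule) (F z) d h n) (rsum H d h n).
Proof.
induction n as [|n IH]; intros Hk.
(* The empty sum requires convergent integrals of the zero function. They are obtained as 0 times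
   those of [kern] at w = -1, and a second multiplication by 0 identifies their value. *)
- split; [apply sector_decay_zero|]; cbn [rsum]; exists (zero : B), (zero : B).
  assert (Hray : forall u, sector_ray (fun _ => RtoC 0) u = fun t => RtoC 0 *: sector_ray (kern (RtoC (-1))) u t).
  { intros u; apply functional_extensionality; intros t; unfold ray_form; module B. }
  assert (Hm1 : attained (kern (RtoC (-1))) (kern_op B r (RtoC (-1)))).
  { apply (attained_kern 0).
    - split; [lra|]; apply cos_gt_0; lra.
    - intros E; apply RtoC_inj in E; lra.
    - unfold Re; simpl; lra. }
  destruct (attained_scal (RtoC 0) _ _ Hm1) as [_ (l & u & Hl & Hu & E)].
  assert (Hz : forall u, sector_ray (fun z => RtoC 0 * kern (RtoC (-1)) z)%C u = sector_ray (fun _ => RtoC 0) u).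
  { intros u'; apply functional_extensionality; intros t; unfold ray_form; module B. }
  rewrite Hz in Hl, Hu.
  assert (Hl0 : forall u0 l0, is_ray_integral (fun _ => RtoC 0) u0 l0 -> is_ray_integral (fun _ => RtoC 0) u0 zero).
  { intros u0 l0 H0.
    assert (H1 := is_RInt_gen_linear (V := B) (W := B) _ _ _ _ (fun v : B => RtoC 0 *: v) _ _
                    (is_linear_scal_r (V := B) (RtoC 0 : C_AbsRing) Cmult_comm) H0).
    cbv beta in H1; rewrite scal_C0 in H1.
    replace (sector_ray (fun _ => RtoC 0) u0) with (fun t => RtoC 0 *: sector_ray (fun _ => RtoC 0) u0 t); [exact H1|].
    apply functional_extensionality; intros t; unfold ray_form; module B. }
  split; [exact (Hl0 _ _ Hl)|split; [exact (Hl0 _ _ Hu)|module B]].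
- cbn [rsum].
  apply (attained_plus (fun z => rsum (V := C_NormedModule) (F z) d h n) (fun z => RtoC h * F z (d + INR n * h)%R)%C).
  + apply IH; intros k Hkn; apply Hk; lia.
  + apply (attained_scal (RtoC h) (fun z => F z (d + INR n * h))), Hk; lia.
Qed.

Variables (y b N : R) (c0 c1 : C) (u0 u1 : R) (Phi : C -> C).
Hypothesis Hy : 0 <= y < cos th.
Hypothesis Hb : 0 < b.
Hypothesis Hu : u0 <= u1 <= u0 + 2 * PI.
Hypothesis Hge : forall u, u0 <= u <= u1 -> 1 <= Cmod (circ c0 c1 u).
Hypothesis Hend : forall u, u = u0 \/ u = u1 ->
  Cmod (circ c0 c1 u) = 1 /\ Re (circ c0 c1 u) <= y.
Hypothesis HPhi : forall s u, 0 < s <= b -> u0 <= u <= u1 ->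
  cdiffable (V := C_NormedModule) Phi (RtoC s * circ c0 c1 u)%C /\
  Cmod (Phi (RtoC s * circ c0 c1 u)%C) <= N.

(** The integrands on the two edges at the same distance t, subtracted so that their logarithmic
    parts cancel. *)
Let jump {V : NormedModule C_AbsRing} (H : C -> V) (t : R) : V :=
  minus (ray_form V H c0 c1 u0 t) (ray_form V H c0 c1 u1 t).

Let pt (s u : R) : C := (RtoC s * circ c0 c1 u)%C.

Lemma pt_end s u : 0 < s -> u = u0 \/ u = u1 ->
  Cmod (pt s u) = s /\ pt s u <> RtoC 0 /\ Re (pt s u) <= y * Cmod (pt s u).
Proof.
intros Hs Hu'.
assert (E := Cmod_pt_end y c0 c1 u0 u1 Hend s u Hs Hu'); fold (pt s u) in E.
split; [exact E|split].
- apply (Cmod_ge_neq_0 _ s); [assumption|right; symmetry; exact E].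
- apply (Re_pt_end y c0 c1 u0 u1 Hend s u Hs Hu').
Qed.

Lemma cdiffable_r z : z <> RtoC 0 -> Re z <= y * Cmod z -> cdiffable r z.
Proof.
intros Hz H; apply (cdiffable_resolvent B a r Hr), Hres; [assumption|].
pose proof (Cmod_ge_0 z); pose proof PI_RGT_0.
assert (cos th < cos nu) by (apply cos_decreasing_1; lra).
apply Rle_trans with (1 := H), Rmult_le_compat_r; lra.
Qed.

Lemma rcont_jump {V : NormedModule C_AbsRing} (H : C -> V) t :
  (forall u, u = u0 \/ u = u1 -> cdiffable H (pt t u)) -> rcont (jump H) t.
Proof. intros Hd; apply rcont_minus; apply rcont_ray_form, Hd; auto. Qed.

Lemma CInt_jump {V : NormedModule C_AbsRing} (CV : norm_complete V) (H : C -> V) p q : p <= q ->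
  (forall t u, p <= t <= q -> u = u0 \/ u = u1 -> cdiffable H (pt t u)) ->
  CInt (jump H) p q = minus (CInt (ray_form V H c0 c1 u0) p q) (CInt (ray_form V H c0 c1 u1) p q).
Proof.
intros Hpq Hd; apply Int_eq, is_Int_minus; (apply ex_Int; [exact CV|assumption|]);
  intros t Ht; apply rcont_ray_form, Hd; auto.
Qed.

Lemma cdiffable_Phi t u : 0 < t <= b -> u = u0 \/ u = u1 -> cdiffable (V := C_NormedModule) Phi (pt t u).
Proof. intros Ht Hu'; apply HPhi; [assumption|destruct Hu'; lra]. Qed.

Lemma cdiffable_kern_left (z w : C) : w <> RtoC 0 -> z <> w ->
  cdiffable (V := C_NormedModule) (fun v => kern v z) w.
Proof.
intros H1 H2; unfold kern; apply (cdiffable_plus (V := C_NormedModule)).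
- now apply cdiffable_Cinv_rsub.
- apply (cdiffable_scal (V := C_NormedModule) (fun v => / v)%C); [now apply cdiffable_Cinv|].
  apply (cdiffable_const (V := C_NormedModule)).
Qed.

Lemma cdiffable_kern_op (w : C) : w <> RtoC 0 -> Re w <= y * Cmod w -> cdiffable (kern_op B r) w.
Proof.
intros H1 H2; unfold kern_op.
apply (cdiffable_linear (fun v : B => opp v)); [apply is_linear_opp|].
apply cdiffable_plus; [now apply cdiffable_r|].
apply (cdiffable_scal (fun v => / v)%C); [now apply cdiffable_Cinv|apply cdiffable_const].
Qed.

Let kap : R := (cos th - y) / 4.

Lemma kap_pos : 0 < kap.
Proof. unfold kap; lra. Qed.

Lemma sector_sep z t u : sector th z -> 0 < t -> u = u0 \/ u = u1 -> kap * t <= Cmod (z - pt t u)%C.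
Proof.
intros Hz Ht Hu'; pose proof PI_RGT_0; pose proof (COS_bound th).
assert (Hz' := proj1 (sector_iff th z ltac:(lra)) Hz).
destruct (pt_end t u Ht Hu') as (E1 & E2 & E3).
destruct (cone_separation z (pt t u) (cos th) y ltac:(lra) ltac:(lra) ltac:(lra) ltac:(lra) E3) as [_ H1].
rewrite E1 in H1; exact H1.
Qed.

Lemma sector_Re_nonneg z : sector th z -> 0 <= Re z.
Proof.
intros Hz; pose proof PI_RGT_0.
assert (Hz' := proj1 (sector_iff th z ltac:(lra)) Hz).
pose proof (Cmod_ge_0 z); nra.
Qed.

Lemma sector_neq z t u : sector th z -> 0 < t -> u = u0 \/ u = u1 -> z <> pt t u.
Proof.
intros Hz Ht Hu' E; assert (H := sector_sep z t u Hz Ht Hu'); pose proof kap_pos.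
rewrite <- E in H; replace (z - z)%C with (RtoC 0) in H by ring; rewrite Cmod_0 in H; nra.
Qed.

Lemma kern_bound z d t u : sector th z -> 0 < d <= t -> u = u0 \/ u = u1 ->
  Cmod (kern (pt t u) z) <= / (kap * d) + / d.
Proof.
intros Hz Ht Hu'; pose proof kap_pos.
destruct (pt_end t u ltac:(lra) Hu') as (E1 & E2 & E3).
assert (S := sector_sep z t u Hz ltac:(lra) Hu').
unfold kern; eapply Rle_trans; [apply Cmod_triangle|]; rewrite Cmod_mult.
apply Rplus_le_compat.
- apply Cmod_Cinv_le; nra.
- rewrite <- (Rmult_1_r (/ d)); apply Rmult_le_compat; try apply Cmod_ge_0.
  + apply Cmod_Cinv_le; lra.
  + apply Cmod_Cinv_le_1, Cmod_plus_1, sector_Re_nonneg, Hz.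
Qed.

(** Differences of inverses; the separation [sector_sep] makes the constant independent of z, as a
    mesh common to all z requires. *)
Lemma kern_lipschitz z d t t' u : sector th z -> 0 < d <= t -> d <= t' -> u = u0 \/ u = u1 ->
  Cmod (kern (pt t u) z - kern (pt t' u) z)%C <=
    (/ (kap * d) * / (kap * d) + / d * / d) * Rabs (t - t').
Proof.
intros Hz Ht Ht' Hu'; pose proof kap_pos as Hk.
destruct (pt_end t u ltac:(lra) Hu') as (E1 & E2 & E3).
destruct (pt_end t' u ltac:(lra) Hu') as (E1' & E2' & E3').
assert (S := sector_sep z t u Hz ltac:(lra) Hu').
assert (S' := sector_sep z t' u Hz ltac:(lra) Hu').
assert (N1 := Csub_neq_0 _ _ (sector_neq z t u Hz ltac:(lra) Hu')).
assert (N2 := Csub_neq_0 _ _ (sector_neq z t' u Hz ltac:(lra) Hu')).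
assert (L1 := Cmod_plus_1 z (sector_Re_nonneg z Hz)).
assert (N3 : (z + 1)%C <> RtoC 0) by (apply (Cmod_ge_neq_0 _ 1); lra).
assert (ED : Cmod (pt t u - pt t' u)%C = Rabs (t - t')).
{ unfold pt; replace (RtoC t * circ c0 c1 u - RtoC t' * circ c0 c1 u)%C with (RtoC (t - t') * circ c0 c1 u)%C
    by (rewrite RtoC_minus; ring).
  rewrite Cmod_mult, Cmod_R, (proj1 (Hend u Hu')); ring. }
replace (kern (pt t u) z - kern (pt t' u) z)%C with
  ((/ (z - pt t u) * / (z - pt t' u)) * (pt t u - pt t' u)
    + (/ pt t u * / pt t' u) * (pt t' u - pt t u) * / (z + 1))%C
  by (unfold kern; field; repeat split; assumption).
replace (pt t' u - pt t u)%C with (- (pt t u - pt t' u))%C by ring.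
eapply Rle_trans; [apply Cmod_triangle|].
rewrite !Cmod_mult, Cmod_opp, ED, Rmult_plus_distr_r.
assert (P := Rabs_pos (t - t')).
assert (I1 : Cmod (/ (z - pt t u))%C <= / (kap * d)) by (apply Cmod_Cinv_le; nra).
assert (I2 : Cmod (/ (z - pt t' u))%C <= / (kap * d)) by (apply Cmod_Cinv_le; nra).
assert (I3 : Cmod (/ pt t u)%C <= / d) by (apply Cmod_Cinv_le; lra).
assert (I4 : Cmod (/ pt t' u)%C <= / d) by (apply Cmod_Cinv_le; lra).
assert (I5 : Cmod (/ (z + 1))%C <= 1) by now apply Cmod_Cinv_le_1.
pose proof (Cmod_ge_0 (/ (z - pt t u))%C); pose proof (Cmod_ge_0 (/ (z - pt t' u))%C).
pose proof (Cmod_ge_0 (/ pt t u)%C); pose proof (Cmod_ge_0 (/ pt t' u)%C); pose proof (Cmod_ge_0 (/ (z + 1))%C).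
apply Rplus_le_compat.
- apply Rmult_le_compat_r; [assumption|]; apply Rmult_le_compat; assumption.
- rewrite <- (Rmult_1_r (/ d * / d * Rabs (t - t'))).
  apply Rmult_le_compat; try assumption.
  + apply Rmult_le_pos; [apply Rmult_le_pos|]; assumption.
  + apply Rmult_le_compat_r; [assumption|]; apply Rmult_le_compat; assumption.
Qed.

(** For fixed t, [fz] as a function of z is a combination of two kernels, and [op t] is its value at
    A. *)
Let fz (z : C) (t : R) : C := jump (V := C_NormedModule) (fun w => Phi w * kern w z)%C t.
Let op (t : R) : B := jump (fun w => Phi w *: kern_op B r w) t.

(** [Phi] varies uniformly on the compact range [d,b], independently of z, and the kernel by
    [kern_lipschitz]. Each source gets e/4 on each of the two rays. *)
Lemma fz_uniform (d : R) : 0 < d <= b -> forall e, 0 < e -> exists dl, 0 < dl /\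
  forall z p q, sector th z -> d <= p <= b -> d <= q <= b -> Rabs (q - p) < dl ->
    Cmod (fz z q - fz z p)%C <= e.
Proof.
intros Hd e He.
pose proof kap_pos as Hk.
assert (HN : 0 <= N) by exact (N_nonneg b N c0 c1 u0 u1 Phi Hb Hu HPhi).
set (k1 := / (kap * d) + / d); set (k2 := / (kap * d) * / (kap * d) + / d * / d).
assert (Hkd : 0 < / (kap * d)) by (apply Rinv_0_lt_compat, Rmult_lt_0_compat; lra).
assert (Hd' : 0 < / d) by (apply Rinv_0_lt_compat; lra).
assert (Hk1 : 0 < k1) by (unfold k1; lra).
assert (Hk2 : 0 < k2) by (unfold k2; nra).
assert (He1 : 0 < e / 4 / k1) by (apply Rdiv_lt_0_compat; lra).
assert (Hc : forall u, u = u0 \/ u = u1 -> exists dl, 0 < dl /\ forall p q, d <= p <= b -> d <= q <= b ->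
  Rabs (q - p) < dl -> Cmod (Phi (pt q u) - Phi (pt p u))%C < e / 4 / k1).
{ intros u Hu'.
  apply (rcont_uniform (V := C_NormedModule) (fun t => Phi (pt t u)) d b); [|exact He1].
  intros t Ht; apply (rcont_cdiffable (V := C_NormedModule) Phi (fun t => pt t u)).
  - apply cdiffable_Phi; [lra|assumption].
  - eapply rdiff_rcont, rdiff_ray. }
destruct (Hc u0 ltac:(auto)) as [dl0 [Hdl0 H0]]; destruct (Hc u1 ltac:(auto)) as [dl1 [Hdl1 H1]].
assert (Hq2 : 0 < e / 4 / (N * k2 + 1)) by (apply Rdiv_lt_0_compat; nra).
exists (Rmin (Rmin dl0 dl1) (e / 4 / (N * k2 + 1))); split; [repeat apply Rmin_glb_lt; assumption|].
intros z p q Hz Hp Hq Hpq.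
assert (D01 := Rlt_le_trans _ _ _ Hpq (Rmin_l _ _)); assert (D2 := Rlt_le_trans _ _ _ Hpq (Rmin_r _ _)).
assert (D0 := Rlt_le_trans _ _ _ D01 (Rmin_l _ _)); assert (D1 := Rlt_le_trans _ _ _ D01 (Rmin_r _ _)).
assert (Hone : forall u, u = u0 \/ u = u1 -> Cmod (Phi (pt q u) - Phi (pt p u))%C < e / 4 / k1 ->
  Cmod (circ c0 c1 u * (Phi (pt q u) * kern (pt q u) z) - circ c0 c1 u * (Phi (pt p u) * kern (pt p u) z))%C <= e / 2).
{ intros u Hu' HP.
  replace (circ c0 c1 u * (Phi (pt q u) * kern (pt q u) z) - circ c0 c1 u * (Phi (pt p u) * kern (pt p u) z))%C
    with (circ c0 c1 u * ((Phi (pt q u) - Phi (pt p u)) * kern (pt q u) z + Phi (pt p u) * (kern (pt q u) z - kern (pt p u) z)))%C by ring.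
  rewrite Cmod_mult, (proj1 (Hend u Hu')), Rmult_1_l.
  eapply Rle_trans; [apply Cmod_triangle|]; rewrite !Cmod_mult.
  assert (B1 := kern_bound z d q u Hz ltac:(lra) Hu'); fold k1 in B1.
  assert (B2 := kern_lipschitz z d q p u Hz ltac:(lra) ltac:(lra) Hu'); fold k2 in B2.
  assert (B3 : Cmod (Phi (pt p u)) <= N) by (apply HPhi; [lra|destruct Hu'; lra]).
  assert (K1 : Cmod (Phi (pt q u) - Phi (pt p u))%C * Cmod (kern (pt q u) z) <= e / 4 / k1 * k1).
  { apply Rmult_le_compat; try apply Cmod_ge_0; lra. }
  assert (K2 : Cmod (Phi (pt p u)) * Cmod (kern (pt q u) z - kern (pt p u) z)%C <= N * (k2 * Rabs (q - p))).
  { apply Rmult_le_compat; try apply Cmod_ge_0; assumption. }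
  replace (e / 4 / k1 * k1) with (e / 4) in K1 by (field; lra).
  assert (K3 : N * (k2 * Rabs (q - p)) <= (N * k2 + 1) * (e / 4 / (N * k2 + 1))).
  { assert (0 <= N * k2) by (apply Rmult_le_pos; lra).
    rewrite <- Rmult_assoc; apply Rmult_le_compat; try lra; apply Rabs_pos. }
  replace ((N * k2 + 1) * (e / 4 / (N * k2 + 1))) with (e / 4) in K3 by (field; nra).
  lra. }
assert (A0 := Hone u0 ltac:(auto) (H0 p q Hp Hq D0)).
assert (A1 := Hone u1 ltac:(auto) (H1 p q Hp Hq D1)).
change (fz z q) with (circ c0 c1 u0 * (Phi (pt q u0) * kern (pt q u0) z) - circ c0 c1 u1 * (Phi (pt q u1) * kern (pt q u1) z))%C.
change (fz z p) with (circ c0 c1 u0 * (Phi (pt p u0) * kern (pt p u0) z) - circ c0 c1 u1 * (Phi (pt p u1) * kern (pt p u1) z))%C.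
set (a0 := (circ c0 c1 u0 * (Phi (pt q u0) * kern (pt q u0) z))%C) in *.
set (a1 := (circ c0 c1 u0 * (Phi (pt p u0) * kern (pt p u0) z))%C) in *.
set (b0 := (circ c0 c1 u1 * (Phi (pt q u1) * kern (pt q u1) z))%C) in *.
set (b1 := (circ c0 c1 u1 * (Phi (pt p u1) * kern (pt p u1) z))%C) in *.
replace (a0 - b0 - (a1 - b1))%C with ((a0 - a1) + - (b0 - b1))%C by ring.
eapply Rle_trans; [apply Cmod_triangle|]; rewrite Cmod_opp; lra.
Qed.

Lemma cdiffable_fz z t u : sector th z -> 0 < t <= b -> u = u0 \/ u = u1 ->
  cdiffable (V := C_NormedModule) (fun w => Phi w * kern w z)%C (pt t u).
Proof.
intros Hz Ht Hu'; apply (cdiffable_scal (V := C_NormedModule) Phi); [now apply cdiffable_Phi|].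
apply cdiffable_kern_left; [apply pt_end; [lra|assumption]|apply sector_neq; auto; lra].
Qed.

Lemma cdiffable_op t u : 0 < t <= b -> u = u0 \/ u = u1 ->
  cdiffable (fun w => Phi w *: kern_op B r w) (pt t u).
Proof.
intros Ht Hu'; apply cdiffable_scal; [now apply cdiffable_Phi|].
destruct (pt_end t u ltac:(lra) Hu') as (E1 & E2 & E3); now apply cdiffable_kern_op.
Qed.

Let Cs : R := (8 * PI * Cmod c1 + 8 / (cos th - y)) * N + 4 * PI * Cmod c1 * N.

(** The two terms of [kern] lead to [int_cauchy_bound] and to 1/(z+1) times [int_inv_bound]; on the
    sector |z+1| >= 1. *)
Lemma int_fz_bound z d : sector th z -> 0 < d <= b -> Cmod (CInt (fz z) d b) <= Cs.
Proof.
intros Hz Hd; pose proof PI_RGT_0; pose proof (COS_bound th) as Hcb.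
assert (Hz' := proj1 (sector_iff th z ltac:(lra)) Hz).
assert (E1 := int_cauchy_bound (cos th) y b N c0 c1 u0 u1 Phi ltac:(lra) ltac:(lra) ltac:(lra) Hb Hu Hge Hend HPhi z d Hd (proj1 Hz) ltac:(lra)).
assert (E2 := int_inv_bound b N c0 c1 u0 u1 Phi Hb Hu Hge HPhi d Hd).
set (h1 := fun w => (/ (z - w) * Phi w)%C) in *; set (h2 := fun w => (/ w * Phi w)%C) in *.
assert (D1 : forall t u, d <= t <= b -> u = u0 \/ u = u1 -> cdiffable (V := C_NormedModule) h1 (pt t u)).
{ intros t u Ht Hu'; apply (cdiffable_scal (V := C_NormedModule) (fun w => / (z - w))%C); [|apply cdiffable_Phi; auto; lra].
  apply cdiffable_Cinv_rsub, sector_neq; auto; lra. }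
assert (D2 : forall t u, d <= t <= b -> u = u0 \/ u = u1 -> cdiffable (V := C_NormedModule) h2 (pt t u)).
{ intros t u Ht Hu'; apply (cdiffable_scal (V := C_NormedModule) (fun w => / w)%C); [|apply cdiffable_Phi; auto; lra].
  apply cdiffable_Cinv, pt_end; auto; lra. }
assert (J1 := CInt_jump C_norm_complete h1 d b ltac:(lra) D1).
assert (J2 := CInt_jump C_norm_complete h2 d b ltac:(lra) D2).
assert (I1 : is_Int (V := C_NormedModule) (jump h1) d b (CInt (jump h1) d b)).
{ apply ex_Int; [apply C_norm_complete|lra|]; intros t Ht; apply rcont_jump; intros u Hu'; auto. }
assert (I2 : is_Int (V := C_NormedModule) (jump h2) d b (CInt (jump h2) d b)).
{ apply ex_Int; [apply C_norm_complete|lra|]; intros t Ht; apply rcont_jump; intros u Hu'; auto. }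
assert (E : CInt (fz z) d b = (CInt (jump h1) d b + / (z + 1) * CInt (jump h2) d b)%C).
{ apply Int_eq.
  apply is_Int_ext with (fun t => plus (jump (V := C_NormedModule) h1 t) ((/ (z + 1))%C *: jump (V := C_NormedModule) h2 t)); [lra| |].
  - intros t _.
    change (circ c0 c1 u0 * h1 (pt t u0) - circ c0 c1 u1 * h1 (pt t u1)
       + / (z + 1) * (circ c0 c1 u0 * h2 (pt t u0) - circ c0 c1 u1 * h2 (pt t u1))
      = circ c0 c1 u0 * (Phi (pt t u0) * kern (pt t u0) z) - circ c0 c1 u1 * (Phi (pt t u1) * kern (pt t u1) z))%C.
    unfold h1, h2, kern; ring.
  - apply (is_Int_plus (V := C_NormedModule)); [exact I1|].
    apply (is_Int_scal (V := C_NormedModule)); exact I2. }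
rewrite E; eapply Rle_trans; [apply Cmod_triangle|]; rewrite Cmod_mult.
assert (L1 := Cmod_plus_1 z (sector_Re_nonneg z Hz)).
assert (I5 : Cmod (/ (z + 1))%C <= 1) by now apply Cmod_Cinv_le_1.
unfold Cs; apply Rplus_le_compat.
- rewrite J1; exact E1.
- rewrite <- (Rmult_1_l (4 * PI * Cmod c1 * N)).
  apply Rmult_le_compat; try apply Cmod_ge_0; [exact I5|rewrite J2; exact E2].
Qed.

(** The Riemann sum of [op] is the calculus applied to that of [fz], so its norm is at most K times
    a supremum over z of scalar sums. One mesh must approximate the scalar integrals for all z, and
    the operator integral as well. *)
Lemma int_op_bound d : 0 < d <= b -> norm (CInt op d b) <= K * Cs.
Proof.
intros Hd.
assert (HN : 0 <= N) by exact (N_nonneg b N c0 c1 u0 u1 Phi Hb Hu HPhi).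
assert (HCs : 0 <= Cs).
{ unfold Cs; pose proof PI_RGT_0; pose proof (Cmod_ge_0 c1).
  assert (0 <= PI * Cmod c1 * N) by (apply Rmult_le_pos; [apply Rmult_le_pos|]; lra).
  assert (0 <= 8 / (cos th - y) * N) by (apply Rmult_le_pos; [apply Rdiv_le_0_compat; lra|lra]).
  lra. }
apply le_epsilon; intros e0 He0.
(* The errors e b in the scalar sums, multiplied by K, and e b in the operator sum add up to e0. *)
set (e := e0 / ((1 + K) * b)).
assert (Hkb : 0 < (1 + K) * b) by (apply Rmult_lt_0_compat; lra).
assert (He : 0 < e) by (now apply Rdiv_lt_0_compat).
assert (Hop : forall t, d <= t <= b -> rcont op t).
{ intros t Ht; apply rcont_jump; intros u Hu'; apply cdiffable_op; auto; lra. }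
destruct (fz_uniform d Hd e He) as [dl1 [Hdl1 U1]].
destruct (rcont_uniform op d b Hop e He) as [dl2 [Hdl2 U2]].
(* n + 1 exceeds b divided by the smaller threshold, so [S n] equal steps are finer than both
   thresholds. *)
destruct (nfloor_ex (b / Rmin dl1 dl2)) as [n Hn].
{ apply Rlt_le, Rdiv_lt_0_compat; [assumption|now apply Rmin_glb_lt]. }
set (h := (b - d) / INR (S n)).
assert (HSn : 0 < INR (S n)) by (apply lt_0_INR; lia).
assert (Hh : 0 <= h) by (apply Rdiv_le_0_compat; lra).
assert (Hnh : d + INR (S n) * h = b) by (unfold h; field; lra).
assert (Hhs : h < Rmin dl1 dl2).
{ assert (Hm : 0 < Rmin dl1 dl2) by now apply Rmin_glb_lt.
  unfold h; apply Rmult_lt_reg_r with (INR (S n)); [assumption|].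
  unfold Rdiv; rewrite Rmult_assoc, Rinv_l, Rmult_1_r by lra.
  rewrite S_INR.
  assert (b < (INR n + 1) * Rmin dl1 dl2); [|lra].
  apply Rmult_lt_reg_r with (/ Rmin dl1 dl2); [now apply Rinv_0_lt_compat|].
  replace ((INR n + 1) * Rmin dl1 dl2 * / Rmin dl1 dl2) with (INR n + 1) by (field; lra).
  exact (proj2 Hn). }
assert (Hh1 := Rlt_le_trans _ _ _ Hhs (Rmin_l _ _)); assert (Hh2 := Rlt_le_trans _ _ _ Hhs (Rmin_r _ _)).
assert (Hlen : INR (S n) * h <= b) by lra.
assert (Hlen0 : 0 <= INR (S n) * h) by (apply Rmult_le_pos; lra).
assert (R1 : forall z, sector th z ->
  Cmod (rsum (V := C_NormedModule) (fz z) d h (S n)) <= Cs + e * b).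
{ intros z Hz.
  assert (R := rsum_near (V := C_NormedModule) (fz z) d h e (S n) Hh).
  rewrite Hnh in R.
  assert (R' : norm (minus (CInt (fz z) d b) (rsum (V := C_NormedModule) (fz z) d h (S n))) <= INR (S n) * h * e).
  { apply R.
    - intros p q Hp Hpq Hq; apply ex_Int; [apply C_norm_complete|assumption|].
      intros t Ht; apply rcont_jump; intros u Hu'; apply cdiffable_fz; auto; lra.
    - intros p q Hp Hpq Hq Hqp; apply (U1 z p q Hz); [lra|lra|]; rewrite Rabs_pos_eq; lra. }
  eapply Rle_trans; [apply (norm_le_minus (V := C_NormedModule) _ (CInt (fz z) d b))|].
  apply Rplus_le_compat; [now apply int_fz_bound|].
  rewrite norm_minus_sym; eapply Rle_trans; [exact R'|].
  rewrite Rmult_comm; apply Rmult_le_compat_l; lra. }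
assert (R2 : norm (minus (CInt op d b) (rsum op d h (S n))) <= b * e).
{ assert (R := rsum_near op d h e (S n) Hh); rewrite Hnh in R.
  eapply Rle_trans; [apply R|apply Rmult_le_compat_r; lra].
  - intros p q Hp Hpq Hq; apply ex_Int; [apply ba_complete|assumption|]; intros t Ht; apply Hop; lra.
  - intros p q Hp Hpq Hq Hqp; apply Rlt_le, U2; [lra|lra|]; rewrite Rabs_pos_eq; lra. }
assert (A : attained (fun z => rsum (V := C_NormedModule) (fz z) d h (S n)) (rsum op d h (S n))).
{ apply (attained_rsum fz op d h (S n)); intros k Hk.
  set (t := d + INR k * h).
  assert (Ht : 0 < t <= b).
  { assert (INR k <= INR (S n)) by (apply le_INR; lia).
    assert (0 <= INR k * h) by (apply Rmult_le_pos; [apply pos_INR|assumption]).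
    assert (INR k * h <= INR (S n) * h) by (apply Rmult_le_compat_r; assumption).
    unfold t; lra. }
  assert (Hone : forall u, u = u0 \/ u = u1 -> attained (kern (pt t u)) (kern_op B r (pt t u))).
  { intros u Hu'; destruct (pt_end t u ltac:(lra) Hu') as (F1 & F2 & F3).
    now apply (attained_kern y). }
  assert (P := attained_plus _ _ _ _
    (attained_scal (circ c0 c1 u0 * Phi (pt t u0))%C _ _ (Hone u0 ltac:(auto)))
    (attained_scal (- (circ c0 c1 u1 * Phi (pt t u1)))%C _ _ (Hone u1 ltac:(auto)))).
  replace (fun z => fz z t) with (fun z => circ c0 c1 u0 * Phi (pt t u0) * kern (pt t u0) z
     + - (circ c0 c1 u1 * Phi (pt t u1)) * kern (pt t u1) z)%C.
  - replace (op t) with (plus ((circ c0 c1 u0 * Phi (pt t u0))%C *: kern_op B r (pt t u0))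
      ((- (circ c0 c1 u1 * Phi (pt t u1)))%C *: kern_op B r (pt t u1))); [exact P|].
    unfold op, jump, ray_form; fold (pt t u0) (pt t u1); module B.
  - apply functional_extensionality; intros z.
    change (fz z t) with (circ c0 c1 u0 * (Phi (pt t u0) * kern (pt t u0) z) - circ c0 c1 u1 * (Phi (pt t u1) * kern (pt t u1) z))%C.
    ring. }
assert (Hn2 := attained_norm _ _ A).
assert (Hsup : sup_norm_on (sector th) (fun z => rsum (V := C_NormedModule) (fz z) d h (S n)) <= Cs + e * b).
{ apply sup_norm_on_le; [nra|exact R1]. }
eapply Rle_trans; [apply (norm_le_minus _ (rsum op d h (S n)))|].
apply Rle_trans with (K * (Cs + e * b) + b * e).
- apply Rplus_le_compat; [|exact R2].
  eapply Rle_trans; [exact Hn2|]; now apply Rmult_le_compat_l.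
- right; unfold e; field; lra.
Qed.

(** Solving the definition of [kern_op] for [r w] pays back the correction in the kernel: what
    remains is the scalar integral of Phi(w)/w times the fixed resolvent at -1. *)
Theorem int_resolvent_bound d : 0 < d <= b ->
  norm (CInt (jump (fun w => Phi w *: r w)) d b) <= K * Cs + 4 * PI * Cmod c1 * N * norm (r (RtoC (-1))).
Proof.
intros Hd.
set (h2 := fun w => (/ w * Phi w)%C).
assert (D2 : forall t u, d <= t <= b -> u = u0 \/ u = u1 -> cdiffable (V := C_NormedModule) h2 (pt t u)).
{ intros t u Ht Hu'; apply (cdiffable_scal (V := C_NormedModule) (fun w => / w)%C); [|apply cdiffable_Phi; auto; lra].
  apply cdiffable_Cinv, pt_end; auto; lra. }
assert (J2 := CInt_jump C_norm_complete h2 d b ltac:(lra) D2).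
assert (E2 := int_inv_bound b N c0 c1 u0 u1 Phi Hb Hu Hge HPhi d Hd); fold h2 in E2.
assert (I2 : is_Int (V := C_NormedModule) (jump h2) d b (CInt (jump h2) d b)).
{ apply ex_Int; [apply C_norm_complete|lra|]; intros t Ht; apply rcont_jump; intros u Hu'; auto. }
assert (I1 : is_Int op d b (CInt op d b)).
{ apply ex_Int; [apply ba_complete|lra|]; intros t Ht; apply rcont_jump; intros u Hu'; apply cdiffable_op; auto; lra. }
assert (E : CInt (jump (fun w => Phi w *: r w)) d b
  = minus (opp (CInt op d b)) (CInt (jump h2) d b *: r (RtoC (-1)))).
{ apply Int_eq.
  apply is_Int_ext with (fun t => minus (opp (op t)) (jump (V := C_NormedModule) h2 t *: r (RtoC (-1)))); [lra| |].
  - intros t _; unfold op.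
    change (jump (V := C_NormedModule) h2 t) with (circ c0 c1 u0 * (/ pt t u0 * Phi (pt t u0)) - circ c0 c1 u1 * (/ pt t u1 * Phi (pt t u1)))%C.
    unfold jump, ray_form, kern_op; fold (pt t u0) (pt t u1); module B.
  - apply is_Int_minus; [now apply is_Int_opp|now apply is_Int_scal_vec]. }
rewrite E; eapply Rle_trans; [apply norm_minus_triangle|]; rewrite norm_opp.
apply Rplus_le_compat; [now apply int_op_bound|].
rewrite norm_Cscal_eq; apply Rmult_le_compat_r; [apply norm_ge_0|].
rewrite J2; exact E2.
Qed.

End OperatorBound.

(** * Geometry of Stolz domains *)

Lemma locally_Cmod (z : C) (P : C -> Prop) :
  locally z P <-> exists d, 0 < d /\ forall w, Cmod (w - z)%C < d -> P w.
Proof.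
split.
- intros [d H]; exists d; split; [apply cond_pos|]; intros w Hw; apply H.
  apply (norm_compat1 (V := C_NormedModule)); exact Hw.
- intros [d [Hd H]].
  destruct (ball_norm_minus (V := C_NormedModule) z (mkposreal d Hd)) as [d' Hd'].
  exists d'; intros w Hw; apply H; exact (Hd' w Hw).
Qed.

(** An induction principle: inclusion of the domain in a convex set is checked at the vertex and on
    the disc only. *)
Lemma stolz_sub_convex (g : R) (E : C -> Prop) : plane_convex E -> E (RtoC 1) ->
  (forall p, Cmod p < sin g -> E p) -> forall w, stolz g w -> E w.
Proof.
intros HE H1 Hp w Hw; apply locally_Cmod in Hw; destruct Hw as [d [Hd Hw]].
apply (Hw w); [replace (w - w)%C with (RtoC 0) by ring; rewrite Cmod_0; exact Hd|exact HE|].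
intros v [-> | Hv]; auto.
Qed.

(** This is the point at fraction s on the way from 1 to p. A perturbation of it is absorbed into p
    after division by s, so the radius s (sin g - |p|) is admissible. *)
Lemma stolz_intro (g s : R) (p : C) : 0 < s <= 1 -> Cmod p < sin g ->
  stolz g (1 - RtoC s * (1 - p))%C.
Proof.
intros Hs Hp; apply locally_Cmod; exists (s * (sin g - Cmod p)); split; [apply Rmult_lt_0_compat; lra|].
intros w Hw E HE HG.
assert (Hs0 : RtoC s <> RtoC 0) by (intros H; apply RtoC_inj in H; lra).
set (p' := (p + / RtoC s * (w - (1 - RtoC s * (1 - p))))%C).
replace w with (RtoC (1 - s) * RtoC 1 + RtoC s * p')%C.
2: { unfold p'; rewrite RtoC_minus; field; exact Hs0. }
apply HE; [apply HG; now left|apply HG; right|lra].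
unfold p'; eapply Rle_lt_trans; [apply Cmod_triangle|].
rewrite Cmod_mult, Cmod_inv, Cmod_R, Rabs_pos_eq by (assumption || lra).
apply Rlt_le_trans with (Cmod p + / s * (s * (sin g - Cmod p))).
- apply Rplus_lt_compat_l, Rmult_lt_compat_l; [apply Rinv_0_lt_compat; lra|exact Hw].
- right; field; lra.
Qed.

Lemma stolz_mono (a b : R) (w : C) : sin a <= sin b -> stolz a w -> stolz b w.
Proof.
intros Hab Hw; apply locally_Cmod in Hw; destruct Hw as [d [Hd Hw]].
apply locally_Cmod; exists d; split; [assumption|]; intros v Hv E HE HG.
apply (Hw v Hv E HE); intros p [Hp|Hp]; apply HG; [now left|right; lra].
Qed.

Lemma Re_one_minus (w : C) : Re (1 - w)%C = 1 - Re w.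
Proof. reflexivity. Qed.

Lemma cone_of_disc (g : R) (p : C) : 0 < g < PI / 2 -> Cmod p <= sin g ->
  cos g * Cmod (1 - p)%C <= Re (1 - p)%C.
Proof.
intros Hg Hp.
assert (Hs : 0 < sin g) by (apply sin_gt_0; pose proof PI_RGT_0; lra).
assert (Hc : 0 < cos g) by (apply cos_gt_0; lra).
assert (Hsc := sin2_cos2 g); unfold Rsqr in Hsc.
assert (Hs1 : sin g < 1) by nra.
assert (HRe : Re p <= sin g) by (eapply Rle_trans; [apply Re_le_Cmod|exact Hp]).
assert (Hq : 0 <= Re (1 - p)%C) by (rewrite Re_one_minus; lra).
apply Rsqr_incr_0; [|apply Rmult_le_pos; [lra|apply Cmod_ge_0]|assumption].
rewrite !Rsqr_pow2, Rpow_mult_distr, <- Re_sq_Im_sq.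
assert (H1 := Re_sq_Im_sq p).
assert (H2 : Cmod p ^ 2 <= sin g ^ 2) by (pose proof (Cmod_ge_0 p); apply pow_incr; lra).
rewrite Re_one_minus.
replace (Im (1 - p)%C) with (- Im p) by (unfold Im; simpl; ring).
set (x := Re p) in *; set (y := Im p) in *; set (s := sin g) in *; set (c := cos g) in *.
assert (Hc2 : c ^ 2 = 1 - s ^ 2) by lra.
rewrite Hc2.
assert (Hy : y ^ 2 <= s ^ 2 - x ^ 2) by lra.
replace ((- y) ^ 2) with (y ^ 2) by ring.
assert (H3 : (1 - s ^ 2) * y ^ 2 <= (1 - s ^ 2) * (s ^ 2 - x ^ 2)) by (apply Rmult_le_compat_l; [nra|assumption]).
(* After substituting y^2 <= s^2 - x^2 the claim is exactly (x - s^2)^2 >= 0, with equality at the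
   tangency points. *)
pose proof (pow2_ge_0 (x - s ^ 2)).
nra.
Qed.

Lemma Cmod_convex (z w : C) (t : R) : 0 <= t <= 1 ->
  Cmod (RtoC (1 - t) * z + RtoC t * w)%C <= (1 - t) * Cmod z + t * Cmod w.
Proof.
intros Ht; eapply Rle_trans; [apply Cmod_triangle|]; rewrite !Cmod_mult, !Cmod_R, !Rabs_pos_eq by lra.
apply Rle_refl.
Qed.

Lemma stolz_cone (g : R) (w : C) : 0 < g < PI / 2 -> stolz g w ->
  cos g * Cmod (1 - w)%C <= Re (1 - w)%C.
Proof.
intros Hg; assert (Hc : 0 < cos g) by (apply cos_gt_0; lra).
apply (stolz_sub_convex g (fun w => cos g * Cmod (1 - w)%C <= Re (1 - w)%C)).
- intros z v t Hz Hv Ht.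
  replace (1 - (RtoC (1 - t) * z + RtoC t * v))%C with (RtoC (1 - t) * (1 - z) + RtoC t * (1 - v))%C
    by (rewrite RtoC_minus; ring).
  replace (Re (RtoC (1 - t) * (1 - z) + RtoC t * (1 - v))%C) with ((1 - t) * Re (1 - z)%C + t * Re (1 - v)%C)
    by (unfold Re; simpl; ring).
  pose proof (Cmod_convex (1 - z)%C (1 - v)%C t Ht).
  apply Rle_trans with (cos g * ((1 - t) * Cmod (1 - z)%C + t * Cmod (1 - v)%C)).
  + apply Rmult_le_compat_l; lra.
  + assert ((1 - t) * (cos g * Cmod (1 - z)%C) <= (1 - t) * Re (1 - z)%C) by (apply Rmult_le_compat_l; lra).
    assert (t * (cos g * Cmod (1 - v)%C) <= t * Re (1 - v)%C) by (apply Rmult_le_compat_l; lra).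
    lra.
- replace (1 - 1)%C with (RtoC 0) by ring; rewrite Cmod_0; unfold Re; simpl; lra.
- intros p Hp; apply cone_of_disc; lra.
Qed.

(** The domain is open, so it also contains w + d/2 for a small d; the closed cone inequality there
    gains (1 - cos g) d/2 at w and becomes strict. *)
Lemma stolz_sector (g : R) (w : C) : 0 < g < PI / 2 -> stolz g w -> sector g (1 - w)%C.
Proof.
intros Hg Hw; pose proof PI_RGT_0; apply sector_iff; [lra|].
assert (Hc : 0 < cos g < 1).
{ split; [apply cos_gt_0; lra|rewrite <- cos_0; apply cos_decreasing_1; lra]. }
assert (Hw' := Hw); apply locally_Cmod in Hw'; destruct Hw' as [d [Hd Hball]].
assert (Hn : stolz g (w + RtoC (d / 2))%C).
{ apply locally_Cmod; exists (d / 2); split; [lra|]; intros v Hv; apply Hball.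
  replace (v - w)%C with ((v - (w + RtoC (d / 2))) + RtoC (d / 2))%C by ring.
  eapply Rle_lt_trans; [apply Cmod_triangle|]; rewrite Cmod_R, Rabs_pos_eq; lra. }
assert (H1 := stolz_cone g _ Hg Hn).
replace (Re (1 - (w + RtoC (d / 2)))%C) with (Re (1 - w)%C - d / 2) in H1 by (unfold Re; simpl; ring).
assert (H2 := Cmod_lower (1 - w)%C (RtoC (d / 2))).
replace (1 - w - RtoC (d / 2))%C with (1 - (w + RtoC (d / 2)))%C in H2 by ring.
rewrite Cmod_R, Rabs_pos_eq in H2 by lra.
nra.
Qed.

(** The bound is the support function, in the direction of angle u, of the hull of 1 and the
    disc. *)
Lemma stolz_half_plane (g u : R) (w : C) : stolz g w ->
  Re (w * cis (- u))%C <= Rmax (cos u) (sin g).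
Proof.
apply (stolz_sub_convex g (fun w => Re (w * cis (- u))%C <= Rmax (cos u) (sin g))).
- intros z v t Hz Hv Ht.
  replace (Re ((RtoC (1 - t) * z + RtoC t * v) * cis (- u))%C)
    with ((1 - t) * Re (z * cis (- u))%C + t * Re (v * cis (- u))%C) by (unfold Re; simpl; ring).
  set (m := Rmax (cos u) (sin g)) in *.
  assert ((1 - t) * Re (z * cis (- u))%C <= (1 - t) * m) by (apply Rmult_le_compat_l; lra).
  assert (t * Re (v * cis (- u))%C <= t * m) by (apply Rmult_le_compat_l; lra).
  lra.
- rewrite Cmult_1_l, Re_cis, cos_neg; apply Rmax_l.
- intros p Hp; eapply Rle_trans; [|apply Rmax_r]; eapply Rle_trans; [apply Re_le_Cmod|].
  rewrite Cmod_mult, Cmod_cis; lra.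
Qed.

Lemma plane_closure_le (D : C -> Prop) (g : C -> R) (L m : R) : 0 < L ->
  (forall z w, g z - g w <= L * Cmod (w - z)%C) -> (forall w, D w -> g w <= m) ->
  forall z, plane_closure D z -> g z <= m.
Proof.
intros HL Hg HD z Hz; apply Rnot_lt_le; intros Hlt.
destruct (Hz (fun w => m < g w)) as [w [Hw1 Hw2]].
- apply locally_Cmod; exists ((g z - m) / L); split; [apply Rdiv_lt_0_compat; lra|]; intros w Hw.
  specialize (Hg z w).
  assert (L * Cmod (w - z)%C < L * ((g z - m) / L)) by (apply Rmult_lt_compat_l; assumption).
  replace (L * ((g z - m) / L)) with (g z - m) in * by (field; lra); lra.
- specialize (HD w Hw2); lra.
Qed.

Lemma closure_sector_cone (w : R) (z : C) : 0 < w < PI -> plane_closure (sector w) z ->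
  cos w * Cmod z <= Re z.
Proof.
intros Hw Hz; pose proof (COS_bound w) as Hc.
enough (cos w * Cmod z - Re z <= 0) by lra.
revert Hz; apply (plane_closure_le _ (fun z => cos w * Cmod z - Re z) 2); [lra| |].
- intros v v'.
  assert (H1 : - Cmod (v' - v)%C <= Cmod v - Cmod v' <= Cmod (v' - v)%C).
  { pose proof (Cmod_lower v' v); pose proof (Cmod_lower v v') as H2.
    replace (v - v')%C with (- (v' - v))%C in H2 by ring; rewrite Cmod_opp in H2; lra. }
  assert (H2 := Re_le_Cmod (v' - v)%C); rewrite Re_minus in H2.
  assert (cos w * (Cmod v - Cmod v') <= Cmod (v' - v)%C).
  { destruct (Rle_lt_dec 0 (cos w)); nra. }
  lra.
- intros v Hv; apply sector_iff in Hv; [lra|assumption].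
Qed.

Lemma closure_stolz_cone (g : R) (w : C) : 0 < g < PI / 2 -> plane_closure (stolz g) w ->
  cos g * Cmod (1 - w)%C <= Re (1 - w)%C.
Proof.
intros Hg Hz; assert (Hc : 0 < cos g <= 1) by (split; [apply cos_gt_0; lra|apply COS_bound]).
enough (cos g * Cmod (1 - w)%C - Re (1 - w)%C <= 0) by lra.
revert Hz; apply (plane_closure_le _ (fun w => cos g * Cmod (1 - w)%C - Re (1 - w)%C) 2); [lra| |].
- intros v v'.
  assert (H1 := Cmod_lower (1 - v)%C (1 - v')%C).
  replace (1 - v - (1 - v'))%C with (v' - v)%C in H1 by ring.
  assert (H2 := Re_le_Cmod (- (v' - v))%C); rewrite Cmod_opp in H2.
  replace (Re (- (v' - v))%C) with (Re (1 - v')%C - Re (1 - v)%C) in H2 by (unfold Re; simpl; ring).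
  pose proof (Cmod_ge_0 (v' - v)%C).
  nra.
- intros v Hv; apply stolz_cone in Hv; lra.
Qed.

Lemma closure_stolz_half_plane (g u : R) (w : C) : plane_closure (stolz g) w ->
  Re (w * cis (- u))%C <= Rmax (cos u) (sin g).
Proof.
apply (plane_closure_le _ (fun w => Re (w * cis (- u))%C) 1); [lra| |].
- intros v v'.
  replace (Re (v * cis (- u))%C - Re (v' * cis (- u))%C) with (Re (- (v' - v) * cis (- u))%C) by (unfold Re; simpl; ring).
  eapply Rle_trans; [apply Re_le_Cmod|]; rewrite Cmod_mult, Cmod_opp, Cmod_cis; lra.
- intros v Hv; now apply stolz_half_plane.
Qed.

Lemma plane_closure_mono (D E : C -> Prop) (z : C) :
  (forall w, D w -> E w) -> plane_closure D z -> plane_closure E z.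
Proof. intros H Hz P HP; destruct (Hz P HP) as [w [H1 H2]]; exists w; auto. Qed.

Lemma closure_stolz_sector (g : R) (z : C) : 0 < g < PI / 2 ->
  plane_closure (stolz g) (1 - z)%C -> plane_closure (sector g) z.
Proof.
intros Hg Hz P HP.
destruct (Hz (fun w => P (1 - w)%C)) as [w [H1 H2]].
- apply locally_Cmod in HP; destruct HP as [d [Hd HP]]; apply locally_Cmod.
  exists d; split; [assumption|]; intros w Hw; apply HP.
  replace (1 - w - z)%C with (- (w - (1 - z)))%C by ring; now rewrite Cmod_opp.
- exists (1 - w)%C; split; [assumption|now apply stolz_sector].
Qed.

Lemma closure_stolz_intro (g s : R) (p : C) : 0 < sin g -> 0 <= s <= 1 -> Cmod p <= sin g ->
  plane_closure (stolz g) (1 - RtoC s * (1 - p))%C.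
Proof.
intros Hg Hs Hp P HP; apply locally_Cmod in HP; destruct HP as [d [Hd HP]].
set (q := Cmod (1 - p)%C + Cmod p + 1).
assert (Hq : 1 <= q) by (unfold q; pose proof (Cmod_ge_0 (1 - p)%C); pose proof (Cmod_ge_0 p); lra).
set (t := Rmin (/ 2) (d / (2 * q))).
assert (Ht : 0 < t <= / 2).
{ split; [apply Rmin_glb_lt; [lra|apply Rdiv_lt_0_compat; lra]|apply Rmin_l]. }
assert (Htq : t * q <= d / 2).
{ apply Rle_trans with (d / (2 * q) * q); [apply Rmult_le_compat_r; [lra|apply Rmin_r]|right; field; lra]. }
(* Shrinking p by 1 - t makes it strictly interior, and s' >= t > 0 even for s = 0, as [stolz_intro]
   requires; the displacement is at most t q <= d/2. *)
set (s' := (1 - t) * s + t).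
exists (1 - RtoC s' * (1 - RtoC (1 - t) * p))%C; split.
- apply HP.
  replace (1 - RtoC s' * (1 - RtoC (1 - t) * p) - (1 - RtoC s * (1 - p)))%C
    with (- (RtoC (t * (1 - s)) * (1 - p) + RtoC (s' * t) * p))%C.
  2: { unfold s'; rewrite !RtoC_mult, !RtoC_plus, !RtoC_mult, !RtoC_minus; ring. }
  assert (Hs' : 0 <= s' <= 1) by (unfold s'; nra).
  rewrite Cmod_opp; eapply Rle_lt_trans; [apply Cmod_triangle|].
  rewrite !Cmod_mult, !Cmod_R, !Rabs_pos_eq by nra.
  pose proof (Cmod_ge_0 (1 - p)%C); pose proof (Cmod_ge_0 p).
  assert (t * (1 - s) * Cmod (1 - p)%C <= t * Cmod (1 - p)%C) by (apply Rmult_le_compat_r; nra).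
  assert (s' * t * Cmod p <= t * Cmod p) by (apply Rmult_le_compat_r; nra).
  assert (t * Cmod (1 - p)%C + t * Cmod p <= t * q) by (unfold q; nra).
  lra.
- apply stolz_intro; [unfold s'; nra|].
  rewrite Cmod_mult, Cmod_R, Rabs_pos_eq by lra; pose proof (Cmod_ge_0 p); nra.
Qed.

(** The circle 1 - sin b e^(iu) divided by cos b, the length of its tangents from 0. Hence s = cos b
    recovers the arc of the Stolz boundary in the variable z = 1 - lambda, and the tangency points
    at both ends of the arc become the unit vectors of angles -b and b. *)
Definition stolz_c0 (b : R) : C := RtoC (/ cos b).
Definition stolz_c1 (b : R) : C := RtoC (- (sin b / cos b)).
Definition stolz_circ (b u : R) : C := circ (stolz_c0 b) (stolz_c1 b) u.

Section StolzArc.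

Variable b : R.
Hypothesis Hb : 0 < b < PI / 2.

Lemma cos_b_pos : 0 < cos b.
Proof. apply cos_gt_0; lra. Qed.

Lemma sin_b_pos : 0 < sin b.
Proof. apply sin_gt_0; pose proof PI_RGT_0; lra. Qed.

Lemma stolz_circ_eq s u :
  (RtoC s * stolz_circ b u)%C = (RtoC (s / cos b) * (1 - RtoC (sin b) * cis u))%C.
Proof.
pose proof cos_b_pos; unfold stolz_circ, circ, stolz_c0, stolz_c1, Rdiv.
rewrite RtoC_opp, !RtoC_mult; ring.
Qed.

Lemma stolz_circ_start : stolz_circ b (PI / 2 - b) = cis (- b).
Proof.
pose proof cos_b_pos; assert (Hsc := sin2_cos2 b); unfold Rsqr in Hsc.
unfold stolz_circ, circ, stolz_c0, stolz_c1, cis, Cplus, Cmult, RtoC; simpl.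
rewrite cos_shift, sin_shift, cos_neg, sin_neg; f_equal.
- apply Rmult_eq_reg_r with (cos b); [|lra]; field_simplify; [|lra]; lra.
- field; lra.
Qed.

Lemma stolz_circ_end : stolz_circ b (3 * PI / 2 + b) = cis b.
Proof.
pose proof cos_b_pos; assert (Hsc := sin2_cos2 b); unfold Rsqr in Hsc.
unfold stolz_circ, circ, stolz_c0, stolz_c1, cis, Cplus, Cmult, RtoC; simpl.
replace (3 * PI / 2 + b) with (2 * PI - (PI / 2 - b)) by field.
rewrite (cos_minus (2 * PI)), (sin_minus (2 * PI)), cos_2PI, sin_2PI, cos_shift, sin_shift; f_equal.
- apply Rmult_eq_reg_r with (cos b); [|lra]; field_simplify; [|lra]; lra.
- field; lra.
Qed.

Lemma cos_le_sin_arc u : PI / 2 - b <= u <= 3 * PI / 2 + b -> cos u <= sin b.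
Proof.
intros Hu; rewrite <- cos_shift; apply (cos_le_exterior (PI / 2 - b)); lra.
Qed.

Lemma Cmod_sq_one_minus_circle u :
  Cmod (1 - RtoC (sin b) * cis u)%C ^ 2 = 1 - 2 * sin b * cos u + sin b ^ 2.
Proof.
rewrite <- Re_sq_Im_sq; unfold Re, Im; simpl.
assert (Hsc := sin2_cos2 u); unfold Rsqr in Hsc; nra.
Qed.

Lemma Cmod_one_minus_circle_ge u : PI / 2 - b <= u <= 3 * PI / 2 + b ->
  cos b <= Cmod (1 - RtoC (sin b) * cis u)%C.
Proof.
intros Hu; pose proof cos_b_pos; pose proof sin_b_pos; assert (Hsc := sin2_cos2 b); unfold Rsqr in Hsc.
apply Rsqr_incr_0; [|lra|apply Cmod_ge_0].
rewrite !Rsqr_pow2, Cmod_sq_one_minus_circle; pose proof (cos_le_sin_arc u Hu); nra.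
Qed.

Lemma Cmod_stolz_circ_ge u : PI / 2 - b <= u <= 3 * PI / 2 + b -> 1 <= Cmod (stolz_circ b u).
Proof.
intros Hu; pose proof cos_b_pos.
replace (stolz_circ b u) with (RtoC 1 * stolz_circ b u)%C by ring.
rewrite stolz_circ_eq, Cmod_mult, Cmod_R, Rabs_pos_eq by (apply Rdiv_le_0_compat; lra).
apply Rle_trans with (1 / cos b * cos b); [right; field; lra|].
apply Rmult_le_compat_l; [apply Rdiv_le_0_compat; lra|now apply Cmod_one_minus_circle_ge].
Qed.

Lemma stolz_circ_in_stolz g s u : sin b < sin g -> 0 < s <= cos b ->
  stolz g (1 - RtoC s * stolz_circ b u)%C.
Proof.
intros Hg Hs; pose proof cos_b_pos; pose proof sin_b_pos; rewrite stolz_circ_eq; apply stolz_intro.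
- split; [apply Rdiv_lt_0_compat; lra|].
  apply Rmult_le_reg_r with (cos b); [assumption|]; unfold Rdiv; rewrite Rmult_assoc, Rinv_l by lra; lra.
- rewrite Cmod_mult, Cmod_R, Cmod_cis, Rabs_pos_eq by lra; lra.
Qed.

Lemma stolz_circ_in_sector g s u : b < g < PI / 2 -> 0 < s -> sector g (RtoC s * stolz_circ b u)%C.
Proof.
intros Hg Hs; pose proof cos_b_pos; pose proof sin_b_pos; pose proof PI_RGT_0.
rewrite stolz_circ_eq; apply sector_iff; [lra|].
set (v := (1 - RtoC (sin b) * cis u)%C).
assert (Hq : 0 < s / cos b) by (apply Rdiv_lt_0_compat; lra).
rewrite Cmod_mult, Cmod_R, Rabs_pos_eq by lra.
replace (Re (RtoC (s / cos b) * v)%C) with (s / cos b * Re v) by (unfold Re; simpl; ring).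
assert (Hvc : cos b * Cmod v <= Re v).
{ apply cone_of_disc; [assumption|]; rewrite Cmod_mult, Cmod_R, Cmod_cis, Rabs_pos_eq by lra; lra. }
assert (Hcg : cos g < cos b) by (apply cos_decreasing_1; lra).
assert (Hv : 0 < Cmod v).
{ apply Rlt_le_trans with (Re v); [|apply Re_le_Cmod].
  unfold v; rewrite Re_one_minus.
  replace (Re (RtoC (sin b) * cis u)%C) with (sin b * cos u) by (unfold Re; simpl; ring).
  pose proof (COS_bound u); assert (sin b < 1) by (rewrite <- sin_PI2; apply sin_increasing_1; lra); nra. }
rewrite Rmult_assoc; apply Rmult_lt_compat_l; [assumption|]; nra.
Qed.

(** A dilated point of the larger arc is cut off from the smaller domain either by a tangent to the
    smaller disc or by an edge of the smaller cone at 1. *)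
Lemma stolz_circ_outside b' s u : 0 < b' < b -> cos b <= s ->
  PI / 2 - b <= u <= 3 * PI / 2 + b ->
  ~ plane_closure (stolz b') (1 - RtoC s * stolz_circ b u)%C.
Proof.
intros Hb' Hs Hu Hcl; pose proof cos_b_pos; pose proof sin_b_pos; pose proof PI_RGT_0.
assert (Hsb : 0 < sin b' < sin b).
{ split; [apply sin_gt_0; lra|apply sin_increasing_1; lra]. }
assert (Hc := cos_le_sin_arc u Hu).
set (s' := s / cos b).
assert (Hs' : 1 <= s').
{ unfold s'; apply Rmult_le_reg_r with (cos b); [assumption|]; unfold Rdiv; rewrite Rmult_assoc, Rinv_l by lra; lra. }
rewrite stolz_circ_eq in Hcl; fold s' in Hcl.
(* The support function of the smaller domain in direction u is the maximum of cos u and sin b'.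
   Where it is sin b', the tangent separates; otherwise the cone is used. *)
destruct (Rle_lt_dec (cos u) (sin b')) as [Hcu|Hcu].
- assert (Hh := closure_stolz_half_plane b' u _ Hcl).
  rewrite Rmax_right in Hh by assumption.
  replace (Re ((1 - RtoC s' * (1 - RtoC (sin b) * cis u)) * cis (- u))%C)
    with (cos u + s' * (sin b * (cos u * cos u + sin u * sin u) - cos u)) in Hh
    by (unfold Re; simpl; rewrite cos_neg, sin_neg; ring).
  assert (Hsc := sin2_cos2 u); unfold Rsqr in Hsc.
  replace (cos u * cos u + sin u * sin u) with 1 in Hh by lra; nra.
- assert (Hh := closure_stolz_cone b' _ ltac:(lra) Hcl).
  set (v := (1 - RtoC (sin b) * cis u)%C) in *.
  replace (1 - (1 - RtoC s' * v))%C with (RtoC s' * v)%C in Hh by ring.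
  rewrite Cmod_mult, Cmod_R, Rabs_pos_eq in Hh by lra.
  replace (Re (RtoC s' * v)%C) with (s' * Re v) in Hh by (unfold Re; simpl; ring).
  assert (Hv : cos b' * Cmod v <= Re v).
  { apply Rmult_le_reg_l with s'; [lra|]; rewrite <- Rmult_assoc, (Rmult_comm s'), Rmult_assoc.
    rewrite Rmult_comm, Rmult_assoc, (Rmult_comm _ (cos b')); lra. }
  assert (Hcb : 0 < cos b') by (apply cos_gt_0; lra).
  assert (Hsq : (cos b' * Cmod v) ^ 2 <= Re v ^ 2).
  { apply pow_incr; split; [apply Rmult_le_pos; [lra|apply Cmod_ge_0]|exact Hv]. }
  rewrite Rpow_mult_distr in Hsq; unfold v in Hsq; rewrite Cmod_sq_one_minus_circle, Re_one_minus in Hsq.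
  replace (Re (RtoC (sin b) * cis u)%C) with (sin b * cos u) in Hsq by (unfold Re; simpl; ring).
  assert (Hsc := sin2_cos2 b'); unfold Rsqr in Hsc.
  assert (Hc2 : cos b' ^ 2 = 1 - sin b' ^ 2) by lra.
  rewrite Hc2 in Hsq.
  set (x := sin b) in *; set (y := sin b') in *; set (c := cos u) in *.
  assert (Hx1 : x < 1) by (unfold x; rewrite <- sin_PI2; apply sin_increasing_1; lra).
  assert (K : 0 < x ^ 2 - x ^ 2 * c ^ 2 - y ^ 2 * (1 - 2 * x * c + x ^ 2)).
  (* The positivity of this polynomial is the negation of the squared cone inequality; for y < c <=
     x < 1 the first summand is positive and the second nonnegative. *)
  { assert (E : x ^ 2 - x ^ 2 * c ^ 2 - y ^ 2 * (1 - 2 * x * c + x ^ 2)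
      = (x ^ 2 - y ^ 2) * (1 - x ^ 2) + (x - c) * (x ^ 2 * (x + c) - 2 * x * y ^ 2)) by ring.
    rewrite E.
    assert (0 < (x ^ 2 - y ^ 2) * (1 - x ^ 2)) by (apply Rmult_lt_0_compat; nra).
    assert (0 <= (x - c) * (x ^ 2 * (x + c) - 2 * x * y ^ 2)).
    { apply Rmult_le_pos; [lra|].
      assert (y ^ 2 <= x * y) by nra.
      assert (x * (x + c) >= x * (2 * y)) by nra.
      assert (2 * x * y ^ 2 <= x * (x * (2 * y))) by nra.
      nra. }
    lra. }
  lra.
Qed.

End StolzArc.

Fixpoint ba_pow {B : banach_algebra} (a : B) (n : nat) : B :=
  match n with O => ba_one | S n => a ** ba_pow a n end.

Fixpoint Cpow_nat (z : C) (n : nat) : C :=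
  match n with O => RtoC 1 | S n => (z * Cpow_nat z n)%C end.

Lemma Cmod_Cpow_nat z n : Cmod (Cpow_nat z n) = Cmod z ^ n.
Proof. induction n as [|n IH]; simpl; [apply Cmod_1|now rewrite Cmod_mult, IH]. Qed.

(** * Resolvents of Ritt operators *)

Section RittResolvent.

Variable B : banach_algebra.
Variable a : B.

(** The divided difference (z^n - a^n)/(z - a), that is, the sum of z^(n-1-i) a^i over i < n. *)
Fixpoint pow_quot (z : C) (n : nat) : B :=
  match n with O => zero | S n => plus (Cpow_nat z n *: ba_one) (a ** pow_quot z n) end.

Lemma pow_quot_spec z n :
  minus (z *: ba_one) a ** pow_quot z n = minus (Cpow_nat z n *: ba_one) (ba_pow a n) /\
  pow_quot z n ** minus (z *: ba_one) a = minus (Cpow_nat z n *: ba_one) (ba_pow a n).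
Proof.
induction n as [|n [IH1 IH2]]; simpl.
- split; [rewrite ba_zero_r|rewrite ba_zero_l]; module B.
- split.
  + transitivity (plus (minus (z *: (Cpow_nat z n *: ba_one)) (Cpow_nat z n *: a)) (a ** (minus (z *: ba_one) a ** pow_quot z n))).
    * ba_expand; module B.
    * rewrite IH1; ba_expand; module B.
  + rewrite ba_plus_l, ba_assoc, IH2; ba_expand; module B.
Qed.

Lemma norm_pow_quot z n (rho : R) : 1 <= rho -> Cmod z <= rho -> norm a <= rho ->
  norm (pow_quot z n) <= INR n * rho ^ n.
Proof.
intros Hr Hz Ha; induction n as [|n IH].
- simpl; rewrite norm_0; lra.
- assert (Hp : 1 <= rho ^ n) by now apply pow_R1_Rle.
  assert (Hn := pos_INR n).
  cbn [pow_quot]; rewrite S_INR; cbn [pow].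
  apply Rle_trans with (rho ^ n * 1 + rho * (INR n * rho ^ n)).
  + apply norm_plus_le.
    * rewrite norm_Cscal_eq, Cmod_Cpow_nat; apply Rmult_le_compat; try apply norm_ge_0; [|apply pow_incr; split; [apply Cmod_ge_0|assumption]|apply ba_norm_one].
      apply pow_le, Cmod_ge_0.
    * eapply Rle_trans; [apply ba_norm_mul|]; apply Rmult_le_compat; try apply norm_ge_0; assumption.
  + nra.
Qed.

Lemma bernoulli_sub (x : R) (n : nat) : 0 <= x <= 1 -> 1 - INR n * x <= (1 - x) ^ n.
Proof.
intros Hx; induction n as [|n IH]; [simpl; lra|].
rewrite S_INR; cbn [pow]; pose proof (pos_INR n).
apply Rle_trans with ((1 - x) * (1 - INR n * x)).
- assert (0 <= INR n * x * x) by (repeat apply Rmult_le_pos; lra); lra.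
- apply Rmult_le_compat_l; lra.
Qed.

(* z^m (z-1) - a^m (a-1) is invertible when |z^m (z-1)| dominates the norm of
   a^m (a-1), which the Ritt condition makes O(1/m); z - a divides it. *)
Lemma ritt_resolvent_bound (M : R) :
  (forall n, norm (RtoC (INR (S n)) *: minus (ba_pow a (S n)) (ba_pow a n)) <= M) ->
  forall e, 0 < e -> exists r0 K, 0 < r0 < 1 /\ 0 <= K /\ forall z,
    r0 <= Cmod z -> e <= Cmod (z - 1)%C -> exists s, ba_resolvent z a s /\ Cmod (z - 1)%C * norm s <= K.
Proof.
intros HM e He.
assert (HM0 : 0 <= M) by exact (Rle_trans _ _ _ (norm_ge_0 _) (HM 0%nat)).
(* m + 1 exceeds 4M/e, so the Ritt condition bounds a^m (a-1) by e/4, half of the lower bound e/2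
   obtained for |z^m (z-1)|. That is the ratio [neumann_scalar] asks for. *)
destruct (nfloor_ex (4 * M / e)) as [m Hm].
{ apply Rdiv_le_0_compat; lra. }
assert (Hm1 : 0 < INR (S m)) by (apply lt_0_INR; lia).
assert (Hm0 : 0 <= INR m) by apply pos_INR.
set (d := minus (ba_pow a (S m)) (ba_pow a m)).
assert (Hd : norm d <= e / 4).
{ assert (H := HM m); fold d in H; rewrite norm_Cscal_eq, Cmod_R, Rabs_pos_eq in H by lra.
  assert (H4 : 4 * M <= INR (S m) * e).
  { rewrite S_INR; apply Rmult_le_reg_r with (/ e); [now apply Rinv_0_lt_compat|].
    replace ((INR m + 1) * e * / e) with (INR m + 1) by (field; lra); unfold Rdiv in Hm; lra. }
  apply Rmult_le_reg_l with (INR (S m)); [assumption|]; lra. }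
(* By Bernoulli (1-x)^m >= 1 - m x >= 1/2, so |z| >= 1 - x implies |z|^m >= 1/2. *)
set (x := / (2 * INR (S m))).
assert (Hx : 0 < x <= / 2).
{ unfold x; split; [apply Rinv_0_lt_compat; lra|apply Rinv_le_contravar; [lra|rewrite S_INR; lra]]. }
assert (Hmx : INR m * x <= / 2).
{ unfold x; apply Rmult_le_reg_r with (2 * INR (S m)); [lra|].
  rewrite Rmult_assoc, Rinv_l by lra; rewrite S_INR; lra. }
assert (Hpow : / 2 <= (1 - x) ^ m) by (pose proof (bernoulli_sub x m ltac:(lra)); lra).
pose proof (norm_ge_0 a) as Ha.
(* Beyond [rho] the Neumann series of z - a converges directly and |z-1| <= 2|z|, which gives the
   bound 4; below [rho] the divided differences are bounded by [q]. *)
set (rho := 2 * norm a + 2).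
assert (Hrho : 1 <= rho ^ S m) by (apply pow_R1_Rle; unfold rho; lra).
assert (Hrho' : 1 <= rho ^ m) by (apply pow_R1_Rle; unfold rho; lra).
set (q := INR (S m) * rho ^ S m + INR m * rho ^ m).
assert (Hq : 0 <= q) by (unfold q; nra).
exists (1 - x), (4 + (rho + 1) * (q * (4 / e))).
assert (H4e : 0 < 4 / e) by (apply Rdiv_lt_0_compat; lra).
assert (HK : 0 <= (rho + 1) * (q * (4 / e))).
{ apply Rmult_le_pos; [unfold rho; lra|apply Rmult_le_pos; lra]. }
split; [lra|split; [lra|]]; intros z Hz Hz1.
destruct (Rle_lt_dec (Cmod z) rho) as [Hzr|Hzr].
- set (c := (Cpow_nat z (S m) - Cpow_nat z m)%C).
  assert (Hc : e / 2 <= Cmod c).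
  { replace c with (Cpow_nat z m * (z - 1))%C by (unfold c; simpl; ring).
    rewrite Cmod_mult, Cmod_Cpow_nat.
    assert ((1 - x) ^ m <= Cmod z ^ m) by (apply pow_incr; lra).
    replace (e / 2) with (/ 2 * e) by field; apply Rmult_le_compat; lra. }
  destruct (neumann_scalar B c d) as [j [[J1 J2] J3]].
  { intros E; rewrite E, Cmod_0 in Hc; lra. }
  { lra. }
  set (Q := minus (pow_quot z (S m)) (pow_quot z m)).
  assert (E1 : minus (z *: ba_one) a ** Q = minus (c *: ba_one) d).
  { unfold Q; rewrite ba_minus_r, (proj1 (pow_quot_spec z (S m))), (proj1 (pow_quot_spec z m)).
    unfold c, d; module B. }
  assert (E2 : Q ** minus (z *: ba_one) a = minus (c *: ba_one) d).
  { unfold Q; rewrite ba_minus_l, (proj2 (pow_quot_spec z (S m))), (proj2 (pow_quot_spec z m)).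
    unfold c, d; module B. }
  assert (R1 : minus (z *: ba_one) a ** (Q ** j) = ba_one) by (rewrite <- ba_assoc, E1; exact J2).
  assert (R2 : (j ** Q) ** minus (z *: ba_one) a = ba_one) by (rewrite ba_assoc, E2; exact J1).
  assert (E : j ** Q = Q ** j) by exact (left_right_inverse B _ _ _ R2 R1).
  exists (Q ** j); split.
  + split; [rewrite <- E; exact R2|exact R1].
  + assert (HQ : norm Q <= q).
    { unfold Q, q; eapply Rle_trans; [apply norm_minus_triangle|].
      apply Rplus_le_compat; apply norm_pow_quot; unfold rho in *; lra. }
    assert (Hj : norm j <= 4 / e).
    { eapply Rle_trans; [exact J3|]; unfold Rdiv.
      replace (4 * / e) with (2 * / (e / 2)) by (field; lra).
      apply Rmult_le_compat_l; [lra|]; apply Rinv_le_contravar; lra. }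
    assert (Hz2 : Cmod (z - 1)%C <= rho + 1).
    { unfold Cminus; eapply Rle_trans; [apply Cmod_triangle|]; rewrite Cmod_opp, Cmod_1; lra. }
    apply Rle_trans with ((rho + 1) * (q * (4 / e))); [|lra].
    apply Rmult_le_compat; [apply Cmod_ge_0|apply norm_ge_0|assumption|].
    eapply Rle_trans; [apply ba_norm_mul|]; apply Rmult_le_compat; try apply norm_ge_0; assumption.
- assert (Hz0 : 2 <= Cmod z) by (unfold rho in Hzr; lra).
  destruct (neumann_scalar B z a) as [j [J1 J2]].
  { intros E; rewrite E, Cmod_0 in Hz0; lra. }
  { unfold rho in Hzr; lra. }
  exists j; split; [exact J1|].
  apply Rle_trans with (2 * Cmod z * (2 / Cmod z)).
  + apply Rmult_le_compat; [apply Cmod_ge_0|apply norm_ge_0| |exact J2].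
    unfold Cminus; eapply Rle_trans; [apply Cmod_triangle|]; rewrite Cmod_opp, Cmod_1; lra.
  + apply Rle_trans with 4; [right; field; lra|lra].
Qed.

Lemma ba_resolvent_reflect z s : ba_resolvent (1 - z)%C a s -> ba_resolvent z (minus ba_one a) (opp s).
Proof.
assert (E : minus (z *: ba_one) (minus ba_one a) = opp (minus ((1 - z)%C *: ba_one) a)) by module B.
intros [H1 H2]; split; rewrite E, ba_opp_l, ba_opp_r; [rewrite H1|rewrite H2]; module B.
Qed.

Lemma ba_resolvent_reflect_inv z s : ba_resolvent z (minus ba_one a) s -> ba_resolvent (1 - z)%C a (opp s).
Proof.
assert (E : minus (z *: ba_one) (minus ba_one a) = opp (minus ((1 - z)%C *: ba_one) a)) by module B.
intros [H1 H2]; rewrite E, ba_opp_r in H1; rewrite E, ba_opp_l in H2.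
split; [rewrite ba_opp_l|rewrite ba_opp_r]; assumption.
Qed.

End RittResolvent.

Lemma velocity_eq (p : R -> C) (t : R) (l : C) :
  is_derive (fun u => Re (p u)) t (Re l) -> is_derive (fun u => Im (p u)) t (Im l) -> velocity p t = l.
Proof.
intros H1 H2; apply injective_projections; apply is_derive_unique; assumption.
Qed.

Lemma velocity_ray (u t : R) : velocity (fun t => RtoC t * cis u)%C t = cis u.
Proof. apply velocity_eq; unfold cis, Re, Im; simpl; auto_derive; auto; ring. Qed.

Lemma velocity_segment (u t : R) : velocity (fun t => 1 - RtoC t * cis u)%C t = (- cis u)%C.
Proof. apply velocity_eq; unfold cis, Re, Im; simpl; auto_derive; auto; ring. Qed.

Lemma velocity_circle (s t : R) : velocity (fun t => RtoC s * cis t)%C t = (RtoC s * (Ci * cis t))%C.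
Proof. apply velocity_eq; unfold cis, Re, Im; simpl; auto_derive; auto; ring. Qed.

Lemma sup_norm_on_ge (D : C -> Prop) (f : C -> C) (z : C) :
  bounded_on D f -> D z -> Cmod (f z) <= sup_norm_on D f.
Proof.
intros [M HM] Hz; unfold sup_norm_on.
destruct (Lub_Rbar_correct (fun r => exists z, D z /\ r = Cmod (f z))) as [H1 H2].
assert (HU : is_ub_Rbar (fun r => exists z, D z /\ r = Cmod (f z)) M).
{ intros r [v [Hv ->]]; now apply HM. }
specialize (H1 (Cmod (f z)) (ex_intro _ z (conj Hz eq_refl))); specialize (H2 M HU).
destruct (Lub_Rbar _) as [l| |]; simpl in *; [assumption|contradiction|contradiction].
Qed.

Lemma Rpower_decr (x y p : R) : 0 < x <= y -> p <= 0 -> Rpower y p <= Rpower x p.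
Proof.
intros Hxy Hp; replace p with (- - p) by ring; rewrite !(Rpower_Ropp _ (- p)).
apply Rinv_le_contravar; [apply exp_pos|]; apply Rle_Rpower_l; lra.
Qed.

Lemma is_RInt_gen_ray_ext (B : banach_algebra) (F G : C -> B) (c0 c1 : C) (u : R) (Fa Fb : (R -> Prop) -> Prop)
    (FFa : Filter Fa) (FFb : Filter Fb) (S : B) :
  Fa (fun t => 0 < t) -> Fb (fun t => 0 < t) ->
  (forall t, 0 < t -> F (RtoC t * circ c0 c1 u)%C = G (RtoC t * circ c0 c1 u)%C) ->
  is_RInt_gen (V := real_module B) (ray_form B F c0 c1 u) Fa Fb S ->
  is_RInt_gen (V := real_module B) (ray_form B G c0 c1 u) Fa Fb S.
Proof.
intros Ha Hb H; apply is_RInt_gen_ext.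
apply (Filter_prod _ _ _ (fun t => 0 < t) (fun t => 0 < t)); [assumption|assumption|].
intros x y Hx Hy t Ht; simpl in Ht; unfold ray_form; rewrite H; [reflexivity|].
apply Rlt_trans with (Rmin x y); [now apply Rmin_glb_lt|apply Ht].
Qed.

Lemma at_right_pos : at_right 0 (fun t => 0 < t).
Proof. exists (mkposreal 1 Rlt_0_1); auto. Qed.

Lemma infty_pos : Rbar_locally p_infty (fun t => 0 < t).
Proof. exists 0; auto. Qed.

Lemma ray_end_point (b s u v : R) : 0 < b < PI / 2 -> 0 < s -> stolz_circ b v = cis u -> cos u = cos b ->
  Cmod (RtoC s * stolz_circ b v)%C = s /\ Re (RtoC s * stolz_circ b v)%C = s * cos b.
Proof. intros Hb Hs -> Hu; rewrite Cmod_scal_cis, Re_scal_cis, Hu by lra; split; reflexivity. Qed.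

(** The gap b' < nu puts the edges and the whole swept region outside the closure of [stolz b'],
    where |z| times the norm of r(z) is at most M. With |f| <= c |z|^(-p) this is the decay required
    by [arc_eq_rays]. *)
Lemma rays_of_stolz_boundary (B : banach_algebra) (a : B) (r : C -> B)
    (Hr : forall z s, ba_resolvent z a s -> ba_resolvent z a (r z))
    (g b' nu M : R) (f : C -> C) (S1 S2 S3 : B) :
  0 < b' < nu -> nu < g < PI / 2 -> 0 <= M ->
  (forall z, ~ plane_closure (stolz b') (1 - z)%C -> ba_resolvent z a (r z) /\ Cmod z * norm (r z) <= M) ->
  H0_sector g f ->
  let F := fun z => f z *: r z in
  is_RInt_gen (V := real_module B) (ray_form B F (stolz_c0 nu) (stolz_c1 nu) (PI / 2 - nu))
    (at_right 0) (at_point (cos nu)) S1 ->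
  is_Int (V := B) (arc_form B F (stolz_c0 nu) (stolz_c1 nu) (cos nu)) (PI / 2 - nu) (3 * PI / 2 + nu) S2 ->
  is_RInt_gen (V := real_module B) (ray_form B F (stolz_c0 nu) (stolz_c1 nu) (3 * PI / 2 + nu))
    (at_point (cos nu)) (at_right 0) S3 ->
  exists Q1 Q0 : B,
    is_RInt_gen (V := real_module B) (ray_form B F (RtoC 0) (RtoC 1) nu) (Rbar_locally p_infty) (at_right 0) Q1 /\
    is_RInt_gen (V := real_module B) (ray_form B F (RtoC 0) (RtoC 1) (- nu)) (at_right 0) (Rbar_locally p_infty) Q0 /\
    plus S1 (plus S2 S3) = plus Q1 Q0.
Proof.
intros Hb' Hg HM0 HM (Hf1 & _ & (p & c & Hp & Hc & Hf2)) F H1 H2 H3.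
pose proof PI_RGT_0 as HPI.
assert (Hn : 0 < nu < PI / 2) by lra.
assert (Hcos := cos_b_pos nu Hn).
set (u0 := PI / 2 - nu) in *; set (u1 := 3 * PI / 2 + nu) in *.
assert (Hsec : forall s u, 0 < s -> sector g (RtoC s * stolz_circ nu u)%C).
{ intros s u Hs; apply stolz_circ_in_sector; lra. }
assert (Hdf : forall s u, 0 < s -> cdiffable (V := C_NormedModule) f (RtoC s * stolz_circ nu u)%C).
{ intros s u Hs; apply cdiffable_ex_derive, Hf1, Hsec, Hs. }
assert (Hcb' : cos nu < cos b') by (apply cos_decreasing_1; lra).
assert (Hend : forall u, u = u0 \/ u = u1 -> exists v, stolz_circ nu u = cis v /\ cos v = cos nu).
{ intros u [-> | ->].
  - exists (- nu); split; [now apply stolz_circ_start|apply cos_neg].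
  - exists nu; split; [now apply stolz_circ_end|reflexivity]. }
assert (Hray : forall s u, 0 < s -> u = u0 \/ u = u1 -> ~ plane_closure (stolz b') (1 - RtoC s * stolz_circ nu u)%C).
{ intros s u Hs Hu Hcl; apply closure_stolz_cone in Hcl; [|lra].
  destruct (Hend u Hu) as [v [Hv1 Hv2]].
  destruct (ray_end_point nu s v u Hn Hs Hv1 Hv2) as [E1 E2].
  replace (1 - (1 - RtoC s * stolz_circ nu u))%C with (RtoC s * stolz_circ nu u)%C in Hcl by ring.
  rewrite E1, E2 in Hcl; nra. }
assert (Harc : forall s u, cos nu <= s -> u0 <= u <= u1 -> ~ plane_closure (stolz b') (1 - RtoC s * stolz_circ nu u)%C).
{ intros s u Hs Hu; apply stolz_circ_outside; [assumption|lra|assumption|exact Hu]. }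
assert (HdF : forall s u, 0 < s -> ~ plane_closure (stolz b') (1 - RtoC s * stolz_circ nu u)%C ->
  cdiffable F (RtoC s * stolz_circ nu u)%C).
{ intros s u Hs Hcl; apply cdiffable_scal; [now apply Hdf|].
  apply (cdiffable_resolvent B a r Hr); now apply HM. }
assert (Hu01 : u0 <= u1) by (unfold u0, u1; lra).
destruct (arc_eq_rays (ba_complete B) F (stolz_c0 nu) (stolz_c1 nu) (cos nu) (c * M) p u0 u1)
  as (l0 & l1 & L0 & L1 & E).
- exact Hcos.
- exact Hp.
- apply Rmult_le_pos; lra.
- exact Hu01.
- intros s u Hs Hu; apply HdF; [exact Hs|now apply Hray].
- intros s u Hs Hu; apply HdF; [lra|now apply Harc].
- intros s u Hs Hu; destruct (HM _ (Harc s u Hs Hu)) as [_ HMb].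
  fold (stolz_circ nu u); set (z := (RtoC s * stolz_circ nu u)%C) in *.
  assert (Hz : s <= Cmod z).
  { unfold z; rewrite Cmod_mult, Cmod_R, Rabs_pos_eq by lra.
    pose proof (Cmod_stolz_circ_ge nu Hn u Hu); nra. }
  assert (Hz0 : 0 < Cmod z) by lra.
  assert (Hfz := Hf2 z (Hsec s u ltac:(lra))).
  assert (Hpz : 0 < Rpower (Cmod z) p) by apply exp_pos.
  assert (Hfz' : Cmod (f z) <= c * Rpower (Cmod z) (- p)).
  { eapply Rle_trans; [exact Hfz|]; apply Rmult_le_compat_l; [lra|].
    rewrite Rpower_Ropp; replace (2 * p) with (p + p) by ring; rewrite Rpower_plus.
    set (q := Rpower (Cmod z) p) in *.
    apply Rmult_le_reg_r with (1 + q * q); [nra|].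
    unfold Rdiv; rewrite Rmult_assoc, Rinv_l, Rmult_1_r by nra.
    replace (/ q * (1 + q * q)) with (/ q + q) by (field; lra).
    pose proof (Rinv_0_lt_compat q Hpz); lra. }
  assert (Hrz : norm (r z) <= M * / Cmod z).
  { apply Rmult_le_reg_l with (Cmod z); [assumption|].
    replace (Cmod z * (M * / Cmod z)) with M by (field; lra); exact HMb. }
  unfold F; rewrite norm_Cscal_eq.
  apply Rle_trans with (c * Rpower (Cmod z) (- p) * (M * / Cmod z)).
  { apply Rmult_le_compat; [apply Cmod_ge_0|apply norm_ge_0|assumption|assumption]. }
  replace (c * Rpower (Cmod z) (- p) * (M * / Cmod z)) with (c * M * Rpower (Cmod z) (- p - 1)).
  + apply Rmult_le_compat_l; [apply Rmult_le_pos; lra|]; apply Rpower_decr; lra.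
  + replace (- p - 1) with (- p + - (1)) by ring.
    rewrite Rpower_plus, (Rpower_Ropp _ 1), Rpower_1 by assumption; ring.
- assert (E2 : S2 = minus l0 l1).
  { rewrite <- E; symmetry; apply Int_eq; exact H2. }
  (* [S1], from 0 to cos nu, is prolonged by [l0] to infinity; on the other edge the direction is
     inward, so [l1] is reversed and followed by [S3]. *)
  assert (Q0 := is_RInt_gen_Chasles (V := real_module B) _ _ _ _ H1 L0).
  assert (Q1 := is_RInt_gen_Chasles (V := real_module B) _ _ _ _ (is_RInt_gen_swap (V := real_module B) _ _ L1) H3).
  assert (Eray : forall u v H, stolz_circ nu u = cis v ->
    ray_form B H (stolz_c0 nu) (stolz_c1 nu) u = ray_form B H (RtoC 0) (RtoC 1) v).
  { intros u v H Huv; apply functional_extensionality; intros t; unfold ray_form.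
    fold (stolz_circ nu u); now rewrite Huv, circ_unit. }
  rewrite (Eray u0 (- nu) F (stolz_circ_start nu Hn)) in Q0.
  rewrite (Eray u1 nu F (stolz_circ_end nu Hn)) in Q1.
  exists (plus (opp l1) S3), (plus S1 l0); split; [exact Q1|split; [exact Q0|]].
  rewrite E2; module B.
Qed.

(** * From the Stolz domain to the sector *)

Section SectorCalculus.

Variable X : NormedModule C_AbsRing.
Hypothesis CX : norm_complete X.
Variable T : bounded_op X.

Let B : banach_algebra := operator_algebra X CX.
Let A : bounded_op X := minus one T.

(** Two expressions of one resolvent, by R(z,A) = -R(1-z,T). Since [resolvent] is a choice, they are
    known to agree only where the inverse exists, and integrals are transferred between them only
    there. *)
Definition res_A (z : C) : operator_algebra X CX := resolvent z A.
Definition res_T (z : C) : operator_algebra X CX := opp (resolvent (1 - z)%C T : operator_algebra X CX).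

Lemma resolvent_spec (z : C) (S s : bounded_op X) :
  @ba_resolvent B z S s -> @ba_resolvent B z S (resolvent z S).
Proof.
intros H.
assert (H' : is_resolvent z S (resolvent z S)).
{ unfold resolvent; apply epsilon_spec; exists s; exact H. }
exact H'.
Qed.

Lemma res_A_spec (z : C) (s : B) : @ba_resolvent B z A s -> @ba_resolvent B z A (res_A z).
Proof. apply resolvent_spec. Qed.

Lemma res_T_spec (z : C) (s : B) : @ba_resolvent B z A s -> @ba_resolvent B z A (res_T z).
Proof.
intros H; apply (ba_resolvent_reflect_inv B T) in H.
apply resolvent_spec in H; exact (ba_resolvent_reflect B T z _ H).
Qed.

Lemma res_A_T (z : C) (s : B) : @ba_resolvent B z A s -> res_A z = res_T z.
Proof.
intros H; exact (ba_inverse_unique B _ _ _ (res_A_spec z s H) (res_T_spec z s H)).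
Qed.

Lemma not_spectrum (z : C) (S : bounded_op X) : ~ spectrum S z -> @ba_resolvent B z S (resolvent z S).
Proof.
intros H; apply NNPP in H; destruct H as [s Hs]; exact (resolvent_spec z S s Hs).
Qed.

Lemma path_integral_ray (F : C -> bounded_op X) (u : R) (Fa Fb : (R -> Prop) -> Prop) (S : bounded_op X) :
  is_path_integral F (fun t => RtoC t * cis u)%C Fa Fb S <->
  is_RInt_gen (V := real_module B) (ray_form B F (RtoC 0) (RtoC 1) u) Fa Fb S.
Proof.
unfold is_path_integral.
replace (fun t => scal (velocity (fun t0 => RtoC t0 * cis u)%C t : C_AbsRing) (F (RtoC t * cis u)%C))
  with (ray_form B F (RtoC 0) (RtoC 1) u); [reflexivity|].
apply functional_extensionality; intros t; rewrite velocity_ray; unfold ray_form.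
now rewrite circ_unit.
Qed.

Lemma sector_boundary_iff (nu : R) (F : C -> bounded_op X) (S : bounded_op X) :
  is_sector_boundary_integral nu F S <->
  exists S1 S2 : B,
    is_RInt_gen (V := real_module B) (ray_form B F (RtoC 0) (RtoC 1) nu) (Rbar_locally p_infty) (at_right 0) S1 /\
    is_RInt_gen (V := real_module B) (ray_form B F (RtoC 0) (RtoC 1) (- nu)) (at_right 0) (Rbar_locally p_infty) S2 /\
    S = plus S1 S2.
Proof.
unfold is_sector_boundary_integral; split; intros (S1 & S2 & H1 & H2 & H3); exists S1, S2.
- exact (conj (proj1 (path_integral_ray F nu _ _ S1) H1) (conj (proj1 (path_integral_ray F (- nu) _ _ S2) H2) H3)).
- exact (conj (proj2 (path_integral_ray F nu _ _ S1) H1) (conj (proj2 (path_integral_ray F (- nu) _ _ S2) H2) H3)).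
Qed.

(** Under z = 1 - lambda both the differential and the resolvent change sign, so the integrands
    agree; the scale s = cos b yields the circle |lambda| = sin b. *)
Lemma stolz_boundary_iff (b : R) (phi : C -> C) (S : bounded_op X) : 0 < b < PI / 2 ->
  let F := (fun z => phi (1 - z)%C *: res_T z) : C -> B in
  is_stolz_boundary_integral b (fun z => scal (phi z : C_AbsRing) (resolvent z T)) S <->
  exists S1 S2 S3 : B,
    is_RInt_gen (V := real_module B) (ray_form B F (stolz_c0 b) (stolz_c1 b) (PI / 2 - b))
      (at_right 0) (at_point (cos b)) S1 /\
    is_Int (V := B) (arc_form B F (stolz_c0 b) (stolz_c1 b) (cos b)) (PI / 2 - b) (3 * PI / 2 + b) S2 /\
    is_RInt_gen (V := real_module B) (ray_form B F (stolz_c0 b) (stolz_c1 b) (3 * PI / 2 + b))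
      (at_point (cos b)) (at_right 0) S3 /\
    S = plus S1 (plus S2 S3).
Proof.
intros Hb F.
assert (Hc := cos_b_pos b Hb).
assert (E : forall u v, stolz_circ b v = cis u ->
  (fun t => scal (velocity (fun t0 => 1 - RtoC t0 * cis u)%C t : C_AbsRing)
     (scal (phi (1 - RtoC t * cis u)%C : C_AbsRing) (resolvent (1 - RtoC t * cis u)%C T)))
  = ray_form B F (stolz_c0 b) (stolz_c1 b) v).
{ intros u v Huv; apply functional_extensionality; intros t; rewrite velocity_segment.
  unfold ray_form; fold (stolz_circ b v); rewrite Huv.
  unfold F, res_T.
  set (v1 := resolvent (1 - RtoC t * cis u)%C T); set (k := phi (1 - RtoC t * cis u)%C).
  change ((- cis u)%C *: (k *: (v1 : B)) = cis u *: (k *: opp (v1 : B))); module B. }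
assert (E2 : (fun t => scal (velocity (fun t0 => RtoC (sin b) * cis t0)%C t : C_AbsRing)
     (scal (phi (RtoC (sin b) * cis t)%C : C_AbsRing) (resolvent (RtoC (sin b) * cis t)%C T)))
  = arc_form B F (stolz_c0 b) (stolz_c1 b) (cos b)).
{ apply functional_extensionality; intros t; rewrite velocity_circle.
  assert (Ep : (RtoC (sin b) * cis t = 1 - RtoC (cos b) * stolz_circ b t)%C).
  { rewrite stolz_circ_eq by assumption; replace (cos b / cos b) with 1 by (field; lra); ring. }
  assert (Ed : (RtoC (cos b) * dcirc (stolz_c1 b) t = - (RtoC (sin b) * (Ci * cis t)))%C).
  { unfold dcirc, stolz_c1; rewrite Cmult_assoc, <- RtoC_mult.
    replace (cos b * - (sin b / cos b)) with (- sin b) by (field; lra); rewrite RtoC_opp; ring. }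
  rewrite Ep; unfold arc_form; rewrite Ed; fold (stolz_circ b t); unfold F, res_T.
  set (v1 := resolvent (1 - RtoC (cos b) * stolz_circ b t)%C T); set (k := phi (1 - RtoC (cos b) * stolz_circ b t)%C).
  set (w := (RtoC (sin b) * (Ci * cis t))%C).
  change (w *: (k *: (v1 : B)) = (- w)%C *: (k *: opp (v1 : B))); module B. }
unfold is_stolz_boundary_integral, is_path_integral.
rewrite (E (- b) (PI / 2 - b) (stolz_circ_start b Hb)), (E b (3 * PI / 2 + b) (stolz_circ_end b Hb)), E2.
split; intros (S1 & S2 & S3 & H1 & H2 & H3 & H4); exists S1, S2, S3;
  (split; [exact H1|split; [|split; [exact H3|exact H4]]]).
- exact (proj1 (is_RInt_gen_at_point (V := real_module B) _ _ _ _) H2).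
- exact (proj2 (is_RInt_gen_at_point (V := real_module B) _ _ _ _) H2).
Qed.

Lemma ritt_type_resolvent (alpha b : R) : Ritt_type T alpha -> alpha < b < PI / 2 ->
  exists M, 0 <= M /\ forall z, ~ plane_closure (stolz b) (1 - z)%C ->
    @ba_resolvent B z A (res_T z) /\ Cmod z * norm (res_T z : B) <= M.
Proof.
intros (Ha & _ & Hs & Hb0) Hb; destruct (Hb0 b Hb) as [M HM].
pose proof PI_RGT_0 as HPI.
exists (Rmax 0 M); split; [apply Rmax_l|]; intros z Hz.
assert (Hsin : sin alpha <= sin b) by (apply Rlt_le, sin_increasing_1; lra).
assert (H1 : @ba_resolvent B (1 - z)%C T (resolvent (1 - z)%C T)).
{ apply not_spectrum; intros H; apply Hz.
  apply (plane_closure_mono (stolz alpha)); [intros w; now apply stolz_mono|now apply Hs]. }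
split; [exact (ba_resolvent_reflect B T z _ H1)|].
eapply Rle_trans; [|apply Rmax_r].
eapply Rle_trans; [|exact (HM _ Hz)].
change (Cmod z * norm (opp (resolvent (1 - z)%C T : B)) <= norm ((1 - z - 1)%C *: (resolvent (1 - z)%C T : B))).
rewrite norm_opp, norm_Cscal_eq.
replace (1 - z - 1)%C with (- z)%C by ring; rewrite Cmod_opp; apply Rle_refl.
Qed.

Lemma sectorial_of_ritt_type (alpha : R) : Ritt_type T alpha -> sectorial_type A alpha.
Proof.
intros HT; pose proof PI_RGT_0 as HPI; assert (HT' := HT); destruct HT' as (Ha & _ & Hs & _).
split; [lra|split].
- intros z Hz; apply closure_stolz_sector; [assumption|]; apply Hs; intros [s H]; apply Hz.
  exists (opp s); exact (ba_resolvent_reflect B T z s H).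
- intros nu Hnu.
  (* The Ritt type controls angles below pi/2 only, while [nu] ranges up to pi; a smaller sector
     gives the stronger bound. *)
  set (nu' := Rmin nu ((alpha + PI / 2) / 2)).
  assert (Hnu1 : alpha < nu') by (apply Rmin_glb_lt; lra).
  assert (Hnu2 : nu' <= nu) by apply Rmin_l.
  assert (Hnu3 : nu' <= (alpha + PI / 2) / 2) by apply Rmin_r.
  destruct (ritt_type_resolvent alpha nu' HT ltac:(lra)) as [M [_ HM]].
  exists M; intros z Hz.
  destruct (HM z) as [H1 H2].
  { intros H; apply Hz; apply (plane_closure_mono (sector nu')).
    - intros w [Hw1 Hw2]; split; [assumption|lra].
    - apply closure_stolz_sector; [lra|exact H]. }
  eapply Rle_trans; [|exact H2].
  rewrite <- (res_A_T z _ H1), <- norm_Cscal_eq; apply Rle_refl.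
Qed.

Lemma sector_calculus_of_stolz (g alpha nu : R) (f : C -> C) (S : bounded_op X) :
  Ritt_type T alpha -> alpha < nu < g -> g < PI / 2 -> H0_sector g f ->
  is_stolz_calculus T (fun w => f (1 - w)%C) nu S -> is_sector_calculus A f nu S.
Proof.
intros HT Hnu Hg Hf (I & HI & HS).
pose proof PI_RGT_0 as HPI; assert (Ha : 0 < alpha < PI / 2) by apply HT.
assert (Hn : 0 < nu < PI / 2) by lra.
exists I; split; [|exact HS].
apply (proj2 (sector_boundary_iff nu (fun z => scal (f z : C_AbsRing) (resolvent z A)) I)).
apply (proj1 (stolz_boundary_iff nu (fun w => f (1 - w)%C) I Hn)) in HI.
destruct HI as (S1 & S2 & S3 & H1 & H2 & H3 & H4).
assert (EF : (fun z => f (1 - (1 - z))%C *: res_T z) = (fun z => f z *: res_T z)).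
{ apply functional_extensionality; intros z; now replace (1 - (1 - z))%C with z by ring. }
rewrite EF in H1, H2, H3.
set (b' := (alpha + nu) / 2).
destruct (ritt_type_resolvent alpha b' HT ltac:(unfold b'; lra)) as [M [HM0 HM]].
destruct (rays_of_stolz_boundary B A res_T res_T_spec g b' nu M f S1 S2 S3
  ltac:(unfold b'; lra) ltac:(lra) HM0 HM Hf H1 H2 H3) as (Q1 & Q0 & G1 & G0 & E).
assert (Hext : forall v, cos v = cos nu -> forall t, 0 < t ->
  f (RtoC t * circ (RtoC 0) (RtoC 1) v)%C *: res_T (RtoC t * circ (RtoC 0) (RtoC 1) v)%C
  = f (RtoC t * circ (RtoC 0) (RtoC 1) v)%C *: res_A (RtoC t * circ (RtoC 0) (RtoC 1) v)%C).
{ intros v Hv t Ht; rewrite circ_unit.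
  destruct (HM (RtoC t * cis v)%C) as [R _]; [|now rewrite (res_A_T _ _ R)].
  intros Hcl; apply closure_stolz_cone in Hcl; [|unfold b'; lra].
  replace (1 - (1 - RtoC t * cis v))%C with (RtoC t * cis v)%C in Hcl by ring.
  rewrite Cmod_scal_cis, Re_scal_cis, Hv in Hcl by lra.
  assert (cos nu < cos b') by (apply cos_decreasing_1; unfold b'; lra); nra. }
exists Q1, Q0; split; [|split].
- exact (is_RInt_gen_ray_ext B _ _ _ _ nu _ _ _ _ _ infty_pos at_right_pos (Hext nu eq_refl) G1).
- exact (is_RInt_gen_ray_ext B _ _ _ _ (- nu) _ _ _ _ _ at_right_pos infty_pos (Hext (- nu) (cos_neg nu)) G0).
- rewrite H4; exact E.
Qed.

Theorem sector_of_stolz (g : R) : 0 < g < PI / 2 ->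
  bounded_stolz_calculus T g -> bounded_sector_calculus A g.
Proof.
intros Hg (alpha & Ha & HT & K & HK & Hcal).
exists alpha; split; [assumption|split; [now apply sectorial_of_ritt_type|]].
exists K; split; [assumption|]; intros f Hf nu Hnu.
assert (Hphi : H0_stolz g (fun w => f (1 - w)%C)).
{ destruct Hf as (Hf1 & [Mb Hf2] & (p & c & Hp & Hc & Hf3)); split; [|split].
  - intros w Hw; apply cdiffable_ex_derive.
    apply (cdiffable_reflect (V := C_NormedModule) f), cdiffable_ex_derive, Hf1.
    now apply stolz_sector.
  - exists Mb; intros w Hw; now apply Hf2, stolz_sector.
  - exists p, c; split; [assumption|split; [assumption|]]; intros w Hw.
    eapply Rle_trans; [now apply Hf3, stolz_sector|].
    apply Rmult_le_compat_l; [lra|].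
    (* The claim is q/(1 + q^2) <= q for q = |1-w|^p. *)
    assert (H1 : 0 < Rpower (Cmod (1 - w)%C) p) by apply exp_pos.
    assert (H2 : 0 < Rpower (Cmod (1 - w)%C) (2 * p)) by apply exp_pos.
    apply Rmult_le_reg_r with (1 + Rpower (Cmod (1 - w)%C) (2 * p)); [lra|].
    unfold Rdiv; rewrite Rmult_assoc, Rinv_l, Rmult_1_r by lra; nra. }
destruct (Hcal _ Hphi nu Hnu) as [S [HS1 HS2]].
exists S; split; [now apply (sector_calculus_of_stolz g alpha)|].
eapply Rle_trans; [exact HS2|]; apply Rmult_le_compat_l; [lra|].
pose proof PI_RGT_0.
apply sup_norm_on_le.
(* The supremum is nonnegative because the sector contains the point 1. *)
- apply Rle_trans with (Cmod (f (RtoC 1))); [apply Cmod_ge_0|].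
  apply sup_norm_on_ge; [apply Hf|]; apply sector_iff; [lra|].
  rewrite Cmod_1; unfold Re; simpl; rewrite Rmult_1_l, <- cos_0; apply cos_decreasing_1; lra.
- intros w Hw; apply (sup_norm_on_ge (sector g) f); [apply Hf|now apply stolz_sector].
Qed.

End SectorCalculus.

(** * From the sector to the Stolz domain *)

(** Rescaled to modulus cos a0, a point v of the cone has Re v >= cos^2 a0, so |1-v|^2 <= 1 - cos^2
    a0 = sin^2 a0: it lies in the disc, and z lies on the segment from it to the vertex. *)
Lemma cone_in_closure_stolz (a0 b : R) (z : C) : 0 < a0 <= b -> b < PI / 2 ->
  cos a0 * Cmod z <= Re z -> Cmod z <= cos a0 -> plane_closure (stolz b) (1 - z)%C.
Proof.
intros Ha Hb Hz1 Hz2; pose proof PI_RGT_0.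
assert (Hc : 0 < cos a0) by (apply cos_gt_0; lra).
assert (Hs : 0 < sin a0 <= sin b).
{ split; [apply sin_gt_0; lra|apply sin_incr_1; lra]. }
assert (Hsc := sin2_cos2 a0); unfold Rsqr in Hsc.
destruct (classic (z = RtoC 0)) as [-> | Hz].
- replace (1 - RtoC 0)%C with (1 - RtoC 0 * (1 - RtoC 0))%C by ring.
  apply closure_stolz_intro; [lra|lra|rewrite Cmod_0; lra].
- assert (Hp : 0 < Cmod z) by now apply Cmod_gt_0.
  set (s := Cmod z / cos a0).
  assert (Hs0 : 0 < s) by (apply Rdiv_lt_0_compat; lra).
  assert (Hs1 : s <= 1).
  { unfold s; apply Rmult_le_reg_r with (cos a0); [assumption|].
    unfold Rdiv; rewrite Rmult_assoc, Rinv_l by lra; lra. }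
  assert (Hsn : RtoC s <> RtoC 0) by (intros E; apply RtoC_inj in E; lra).
  replace (1 - z)%C with (1 - RtoC s * (1 - (1 - RtoC (/ s) * z)))%C.
  2: { rewrite RtoC_inv by lra; field; exact Hsn. }
  apply closure_stolz_intro; [lra|lra|].
  apply Rle_trans with (sin a0); [|lra].
  apply Rsqr_incr_0; [|apply Cmod_ge_0|lra].
  rewrite !Rsqr_pow2, <- Re_sq_Im_sq.
  replace (Re (1 - RtoC (/ s) * z)%C) with (1 - / s * Re z) by (unfold Re; simpl; ring).
  replace (Im (1 - RtoC (/ s) * z)%C) with (- (/ s * Im z)) by (unfold Im; simpl; ring).
  assert (E := Re_sq_Im_sq z).
  assert (Es : / s * Cmod z = cos a0) by (unfold s; field; lra).
  assert (Es2 : (/ s * Re z) ^ 2 + (/ s * Im z) ^ 2 = cos a0 ^ 2).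
  { rewrite <- Es, !Rpow_mult_distr, <- E; ring. }
  assert (Hi : 0 < / s) by now apply Rinv_0_lt_compat.
  assert (Hre : cos a0 * cos a0 <= / s * Re z).
  { rewrite <- Es at 2; replace (cos a0 * (/ s * Cmod z)) with (/ s * (cos a0 * Cmod z)) by ring.
    apply Rmult_le_compat_l; lra. }
  set (x := / s * Re z) in *; set (y := / s * Im z) in *; nra.
Qed.

Lemma disc_in_closure_stolz (b : R) (w : C) : 0 < sin b -> Cmod w <= sin b -> plane_closure (stolz b) w.
Proof.
intros Hb Hw; replace w with (1 - RtoC 1 * (1 - w))%C by ring.
apply closure_stolz_intro; lra.
Qed.

Section Region.

Variable B : banach_algebra.
Variable a : B.
Variable r : C -> B.
Hypothesis Hr : forall z s, ba_resolvent z a s -> ba_resolvent z a (r z).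

Variables a0 r0 M : R.
Hypothesis Ha0 : 0 < a0 < PI / 2.
Hypothesis Hr0 : 0 < r0 < 1.
Hypothesis HM : 0 <= M.
Hypothesis Hcone : forall z, z <> RtoC 0 -> Re z <= cos a0 * Cmod z ->
  ba_resolvent z a (r z) /\ Cmod z * norm (r z) <= M.
Hypothesis Hfar : forall z, r0 <= Cmod (1 - z)%C -> cos a0 <= Cmod z ->
  ba_resolvent z a (r z) /\ Cmod z * norm (r z) <= M.

(** Outside the cone of angle a0 [Hcone] applies. A point of the cone off the closed domain has |z|
    > cos a0 and |1-z| > sin b >= r0, so [Hfar] applies. *)
Lemma outside_stolz_resolvent (b : R) (z : C) : a0 <= b < PI / 2 -> r0 <= sin b ->
  ~ plane_closure (stolz b) (1 - z)%C ->
  ba_resolvent z a (r z) /\ Cmod z * norm (r z) <= M.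
Proof.
intros Hb Hrb Hz.
destruct (Rle_lt_dec (Re z) (cos a0 * Cmod z)) as [H1|H1].
- apply Hcone; [|assumption]; intros E; apply Hz; rewrite E.
  apply (cone_in_closure_stolz a0); try lra; rewrite Cmod_0; [unfold Re; simpl; lra|].
  apply Rlt_le, cos_gt_0; lra.
- apply Hfar.
  + apply Rnot_lt_le; intros H2; apply Hz, disc_in_closure_stolz; lra.
  + apply Rnot_lt_le; intros H2; apply Hz, (cone_in_closure_stolz a0); lra.
Qed.

(** The arc lies in the closed domain, out of reach of [outside_stolz_resolvent]. On it 2 Re z =
    |z|^2 + cos^2 b, the power of the point 0; for cos b <= |z| < cos a0 this places z outside the
    cone of angle a0. *)
Lemma arc_resolvent (b u : R) : a0 <= b < PI / 2 -> r0 <= sin b ->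
  PI / 2 - b <= u <= 3 * PI / 2 + b ->
  let z := (RtoC (cos b) * stolz_circ b u)%C in
  ba_resolvent z a (r z) /\ Cmod z * norm (r z) <= M.
Proof.
intros Hb Hrb Hu z.
assert (Hb' : 0 < b < PI / 2) by lra.
assert (Hc := cos_b_pos b Hb'); assert (Hs := sin_b_pos b Hb').
assert (Ez : z = (1 - RtoC (sin b) * cis u)%C).
{ unfold z; rewrite stolz_circ_eq by assumption; replace (cos b / cos b) with 1 by (field; lra); ring. }
assert (Hge := Cmod_one_minus_circle_ge b Hb' u Hu); rewrite <- Ez in Hge.
assert (E1 : Cmod (1 - z)%C = sin b).
{ rewrite Ez; replace (1 - (1 - RtoC (sin b) * cis u))%C with (RtoC (sin b) * cis u)%C by ring.
  apply Cmod_scal_cis; lra. }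
destruct (Rle_lt_dec (cos a0) (Cmod z)) as [H1|H1]; [apply Hfar; lra|].
apply Hcone; [apply (Cmod_ge_neq_0 _ (cos b)); assumption|].
assert (E2 := Cmod_sq_one_minus_circle b u); rewrite <- Ez in E2.
assert (E3 : Re z = 1 - sin b * cos u) by (rewrite Ez; unfold Re; simpl; ring).
assert (Hsc := sin2_cos2 b); unfold Rsqr in Hsc.
assert (Hcb : cos b <= cos a0) by (apply cos_decr_1; pose proof PI_RGT_0; lra).
assert (E4 : 2 * Re z = Cmod z ^ 2 + cos b * cos b) by (rewrite E2, E3; lra).
assert (K1 : 0 <= (Cmod z - cos b) * (cos a0 - Cmod z)) by (apply Rmult_le_pos; lra).
assert (K2 : 0 <= (cos a0 - cos b) * (Cmod z + cos b)) by (apply Rmult_le_pos; lra).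
nra.
Qed.

Section Calculus.

Variables th nu K g : R.
Hypothesis Hth : 0 < th < a0.
Hypothesis Hnu : 0 < nu < th.
Hypothesis HK : 0 <= K.
Hypothesis Hg : a0 < g < PI / 2.
Variable Mn : R.
Hypothesis Hres : forall z, z <> RtoC 0 -> Re z <= cos nu * Cmod z ->
  ba_resolvent z a (r z) /\ Cmod z * norm (r z) <= Mn.
Hypothesis Hcal : forall f, H0_sector th f -> exists l u : B,
  is_RInt_gen (V := real_module B) (ray_form B (fun z => f z *: r z) (RtoC 0) (RtoC 1) (- nu)) (at_right 0) (Rbar_locally p_infty) l /\
  is_RInt_gen (V := real_module B) (ray_form B (fun z => f z *: r z) (RtoC 0) (RtoC 1) nu) (at_right 0) (Rbar_locally p_infty) u /\
  norm (minus l u) <= K * sup_norm_on (sector th) f.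

(** Bounds the modulus tan b of [stolz_c1 b] for all b < g at once, since the calculus demands one
    constant for all contours. *)
Let t1 : R := / cos g.
Definition stolz_bound : R :=
  K * ((8 * PI * t1 + 8 / (cos th - cos a0)) + 4 * PI * t1)
  + 4 * PI * t1 * norm (r (RtoC (-1))) + 2 * PI * t1 * M.

Lemma t1_pos : 0 < t1.
Proof. apply Rinv_0_lt_compat, cos_gt_0; lra. Qed.

Lemma stolz_bound_nonneg : 0 <= stolz_bound.
Proof.
pose proof t1_pos; pose proof PI_RGT_0; pose proof (norm_ge_0 (r (RtoC (-1)))).
assert (cos a0 < cos th) by (apply cos_decreasing_1; lra).
assert (Hpt1 : 0 < PI * t1) by (apply Rmult_lt_0_compat; lra).
assert (0 <= 8 / (cos th - cos a0)) by (apply Rdiv_le_0_compat; lra).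
unfold stolz_bound; repeat apply Rplus_le_le_0_compat.
- apply Rmult_le_pos; lra.
- apply Rmult_le_pos; lra.
- apply Rmult_le_pos; lra.
Qed.

(** The decay of phi at 1 provides convergence of the improper integrals, while the estimate sees
    sup|phi| alone. The segments are bounded jointly by [int_resolvent_bound] and the arc
    directly. *)
Lemma stolz_integral_bound (b : R) (phi : C -> C) : a0 <= b < g -> r0 <= sin b -> H0_stolz g phi ->
  let F := fun z => phi (1 - z)%C *: r z in
  exists S1 S2 S3 : B,
    is_RInt_gen (V := real_module B) (ray_form B F (stolz_c0 b) (stolz_c1 b) (PI / 2 - b))
      (at_right 0) (at_point (cos b)) S1 /\
    is_Int (V := B) (arc_form B F (stolz_c0 b) (stolz_c1 b) (cos b)) (PI / 2 - b) (3 * PI / 2 + b) S2 /\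
    is_RInt_gen (V := real_module B) (ray_form B F (stolz_c0 b) (stolz_c1 b) (3 * PI / 2 + b))
      (at_point (cos b)) (at_right 0) S3 /\
    norm (plus S1 (plus S2 S3)) <= stolz_bound * sup_norm_on (stolz g) phi.
Proof.
intros Hb Hrb (Hp1 & Hp2 & (p & c & Hp & Hc & Hp3)) F.
pose proof PI_RGT_0 as HPI.
assert (Hb' : 0 < b < PI / 2) by lra.
assert (Hcb := cos_b_pos b Hb'); assert (Hsb := sin_b_pos b Hb').
assert (Hsg : sin b < sin g) by (apply sin_increasing_1; lra).
set (N := sup_norm_on (stolz g) phi).
set (Phi := fun z => phi (1 - z)%C).
set (u0 := PI / 2 - b); set (u1 := 3 * PI / 2 + b).
assert (Hu : u0 <= u1 <= u0 + 2 * PI) by (unfold u0, u1; lra).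
assert (HPhi : forall s u, 0 < s <= cos b -> u0 <= u <= u1 ->
  cdiffable (V := C_NormedModule) Phi (RtoC s * stolz_circ b u)%C /\ Cmod (Phi (RtoC s * stolz_circ b u)%C) <= N).
{ intros s u Hs _; assert (Hin := stolz_circ_in_stolz b Hb' g s u Hsg Hs); split.
  - change (cdiffable (V := C_NormedModule) (fun z => phi (1 - z)%C) (RtoC s * stolz_circ b u)%C).
    apply (cdiffable_reflect (V := C_NormedModule) phi), cdiffable_ex_derive, Hp1, Hin.
  - exact (sup_norm_on_ge (stolz g) phi _ Hp2 Hin). }
assert (Hend : forall u, u = u0 \/ u = u1 -> Cmod (stolz_circ b u) = 1 /\ Re (stolz_circ b u) <= cos a0).
{ assert (cos b <= cos a0) by (apply cos_decr_1; lra).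
  intros u [-> | ->]; [unfold u0; rewrite stolz_circ_start by assumption|unfold u1; rewrite stolz_circ_end by assumption];
    rewrite Cmod_cis, Re_cis, ?cos_neg; split; lra. }
assert (Hge : forall u, u0 <= u <= u1 -> 1 <= Cmod (stolz_circ b u)) by (apply Cmod_stolz_circ_ge; assumption).
assert (Hct : cos a0 < cos th) by (apply cos_decreasing_1; lra).
assert (Hca : 0 < cos a0) by (apply cos_gt_0; lra).
assert (HN : 0 <= N).
{ eapply Rle_trans; [apply Cmod_ge_0|apply (HPhi (cos b) u0); lra]. }
set (ray := fun u => ray_form B F (stolz_c0 b) (stolz_c1 b) u).
assert (Hpt : forall t u, 0 < t -> u = u0 \/ u = u1 ->
  Cmod (RtoC t * stolz_circ b u)%C = t /\
  ba_resolvent (RtoC t * stolz_circ b u)%C a (r (RtoC t * stolz_circ b u)%C) /\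
  t * norm (r (RtoC t * stolz_circ b u)%C) <= M).
{ intros t u Ht Hu'; destruct (Hend u Hu') as [E1 E2].
  assert (E : Cmod (RtoC t * stolz_circ b u)%C = t) by (rewrite Cmod_mult, Cmod_R, Rabs_pos_eq, E1 by lra; ring).
  split; [exact E|].
  assert (H := Hcone (RtoC t * stolz_circ b u)%C); rewrite E in H; apply H.
  - apply (Cmod_ge_neq_0 _ t); lra.
  - replace (Re (RtoC t * stolz_circ b u)%C) with (t * Re (stolz_circ b u)) by (unfold Re; simpl; ring); nra. }
assert (Hray_c : forall u, u = u0 \/ u = u1 -> forall t, 0 < t <= cos b -> rcont (ray u) t).
{ intros u Hu' t Ht; apply rcont_ray_form; apply cdiffable_scal.
  - apply HPhi; [assumption|destruct Hu'; lra].
  - apply (cdiffable_resolvent B a r Hr); apply Hpt; [lra|assumption]. }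
assert (Hex : forall u, u = u0 \/ u = u1 -> exists l : B,
  is_RInt_gen (V := real_module B) (ray u) (at_point (cos b)) (at_right 0) l).
{ intros u Hu'.
  apply (is_RInt_gen_zero_local (ba_complete B) (ray u) (cos b) (c * M) p Hcb Hp (Hray_c u Hu')).
  intros t Ht; destruct (Hpt t u ltac:(lra) Hu') as (E1 & _ & E2).
  unfold ray, ray_form; fold (stolz_circ b u).
  rewrite norm_Cscal_eq, (proj1 (Hend u Hu')), Rmult_1_l; unfold F; rewrite norm_Cscal_eq.
  assert (H1 := Hp3 _ (stolz_circ_in_stolz b Hb' g t u Hsg Ht)).
  replace (1 - (1 - RtoC t * stolz_circ b u))%C with (RtoC t * stolz_circ b u)%C in H1 by ring.
  rewrite E1 in H1.
  assert (Hrz : norm (r (RtoC t * stolz_circ b u)%C) <= M * / t).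
  { apply Rmult_le_reg_l with t; [lra|]; replace (t * (M * / t)) with M by (field; lra); exact E2. }
  apply Rle_trans with (c * Rpower t p * (M * / t)).
  - apply Rmult_le_compat; [apply Cmod_ge_0|apply norm_ge_0|exact H1|exact Hrz].
  - right; unfold Rminus; rewrite Rpower_plus, (Rpower_Ropp _ 1), Rpower_1 by lra; ring. }
destruct (Hex u0 ltac:(auto)) as [l0 L0]; destruct (Hex u1 ltac:(auto)) as [l1 L1].
assert (Hbase := int_resolvent_bound B a r Hr th nu Mn K ltac:(lra) Hnu Hres HK Hcal
  (cos a0) (cos b) N (stolz_c0 b) (stolz_c1 b) u0 u1 Phi ltac:(lra) Hcb Hu Hge Hend HPhi).
assert (Hc1 : Cmod (stolz_c1 b) <= t1).
{ unfold stolz_c1; rewrite Cmod_R, Rabs_Ropp, Rabs_pos_eq by (apply Rdiv_le_0_compat; lra).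
  unfold t1; rewrite <- (Rmult_1_l (/ cos g)); unfold Rdiv.
  apply Rmult_le_compat; [lra|apply Rlt_le, Rinv_0_lt_compat; lra|apply SIN_bound|].
  apply Rinv_le_contravar; [apply cos_gt_0; lra|apply Rlt_le, cos_decreasing_1; lra]. }
pose proof (Cmod_ge_0 (stolz_c1 b)) as Hc10.
set (W := K * ((8 * PI * t1 + 8 / (cos th - cos a0)) + 4 * PI * t1)
  + 4 * PI * t1 * norm (r (RtoC (-1)))).
(* The bound at cut-off t is uniform in t, so approximating both improper integrals within e/2 at
   one small t passes it to the limit. They run from cos b down to t, hence the sign in [Hsw]. *)
assert (Hl01 : norm (minus l0 l1) <= W * N).
{ apply le_epsilon; intros e He.
  assert (G0 := is_RInt_gen_point_limit _ _ _ _ _ L0 (e / 2) ltac:(lra)).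
  assert (G1 := is_RInt_gen_point_limit _ _ _ _ _ L1 (e / 2) ltac:(lra)).
  assert (Hsmall : at_right 0 (fun t => 0 < t <= cos b)).
  { exists (mkposreal _ Hcb); intros t Ht Ht0.
    change (Rabs (t - 0) < cos b) in Ht; rewrite Rminus_0_r, Rabs_pos_eq in Ht; lra. }
  destruct (filter_ex _ (filter_and _ _ Hsmall (filter_and _ _ G0 G1))) as [t [Ht [D0 D1]]].
  assert (Hsw : forall u, u = u0 \/ u = u1 -> CInt (ray u) (cos b) t = opp (CInt (ray u) t (cos b))).
  { intros u Hu'; apply Int_eq; apply (is_RInt_swap (V := real_module B)).
    apply (ex_Int (ba_complete B)); [lra|]; intros s Hs; apply Hray_c; [assumption|lra]. }
  rewrite (Hsw u0 ltac:(auto)) in D0; rewrite (Hsw u1 ltac:(auto)) in D1.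
  specialize (Hbase t Ht).
  set (J := CInt (fun s => minus (ray u0 s) (ray u1 s)) t (cos b)).
  assert (EJ : J = minus (CInt (ray u0) t (cos b)) (CInt (ray u1) t (cos b))).
  { apply Int_eq, is_Int_minus; (apply (ex_Int (ba_complete B)); [lra|]); intros s Hs; apply Hray_c; auto; lra. }
  assert (HJ : norm J <= W * N).
  { eapply Rle_trans; [exact Hbase|].
    assert (H8 : 0 <= 8 / (cos th - cos a0)) by (apply Rdiv_le_0_compat; lra).
    pose proof (norm_ge_0 (r (RtoC (-1)))) as Hn1.
    assert (Q1 : PI * Cmod (stolz_c1 b) <= PI * t1) by (apply Rmult_le_compat_l; lra).
    assert (Q2 : PI * Cmod (stolz_c1 b) * N <= PI * t1 * N) by (apply Rmult_le_compat_r; lra).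
    apply Rle_trans with (K * (((8 * PI * t1 + 8 / (cos th - cos a0)) + 4 * PI * t1) * N)
      + 4 * PI * t1 * norm (r (RtoC (-1))) * N); [|right; unfold W; ring].
    apply Rplus_le_compat.
    - apply Rmult_le_compat_l; [assumption|]; lra.
    - change (4 * PI * Cmod (stolz_c1 b) * N * norm (r (RtoC (-1))) <= 4 * PI * t1 * norm (r (RtoC (-1))) * N).
      replace (4 * PI * t1 * norm (r (RtoC (-1))) * N) with (4 * (PI * t1 * N) * norm (r (RtoC (-1)))) by ring.
      replace (4 * PI * Cmod (stolz_c1 b) * N * norm (r (RtoC (-1)))) with (4 * (PI * Cmod (stolz_c1 b) * N) * norm (r (RtoC (-1)))) by ring.
      apply Rmult_le_compat_r; lra. }
  set (v0 := CInt (ray u0) t (cos b)) in *; set (v1 := CInt (ray u1) t (cos b)) in *.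
  apply Rle_trans with (norm (plus (opp J) (plus (opp (minus (opp v0) l0)) (minus (opp v1) l1)))).
  { right; apply (f_equal (@norm C_AbsRing B)); rewrite EJ; module B. }
  replace (W * N + e) with (W * N + (e / 2 + e / 2)) by field.
  apply norm_plus_le; [now apply norm_opp_le|].
  apply norm_plus_le; [apply norm_opp_le, Rlt_le, D0|apply Rlt_le, D1]. }
set (arc := arc_form B F (stolz_c0 b) (stolz_c1 b) (cos b)).
assert (Harc : is_Int (V := B) arc u0 u1 (CInt arc u0 u1)).
{ apply (ex_Int (ba_complete B)); [lra|]; intros u Hu'; apply rcont_arc_form; apply cdiffable_scal.
  - apply HPhi; [lra|assumption].
  - apply (cdiffable_resolvent B a r Hr).
    apply (arc_resolvent b u); [lra|assumption|exact Hu']. }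
assert (Hna : norm (CInt arc u0 u1) <= 2 * PI * t1 * M * N).
{ pose proof t1_pos.
  apply Rle_trans with ((u1 - u0) * (t1 * (N * M))).
  - apply (norm_is_Int_le arc u0 u1); [lra| |exact Harc].
    intros u Hu'; unfold arc, arc_form; fold (stolz_circ b u).
    rewrite norm_Cscal_eq, Cmod_mult, Cmod_R, Rabs_pos_eq, Cmod_dcirc by lra.
    destruct (arc_resolvent b u ltac:(lra) Hrb Hu') as [_ H1].
    set (z := (RtoC (cos b) * stolz_circ b u)%C) in *.
    assert (Hz : cos b <= Cmod z).
    { unfold z; rewrite Cmod_mult, Cmod_R, Rabs_pos_eq by lra; specialize (Hge u Hu'); nra. }
    unfold F; rewrite norm_Cscal_eq; change (phi (1 - z)%C) with (Phi z).
    assert (HPz : Cmod (Phi z) <= N) by (apply HPhi; [lra|assumption]).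
    pose proof (norm_ge_0 (r z)) as Hn0; pose proof (Cmod_ge_0 (Phi z)).
    (* Since |z| >= cos b on the arc, the resolvent bound absorbs the factor cos b in the speed of
       the parametrization. *)
    assert (H2 : cos b * norm (r z) <= M).
    { eapply Rle_trans; [|exact H1]; apply Rmult_le_compat_r; assumption. }
    replace (cos b * Cmod (stolz_c1 b) * (Cmod (Phi z) * norm (r z)))
      with (Cmod (stolz_c1 b) * (Cmod (Phi z) * (cos b * norm (r z)))) by ring.
    apply Rmult_le_compat; [assumption|apply Rmult_le_pos; [assumption|apply Rmult_le_pos; lra]|assumption|].
    apply Rmult_le_compat; [assumption|apply Rmult_le_pos; lra|assumption|assumption].
  - apply Rle_trans with (2 * PI * (t1 * (N * M))); [|right; ring].
    apply Rmult_le_compat_r; [repeat apply Rmult_le_pos; lra|lra]. }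
set (S2 := CInt arc u0 u1) in *.
exists (opp l0), S2, l1; split; [|split; [exact Harc|split; [exact L1|]]].
- exact (is_RInt_gen_swap (V := real_module B) _ _ L0).
- apply Rle_trans with (norm (plus (opp (minus l0 l1)) S2)).
  + right; apply (f_equal (@norm C_AbsRing B)); module B.
  + fold N; replace (stolz_bound * N) with (W * N + 2 * PI * t1 * M * N) by (unfold stolz_bound, W; ring).
    apply norm_plus_le; [now apply norm_opp_le|exact Hna].
Qed.

End Calculus.
End Region.

Section Converse.

Variable X : NormedModule C_AbsRing.
Hypothesis CX : norm_complete X.
Variable T : bounded_op X.

Let B : banach_algebra := operator_algebra X CX.
Let A : bounded_op X := minus one T.

Notation res_A := (res_A X CX T).
Notation res_T := (res_T X CX T).

(** Sectoriality speaks of complements of closed sectors, whereas the boundary rays of angle nu are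
    included here; the intermediate angle [mu] leaves room for them. *)
Lemma sectorial_resolvent (om nu : R) : sectorial_type A om -> om < nu < PI ->
  exists M, 0 <= M /\ forall z, z <> RtoC 0 -> Re z <= cos nu * Cmod z ->
    @ba_resolvent B z A (res_T z) /\ Cmod z * norm (res_T z) <= M.
Proof.
intros (Hom & Hs & Hb) Hnu.
set (mu := (om + nu) / 2).
destruct (Hb mu ltac:(unfold mu; lra)) as [M HM].
exists (Rmax 0 M); split; [apply Rmax_l|]; intros z Hz0 Hz.
assert (Hp : 0 < Cmod z) by now apply Cmod_gt_0.
assert (Hout : forall k, om <= k <= mu -> ~ plane_closure (sector k) z).
{ intros k Hk Hcl; apply closure_sector_cone in Hcl; [|unfold mu in Hk; lra].
  assert (cos nu < cos k) by (apply cos_decreasing_1; unfold mu in Hk; lra); nra. }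
assert (R : @ba_resolvent B z A (res_A z)).
{ apply (not_spectrum X CX); intros H; apply (Hout om); [unfold mu; lra|now apply Hs]. }
rewrite <- (res_A_T X CX T z _ R).
split; [exact R|].
eapply Rle_trans; [|apply Rmax_r].
eapply Rle_trans; [|apply (HM z), Hout; unfold mu; lra].
rewrite <- norm_Cscal_eq; apply Rle_refl.
Qed.

Lemma pow_n_ba_pow n : pow_n T n = @ba_pow B T n.
Proof. induction n as [|n IH]; [reflexivity|]; simpl; now rewrite IH. Qed.

Lemma ritt_resolvent (e : R) : is_Ritt T -> 0 < e ->
  exists r0 M, 0 < r0 < 1 /\ 0 <= M /\ forall z, r0 <= Cmod (1 - z)%C -> e <= Cmod z ->
    @ba_resolvent B z A (res_T z) /\ Cmod z * norm (res_T z) <= M.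
Proof.
intros [_ [M HM]] He.
destruct (ritt_resolvent_bound B T M) with (e := e) as (r0 & K & Hr0 & HK & H); [|exact He|].
- intros n; specialize (HM (S n) ltac:(lia)).
  replace (S n - 1)%nat with n in HM by lia; rewrite !pow_n_ba_pow in HM; exact HM.
- exists r0, K; split; [assumption|split; [assumption|]]; intros z Hz1 Hz2.
  destruct (H (1 - z)%C Hz1) as (s & Hs1 & Hs2).
  { replace (1 - z - 1)%C with (- z)%C by ring; now rewrite Cmod_opp. }
  assert (R := ba_resolvent_reflect B T z s Hs1).
  assert (R' := res_T_spec X CX T z _ R).
  split; [exact R'|].
  rewrite (ba_inverse_unique B _ _ _ R' R), norm_opp.
  replace (1 - z - 1)%C with (- z)%C in Hs2 by ring; now rewrite Cmod_opp in Hs2.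
Qed.

(** [is_Ritt] carries no angle. A type is read off from the two regions where the resolvent is
    controlled: [al] must be at least a0 for the cone and satisfy r0 <= sin al for the disc. *)
Lemma ritt_type_of_region (a0 r0 M al : R) : 0 < a0 < PI / 2 ->
  (forall z, z <> RtoC 0 -> Re z <= cos a0 * Cmod z ->
    @ba_resolvent B z A (res_T z) /\ Cmod z * norm (res_T z) <= M) ->
  (forall z, r0 <= Cmod (1 - z)%C -> cos a0 <= Cmod z ->
    @ba_resolvent B z A (res_T z) /\ Cmod z * norm (res_T z) <= M) ->
  0 < r0 < 1 -> is_Ritt T -> a0 <= al < PI / 2 -> r0 <= sin al -> Ritt_type T al.
Proof.
intros Ha0 Hcone Hfar Hr0 HT Hal Hral; pose proof PI_RGT_0.
assert (Hout := outside_stolz_resolvent B A res_T a0 r0 M Ha0 Hr0 Hcone Hfar).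
split; [lra|split; [assumption|split]].
- intros w Hw; apply NNPP; intros Hcl; apply Hw.
  destruct (Hout al (1 - w)%C Hal Hral) as [R _].
  { replace (1 - (1 - w))%C with w by ring; exact Hcl. }
  exists (opp (res_T (1 - w)%C)).
  assert (R' := ba_resolvent_reflect_inv B T (1 - w)%C _ R).
  replace (1 - (1 - w))%C with w in R' by ring; exact R'.
- intros b Hb; exists M; intros w Hw.
  assert (Hsb : sin al < sin b) by (apply sin_increasing_1; lra).
  destruct (Hout b (1 - w)%C ltac:(lra) ltac:(lra)) as [_ H1].
  { replace (1 - (1 - w))%C with w by ring; exact Hw. }
  eapply Rle_trans; [|exact H1].
  unfold Submission.res_T; replace (1 - (1 - w))%C with w by ring.
  rewrite norm_opp, <- Cmod_opp; replace (- (1 - w))%C with (w - 1)%C by ring.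
  rewrite <- norm_Cscal_eq; apply Rle_refl.
Qed.

Lemma sector_calculus_rays (om th nu K Mn : R) :
  (forall f, H0_sector th f -> forall nu, om < nu < th -> exists S : bounded_op X,
     is_sector_calculus A f nu S /\ norm S <= K * sup_norm_on (sector th) f) ->
  om < nu < th -> 
  (forall z, z <> RtoC 0 -> Re z <= cos nu * Cmod z ->
    @ba_resolvent B z A (res_T z) /\ Cmod z * norm (res_T z) <= Mn) ->
  forall f, H0_sector th f -> exists l u : B,
  is_RInt_gen (V := real_module B) (ray_form B (fun z => f z *: res_T z) (RtoC 0) (RtoC 1) (- nu)) (at_right 0) (Rbar_locally p_infty) l /\
  is_RInt_gen (V := real_module B) (ray_form B (fun z => f z *: res_T z) (RtoC 0) (RtoC 1) nu) (at_right 0) (Rbar_locally p_infty) u /\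
  norm (minus l u) <= 2 * PI * K * sup_norm_on (sector th) f.
Proof.
intros Hcal Hnu Hres f Hf; pose proof PI_RGT_0 as HPI.
destruct (Hcal f Hf nu Hnu) as (S & (I & HI & HS) & Hn).
apply (proj1 (sector_boundary_iff X CX nu (fun z => scal (f z : C_AbsRing) (resolvent z A)) I)) in HI.
destruct HI as (S1 & S2 & H1 & H2 & H3).
assert (Hext : forall v, cos v = cos nu -> forall t, 0 < t ->
  f (RtoC t * circ (RtoC 0) (RtoC 1) v)%C *: res_A (RtoC t * circ (RtoC 0) (RtoC 1) v)%C
  = f (RtoC t * circ (RtoC 0) (RtoC 1) v)%C *: res_T (RtoC t * circ (RtoC 0) (RtoC 1) v)%C).
{ intros v Hv t Ht; rewrite circ_unit.
  assert (E := Cmod_scal_cis t v (Rlt_le _ _ Ht)).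
  destruct (Hres (RtoC t * cis v)%C) as [R _]; [| |now rewrite (res_A_T X CX T _ _ R)].
  - apply (Cmod_ge_neq_0 _ t); lra.
  - rewrite E, Re_scal_cis, Hv; lra. }
(* [S1] runs inward along the upper ray; its opposite is the outward integral, and l - u becomes S1
   + S2. *)
exists S2, (opp S1); split; [|split].
- exact (is_RInt_gen_ray_ext B _ _ _ _ (- nu) _ _ _ _ _ at_right_pos infty_pos (Hext (- nu) (cos_neg nu)) H2).
- exact (is_RInt_gen_ray_ext B _ _ _ _ nu _ _ _ _ _ at_right_pos infty_pos (Hext nu eq_refl)
    (is_RInt_gen_swap (V := real_module B) _ _ H1)).
- assert (HS' : S = (/ (2 * RtoC PI * Ci))%C *: plus S1 S2) by (rewrite HS, H3; reflexivity).
  assert (Hn' : norm ((/ (2 * RtoC PI * Ci))%C *: plus S1 S2) <= K * sup_norm_on (sector th) f).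
  { rewrite <- HS'; exact Hn. }
  rewrite norm_Cscal_eq in Hn'.
  assert (E : Cmod (2 * RtoC PI * Ci)%C = 2 * PI) by (rewrite !Cmod_mult, Cmod_Ci, !Cmod_R, !Rabs_pos_eq by lra; ring).
  rewrite Cmod_inv, E in Hn' by (apply (Cmod_ge_neq_0 _ (2 * PI)); lra).
  apply Rle_trans with (norm (plus S1 S2)).
  + right; apply (f_equal (@norm C_AbsRing B)); module B.
  + apply Rmult_le_reg_l with (/ (2 * PI)); [apply Rinv_0_lt_compat; lra|].
    replace (/ (2 * PI) * (2 * PI * K * sup_norm_on (sector th) f)) with (K * sup_norm_on (sector th) f) by (field; lra).
    exact Hn'.
Qed.

Lemma stolz_calculus_of_integrals (b Kb : R) (phi : C -> C) : 0 < b < PI / 2 ->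
  (exists S1 S2 S3 : B,
    is_RInt_gen (V := real_module B) (ray_form B (fun z => phi (1 - z)%C *: res_T z) (stolz_c0 b) (stolz_c1 b) (PI / 2 - b))
      (at_right 0) (at_point (cos b)) S1 /\
    is_Int (V := B) (arc_form B (fun z => phi (1 - z)%C *: res_T z) (stolz_c0 b) (stolz_c1 b) (cos b)) (PI / 2 - b) (3 * PI / 2 + b) S2 /\
    is_RInt_gen (V := real_module B) (ray_form B (fun z => phi (1 - z)%C *: res_T z) (stolz_c0 b) (stolz_c1 b) (3 * PI / 2 + b))
      (at_point (cos b)) (at_right 0) S3 /\
    norm (plus S1 (plus S2 S3)) <= Kb) ->
  exists S : bounded_op X, is_stolz_calculus T phi b S /\ norm S <= Kb.
Proof.
intros Hb (S1 & S2 & S3 & H1 & H2 & H3 & H4); pose proof PI_RGT_0 as HPI.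
exists (scal (/ (2 * RtoC PI * Ci))%C (plus S1 (plus S2 S3) : bounded_op X)); split.
- exists (plus S1 (plus S2 S3)); split; [|reflexivity].
  apply (proj2 (stolz_boundary_iff X CX T b phi _ Hb)).
  exists S1, S2, S3; exact (conj H1 (conj H2 (conj H3 eq_refl))).
- assert (H2pi : Cmod (/ (2 * RtoC PI * Ci))%C <= 1).
  { apply Cmod_Cinv_le_1; rewrite !Cmod_mult, Cmod_Ci, !Cmod_R, !Rabs_pos_eq by lra; pose proof PI2_1; lra. }
  change (norm ((/ (2 * RtoC PI * Ci))%C *: plus S1 (plus S2 S3)) <= Kb); rewrite norm_Cscal_eq.
  rewrite <- (Rmult_1_l Kb).
  apply Rmult_le_compat; [apply Cmod_ge_0|apply norm_ge_0|assumption|assumption].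
Qed.

(** The angles satisfy om < nu < th < a0 <= al < g < pi/2: [nu] carries the contour of the given
    calculus, and the gap between th and a0 keeps the Stolz segments away from the sector where
    scalar functions are estimated. *)
Theorem stolz_of_sector (th : R) : is_Ritt T -> 0 < th < PI / 2 -> bounded_sector_calculus A th ->
  exists g, 0 < g < PI / 2 /\ bounded_stolz_calculus T g.
Proof.
intros HT Hth (om & Hom & HA & K & HK & Hcal).
pose proof PI_RGT_0 as HPI; assert (Hom0 : 0 < om) by apply HA.
set (nu := (om + th) / 2).
assert (Hnu : om < nu < th) by (unfold nu; lra).
destruct (sectorial_resolvent om nu HA ltac:(lra)) as (Mn & HMn & Hres).
set (a0 := (th + PI / 2) / 2).
assert (Ha0 : th < a0 < PI / 2) by (unfold a0; lra).
assert (Hca : 0 < cos a0) by (apply cos_gt_0; lra).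
destruct (ritt_resolvent (cos a0) HT Hca) as (r0 & M2 & Hr0 & HM2 & Hfar).
set (M := Rmax Mn M2).
assert (Hcone' : forall z, z <> RtoC 0 -> Re z <= cos a0 * Cmod z ->
  @ba_resolvent B z A (res_T z) /\ Cmod z * norm (res_T z) <= M).
{ intros z Hz0 Hz; assert (cos a0 < cos nu) by (apply cos_decreasing_1; lra).
  destruct (Hres z Hz0) as [R1 R2]; [pose proof (Cmod_ge_0 z); nra|].
  split; [exact R1|]; eapply Rle_trans; [exact R2|apply Rmax_l]. }
assert (Hfar' : forall z, r0 <= Cmod (1 - z)%C -> cos a0 <= Cmod z ->
  @ba_resolvent B z A (res_T z) /\ Cmod z * norm (res_T z) <= M).
{ intros z H1 H2; destruct (Hfar z H1 H2) as [R1 R2]; split; [exact R1|].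
  eapply Rle_trans; [exact R2|apply Rmax_r]. }
assert (HM : 0 <= M) by (eapply Rle_trans; [exact HMn|apply Rmax_l]).
(* The closed domain of angle [al] must contain the disc of radius r0, where the Ritt condition
   gives no bound. *)
set (al := Rmax a0 (asin r0)).
assert (Hasin := asin_bound_lt r0 ltac:(lra)).
assert (Hal1 : a0 <= al) by apply Rmax_l.
assert (Hal2 : al < PI / 2) by (apply Rmax_lub_lt; lra).
assert (Hsal : r0 <= sin al).
{ rewrite <- (sin_asin r0) by lra; apply sin_incr_1; try lra; apply Rmax_r. }
set (g := (al + PI / 2) / 2).
assert (Hg : al < g < PI / 2) by (unfold g; lra).
exists g; split; [lra|].
exists al; split; [lra|split].
{ apply (ritt_type_of_region a0 r0 M); try assumption; lra. }
set (bd := stolz_bound B res_T a0 M th (2 * PI * K) g).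
assert (HK2 : 0 <= 2 * PI * K) by (apply Rmult_le_pos; lra).
assert (Hbd : 0 <= bd) by (apply (stolz_bound_nonneg B res_T a0 M) with (nu := nu); lra).
(* The constant of a calculus has to be positive, while [bd] is only known to be nonnegative. *)
exists (bd + 1); split; [lra|]; intros phi Hphi b Hb.
assert (Hsb : r0 <= sin b).
{ eapply Rle_trans; [exact Hsal|]; apply Rlt_le, sin_increasing_1; lra. }
assert (Hb' : 0 < b < PI / 2) by lra.
destruct (stolz_calculus_of_integrals b _ phi Hb' (stolz_integral_bound B A res_T (res_T_spec X CX T)
  a0 r0 M ltac:(lra) HM Hcone' Hfar' th nu (2 * PI * K) g
  ltac:(lra) ltac:(lra) HK2 ltac:(lra) Mn Hres (sector_calculus_rays om th nu K Mn Hcal Hnu Hres)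
  b phi ltac:(lra) Hsb Hphi)) as [S [HS1 HS2]].
exists S; split; [exact HS1|]; eapply Rle_trans; [exact HS2|].
apply Rmult_le_compat_r; [|fold bd; lra].
eapply Rle_trans; [apply Cmod_ge_0|].
apply (sup_norm_on_ge (stolz g) phi (1 - RtoC (cos b) * stolz_circ b 0)%C); [apply Hphi|].
apply stolz_circ_in_stolz; [assumption|apply sin_increasing_1; lra|].
split; [now apply cos_b_pos|lra].
Qed.

End Converse.

Theorem proposition4p1 :
  forall (X : CompleteNormedModule C_AbsRing) (T : bounded_op X),
    is_Ritt T ->
    ((exists gamma : R, 0 < gamma < PI / 2 /\ bounded_stolz_calculus T gamma) <->
     (exists theta : R, 0 < theta < PI / 2 /\
        bounded_sector_calculus (minus one T) theta)).
Proof.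
intros X T HT; assert (CX := complete_norm_complete X); split.
- intros [g [Hg Hcal]]; exists g; split; [assumption|].
  exact (sector_of_stolz X CX T g Hg Hcal).
- intros [th [Hth Hcal]]; exact (stolz_of_sector X CX T th HT Hth Hcal).
Qed.
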